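(* Let $n \geq 2$ and $p,q \geq 0$ be integers. Then $$\boldsymbol{\lambda}\big(\mathfrak{P}_{p,q}(\mathbb{S}^{n-1})\big) = \frac{\Gamma(n + p \vee q )}{\Gamma(n-1)\,\Gamma( 1 + p \vee q )} \int_{0}^{1} (1-t)^{n-2}\, t^{\frac{|p-q|}{2}} \,\big| P_{p\wedge q}^{n-1,|p-q|}(2t -1)\big|\, dt,$$ or equivalently, $$\boldsymbol{\lambda}\big(\mathfrak{P}_{p,q}(\mathbb{S}^{n-1})\big) = \frac{1}{2^{n + \frac{|p-q|}{2}}}\, \frac{\Gamma(n + p \vee q )}{\Gamma(n-1)\,\Gamma( 1 + p \vee q )} \int_{-1}^{1} (1-s)^{n-2} (1+s)^{\frac{|p-q|}{2}} \,\big| P_{p\wedge q}^{n-1,|p-q|}(s)\big|\, ds.$$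
   Context: Notation: $p\wedge q=\min\{p,q\}$, $p\vee q=\max\{p,q\}$; $\mathbb{S}^{n-1}=\{z\in\mathbb{C}^n:\|z\|_2=1\}$ is the complex Euclidean sphere. $\mathfrak{P}_{p,q}(\mathbb{C}^n)$ is the space of functions $f(z)=\sum_{|\alpha|=p,|\beta|=q}c_{(\alpha,\beta)}z^\alpha\overline{z}^\beta$ on $\mathbb{C}^n$ ($\alpha,\beta\in\mathbb{N}_0^n$, $c_{(\alpha,\beta)}\in\mathbb{C}$). $\mathfrak{P}_{p,q}(\mathbb{S}^{n-1})$ is the space of restrictions of these functions to $\mathbb{S}^{n-1}$, with the supremum norm (a subspace of $C(\mathbb{S}^{n-1})$, complex-valued functions). For a Banach space $Y$ and a closed complemented subspace $X\subset Y$, $\boldsymbol{\lambda}(X,Y)$ is the infimum of the norms of all bounded linear projections from $Y$ onto $X$. The (absolute) projection constant of a Banach space $X$ is $\boldsymbol{\lambda}(X)=\sup\boldsymbol{\lambda}(I(X),Y)$, the supremum over all Banach spaces $Y$ and isometric embeddings $I:X\to Y$. If $X$ is a finite-dimensional subspace of $C(K)$, then $\boldsymbol{\lambda}(X)=\boldsymbol{\lambda}(X,C(K))$. For $\alpha,\beta>-1$ and $d\in\mathbb{N}_0$, the Jacobi polynomial of degree $d$ is $$P_d^{\alpha,\beta}(t)=\frac{(-1)^d}{2^d d!}(1-t)^{-\alpha}(1+t)^{-\beta}\Big(\frac{d}{dt}\Big)^d\big[(1-t)^{\alpha+d}(1+t)^{\beta+d}\big],$$ so that $P_d^{\alpha,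\beta}(1)=\binom{d+\alpha}{d}$.
   Formalization: In the second formula the constant 1/2^{n+|p-q|/2} is corrected to 1/2^{n-1+|p-q|/2}: the printed one is too small by a factor 2 (for n=2, p=q=0 it gives 1/2, while the projection constant is 1). *)

(* Defs.v *)
From HB Require Import structures.
From mathcomp Require Import all_boot all_order all_algebra.
From mathcomp Require Import complex.
From mathcomp Require Import all_classical all_reals all_analysis.
From mathcomp Require Import ring lra.
Set Implicit Arguments.
Unset Strict Implicit.
Unset Printing Implicit Defensive.
Import Order.TTheory GRing.Theory Num.Theory.
Import numFieldNormedType.Exports.
Local Open Scope classical_set_scope.
Local Open Scope complex_scope.
Local Open Scope ring_scope.

Section projection_constant.
Variable R : realType.

(* The norm of a [normedModType R[i]] is [R[i]]-valued, hence the [Re]. *)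
Definition opnorm (X Y : normedModType R[i]) (f : X -> Y) : \bar R :=
  ereal_sup [set (complex.Re `|f x|)%:E | x in [set x : X | `|x| <= 1]].

Definition projection_onto (Y : normedModType R[i]) (A : set Y)
    (P : {linear Y -> Y}) : Prop :=
  range P = A /\ (forall y, P (P y) = P y).

(* [+oo] when there is no bounded projection onto [A]. *)
Definition relative_projection_constant (Y : normedModType R[i]) (A : set Y) :
    \bar R :=
  ereal_inf [set opnorm P | P in
    [set P : {linear Y -> Y} | continuous P /\ projection_onto A P]].

Definition projection_constant (X : normedModType R[i]) : \bar R :=
  ereal_sup [set l | exists (Y : completeNormedModType R[i])
      (I : {linear X -> Y}),
    (forall x, `|I x| = `|x|) /\ l = relative_projection_constant (range I)].

End projection_constant.

Section bihomogeneous.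
Variables (R : realType) (n p q : nat).

Definition csphere : Type := {z : 'rV[R[i]]_n | \sum_i `|z ord0 i| ^+ 2 == 1}.

(* Multi-indices of order [p] have entries at most [p]; this bound makes them *)
(* range over a finite type.                                                  *)
Definition bihomogeneous (f : 'rV[R[i]]_n -> R[i]) : Prop :=
  exists c : {ffun 'I_n -> 'I_p.+1} -> {ffun 'I_n -> 'I_q.+1} -> R[i],
    forall z : 'rV[R[i]]_n, f z =
      \sum_(a : {ffun 'I_n -> 'I_p.+1} | (\sum_i a i == p)%N)
        \sum_(b : {ffun 'I_n -> 'I_q.+1} | (\sum_i b i == q)%N)
          c a b * (\prod_i z ord0 i ^+ a i) *
                  (\prod_i Num.conj (z ord0 i) ^+ b i).

Definition bihom_pred : {pred csphere -> R[i]} :=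
  fun f => `[< exists2 F, bihomogeneous F & f = (fun z => F (sval z)) >].

Record bihom : Type := Bihom {
  bihom_fun :> csphere -> R[i];
  _ : bihom_fun \in bihom_pred
}.

HB.instance Definition _ := [isSub for bihom_fun].
HB.instance Definition _ := [Choice of bihom by <:].

Lemma bihom_submod_closed : submod_closed bihom_pred.
Proof.
split.
  apply/asboolP; exists (fun=> 0); last by apply/funext.
  exists (fun _ _ => 0) => z.
  by rewrite big1 // => a _; rewrite big1 // => b _; rewrite !mul0r.
move=> k f g /asboolP[F [c Fc] ->] /asboolP[G [d Gd] ->].
apply/asboolP; exists (fun z => k * F z + G z); last by apply/funext.
exists (fun a b => k * c a b + d a b) => z.
rewrite Fc Gd mulr_sumr -big_split; apply: eq_bigr => a _ /=.
rewrite mulr_sumr -big_split; apply: eq_bigr => b _ /=.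
by rewrite !mulrDl !mulrA.
Qed.

HB.instance Definition _ :=
  GRing.isSubmodClosed.Build R[i] (csphere -> R[i]) bihom_pred bihom_submod_closed.
HB.instance Definition _ := [SubChoice_isSubLmodule of bihom by <:].

(* The supremum norm, as an element of [R[i]]. *)
Definition bihom_norm (f : bihom) : R[i] :=
  (sup [set complex.Re `|f z| | z in [set: csphere]])%:C.


Lemma coord_le1 (z : csphere) i : `|sval z ord0 i| <= 1.
Proof.
have /eqP h := svalP z.
have : `|sval z ord0 i| ^+ 2 <= 1.
  rewrite -[leRHS]h (bigD1 i) //= lerDl; apply: sumr_ge0 => j _.
  exact: exprn_ge0.
by rewrite expr_le1.
Qed.

Lemma bihom_bounded (f : bihom) :
  exists M : R, forall z, complex.Re `|f z| <= M.
Proof.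
case: f => f /= /asboolP[F [c Fc] ->].
pose B : R[i] := \sum_(a : {ffun 'I_n -> 'I_p.+1} | (\sum_i a i == p)%N)
  \sum_(b : {ffun 'I_n -> 'I_q.+1} | (\sum_i b i == q)%N) `|c a b|.
exists (complex.Re B) => z.
suff : `|F (sval z)| <= B by rewrite lecE => /andP[].
rewrite Fc; apply: (le_trans (ler_norm_sum _ _ _)).
apply: ler_sum => a _; apply: (le_trans (ler_norm_sum _ _ _)).
apply: ler_sum => b _; rewrite !normrM -mulrA ler_piMr // mulr_ile1 //.
  rewrite normr_prod; apply: Num.Theory.prodr_ile1 => i _.
  by rewrite normr_ge0 normrX exprn_ile1 // coord_le1.
rewrite normr_prod; apply: Num.Theory.prodr_ile1 => i _.
by rewrite normr_ge0 normrX norm_conjC exprn_ile1 // coord_le1.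
Qed.

Lemma RRe_norm (x : R[i]) : (complex.Re `|x|)%:C = `|x|.
Proof. by rewrite RRe_real // normr_real. Qed.

Let cnorm (x : R[i]) : R := complex.Re `|x|.

Let cnorm_ge0 x : 0 <= cnorm x.
Proof. by rewrite -ler0c /cnorm RRe_norm. Qed.

Let cnormD x y : cnorm (x + y) <= cnorm x + cnorm y.
Proof. by rewrite -lecR rmorphD /= /cnorm !RRe_norm ler_normD. Qed.

Let cnormM x y : cnorm (x * y) = cnorm x * cnorm y.
Proof.
by apply: (@complexI _); rewrite rmorphM /= /cnorm !RRe_norm normrM.
Qed.

Let bset (f : bihom) := [set cnorm (f z) | z in [set: csphere]].

Let bset_ub (f : bihom) : has_ubound (bset f).
Proof. by have [M HM] := bihom_bounded f; exists M => _ [z _ <-]; exact: HM. Qed.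

Let bnorm_ub (f : bihom) z : cnorm (f z) <= sup (bset f).
Proof. apply: (ub_le_sup (bset_ub f)); by exists z. Qed.

Let bnorm_le (f : bihom) M : 0 <= M -> (forall z, cnorm (f z) <= M) -> sup (bset f) <= M.
Proof.
move=> M0 HM; have [->|/set0P ne] := eqVneq (bset f) set0; first by rewrite sup0.
by apply: ge_sup => // _ [z _ <-].
Qed.

Let bnorm_ge0 (f : bihom) : 0 <= sup (bset f).
Proof.
have [->|/set0P[_ [z _ _]]] := eqVneq (bset f) set0; first by rewrite sup0.
exact: le_trans (cnorm_ge0 _) (bnorm_ub f z).
Qed.

Lemma bihom_normD (f g : bihom) : bihom_norm (f + g) <= bihom_norm f + bihom_norm g.
Proof.
rewrite /bihom_norm -rmorphD lecR; apply: bnorm_le; first by apply: addr_ge0; exact: bnorm_ge0.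
by move=> z; apply: (le_trans (cnormD (f z) (g z))); apply: lerD; exact: bnorm_ub.
Qed.

Lemma bihom_normZ (l : R[i]) (f : bihom) : bihom_norm (l *: f) = `|l| * bihom_norm f.
Proof.
rewrite /bihom_norm -(RRe_norm l) -rmorphM; congr (_%:C).
rewrite -[X in X * _]/(cnorm l).
have le1 k g : sup (bset (k *: g)) <= cnorm k * sup (bset g).
  apply: bnorm_le; first by apply: mulr_ge0; [exact: cnorm_ge0|exact: bnorm_ge0].
  move=> z; rewrite [leLHS](cnormM k (g z)).
  by apply: ler_wpM2l; [exact: cnorm_ge0|exact: bnorm_ub].
apply/eqP; rewrite eq_le le1 /=.
have [->|l0] := eqVneq l 0.
  have -> : cnorm 0 = 0 by rewrite /cnorm normr0.
  by rewrite mul0r; exact: (bnorm_ge0 (0 *: f)).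
have := le1 l^-1 (l *: f).
rewrite scalerA mulVf // scale1r => h.
apply: (le_trans (ler_wpM2l (cnorm_ge0 l) h)).
by rewrite mulrA -cnormM divff // /cnorm normr1 mul1r.
Qed.

Lemma bihom_norm_eq0 (f : bihom) : bihom_norm f = 0 -> f = 0.
Proof.
move=> /(@complexI _) f0; apply/val_inj/funext => z /=.
apply/eqP; rewrite -normr_eq0 -RRe_norm.
have -> : complex.Re `|f z| = 0 by apply/le_anti; rewrite -{1}f0 bnorm_ub cnorm_ge0.
by [].
Qed.

HB.instance Definition _ := Lmodule_isNormed.Build R[i] bihom
  bihom_normD bihom_normZ bihom_norm_eq0.

End bihomogeneous.

Section special_functions.
Variable R : realType.

Definition Gamma (x : R) : R :=
  \int[lebesgue_measure]_(t in `]0, +oo[) (t `^ (x - 1) * expR (- t)).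

Definition rodrigues (a b : R) (d : nat) (t : R) : R :=
  (-1) ^+ d / (2 ^+ d * d`!%:R) * (1 - t) `^ (- a) * (1 + t) `^ (- b) *
  derive1n d (fun s : R => (1 - s) `^ (a + d%:R) * (1 + s) `^ (b + d%:R)) t.

(* On ]-1, 1[ the Rodrigues formula coincides with a unique polynomial (see   *)
(* [jacobiE] and [horner_itv_inj]); at -1 and 1 the formula itself is         *)
(* degenerate, so the polynomial is used there.                               *)
Definition jacobi (a b : R) (d : nat) : {poly R} :=
  xget 0 [set J : {poly R} |
    forall t, -1 < t < 1 -> J.[t] = rodrigues a b d t].

Let derive_weight (A B : R) k : exists Q : {poly R}, forall t, -1 < t < 1 ->
  derive1n k (fun s : R => (1 - s) `^ A * (1 + s) `^ B) t =
  Q.[t] * ((1 - t) `^ (A - k%:R) * (1 + t) `^ (B - k%:R)).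
Proof.
elim: k => [|k [Q HQ]].
  exists 1 => t _; rewrite derive1n0 !subr0 hornerC; exact: (esym (mul1r _)).
pose a := A - k%:R; pose b := B - k%:R.
exists ((1 - 'X) * (1 + 'X) * Q^`() - a *: ((1 + 'X) * Q) + b *: ((1 - 'X) * Q)).
move=> t t11; have /andP[t1 t2] := t11.
rewrite derive1nS.
have -> : (derive1n k (fun s : R => (1 - s) `^ A * (1 + s) `^ B))^`()%classic t =
    (fun s : R => Q.[s] * ((1 - s) `^ a * (1 + s) `^ b))^`()%classic t.
  rewrite !derive1E; apply: near_eq_derive.
  near=> s; apply: HQ; apply/andP; split; near: s.
    exact: lt_nbhsr.
  exact: lt_nbhsl.
have p1 : 0 < 1 - t by rewrite subr_gt0.
have p2 : 0 < 1 + t by rewrite -ltrBlDl sub0r.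
have Dg1 : is_derive t 1 (fun s : R => 1 - s) (-1).
  by rewrite -[X in is_derive _ _ _ X]sub0r; exact: (is_deriveB (is_derive_cst (1 : R) t 1) (is_derive_id t 1)).
have Dg2 : is_derive t 1 (fun s : R => 1 + s) 1.
  by rewrite -[X in is_derive _ _ _ X]add0r; exact: (is_deriveD (is_derive_cst (1 : R) t 1) (is_derive_id t 1)).
have D1 : is_derive t 1 (fun s : R => (1 - s) `^ a) (a * (1 - t) `^ (a - 1) * -1).
  exact: (@is_derive1_comp _ (fun x : R => x `^ a) (fun s : R => 1 - s) _ _ _
    (is_derive1_powR a p1) Dg1).
have D2 : is_derive t 1 (fun s : R => (1 + s) `^ b) (b * (1 + t) `^ (b - 1) * 1).
  exact: (@is_derive1_comp _ (fun x : R => x `^ b) (fun s : R => 1 + s) _ _ _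
    (is_derive1_powR b p2) Dg2).
rewrite derive1E (@derive_val _ _ _ _ _ _ _
  (is_deriveM (is_derive_poly Q t) (is_deriveM D1 D2))).
have E (A' x : R) : 0 < x -> x `^ (A' - k%:R) = x * x `^ (A' - k.+1%:R).
  move=> x0; rewrite -[X in _ = X * _]powRr1 ?ltW // -powRD; last first.
    by rewrite (gt_eqF x0) implybT.
  by congr (_ `^ _); rewrite -natr1; ring.
have E1 (A' : R) : A' - k%:R - 1 = A' - k.+1%:R by rewrite -natr1; ring.
transitivity (Q.[t] * ((1 - t) `^ a * (b * (1 + t) `^ (b - 1) * 1) +
    (1 + t) `^ b * (a * (1 - t) `^ (a - 1) * -1)) +
    (1 - t) `^ a * (1 + t) `^ b * Q^`().[t]); first by [].
rewrite !E1 {1 2}/a {1 2}/b !E //.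
rewrite !(hornerD, hornerN, hornerZ, hornerM, hornerX, hornerC).
by rewrite /a /b; ring.
Unshelve. all: by end_near.
Qed.

Lemma horner_itv_inj (p1 p2 : {poly R}) :
  (forall t, -1 < t < 1 -> p1.[t] = p2.[t]) -> p1 = p2.
Proof.
move=> H; apply/eqP; rewrite -subr_eq0; apply/negPn/negP => nz.
pose s := [seq (i.+2%:R^-1 : R) | i <- iota 0 (size (p1 - p2)%R)].
have : (size s < size (p1 - p2)%R)%N.
  apply: max_poly_roots => //.
    apply/allP => _ /mapP[i _ ->]; rewrite /root !hornerE H ?subrr //.
    rewrite (lt_trans (ltrN10 _)) ?invr_gt0 ?ltr0n //=.
    by rewrite invf_lt1 ?ltr0n // ltr1n.
  rewrite map_inj_uniq ?iota_uniq // => i j /invr_inj /eqP.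
  by rewrite eqr_nat => /eqP[].
by rewrite size_map size_iota ltnn.
Qed.

Lemma jacobiE (a b : R) d t : -1 < t < 1 -> (jacobi a b d).[t] = rodrigues a b d t.
Proof.
rewrite /jacobi; case: xgetP => [J _ /= HJ|noJ]; first exact: HJ.
have [Q HQ] := derive_weight (a + d%:R) (b + d%:R) d.
exfalso; apply: (noJ (((-1) ^+ d / (2 ^+ d * d`!%:R)) *: Q)) => {}t t11.
have /andP[t1 t2] := t11.
have p1 : 0 < 1 - t by rewrite subr_gt0.
have p2 : 0 < 1 + t by rewrite -ltrBlDl sub0r.
rewrite hornerZ /rodrigues HQ // !addrK; set c := _ / _.
have E (x y : R) : 0 < x -> x `^ (- y) * x `^ y = 1.
  move=> x0; rewrite -powRD ?addNr ?powRr0 //.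
  by rewrite (gt_eqF x0) implybT.
transitivity (c * Q.[t] * ((1 - t) `^ (- a) * (1 - t) `^ a) *
              ((1 + t) `^ (- b) * (1 + t) `^ b)).
  by rewrite !E // !mulr1.
ring.
Qed.

End special_functions.

(* Main.v *)
(* The kernel K(<z,w>) reproducing P_{p,q} on the sphere has the form          *)
(* s^(p-q) conj(s)^(q-p) c J(2|s|^2-1) with J the Jacobi polynomial, and the    *)
(* asserted integral C is the common value of the integrals of |K(<z,.>)|.      *)
(*                                                                              *)
(* The surface measure is replaced by a mean, defined on all bounded functions  *)
(* as an ultrafilter limit of averages over finite sets of points, which has    *)
(* the same moments.                                                            *)
(*                                                                              *)
(* Upper bound: given an isometric copy I(X) of X = P_{p,q} in Y, Hahn-Banach   *)
(* extends every point evaluation on I(X) to a functional phi_w of norm at most *)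
(* 1 on Y, and y |-> (z |-> mean_w K(<z,w>) phi_w(y)) is a projection of norm   *)
(* at most C. The mean is needed here because w |-> phi_w(y) need not be        *)
(* measurable.                                                                  *)
(*                                                                              *)
(* Lower bound: embed X in the space of bounded functions, and let              *)
(* h_z(w) = Phi(<w,z>) with Phi(s) = s^(p-q) conj(s)^(q-p) g(|s|^2) bounded by 1 *)
(* and g a polynomial. Then mean_z (P h_z)(z) is the same for all projections P *)
(* onto X, because w |-> mean_z h_z(w) f(z) lies in X for every f in X. When    *)
(* Phi is close to the phase of K this common value is close to C.              *)

Require Import Defs.
From HB Require Import structures.
From mathcomp Require Import all_boot all_order all_algebra.
From mathcomp Require Import cyclic separable cyclotomic.
From mathcomp Require Import complex.
From mathcomp Require Import all_classical all_reals all_analysis.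
From mathcomp Require Import measurable_realfun.
From mathcomp Require Import ring lra zify.
Set Implicit Arguments.
Unset Strict Implicit.
Unset Printing Implicit Defensive.
Import Order.TTheory GRing.Theory Num.Theory.
Import numFieldNormedType.Exports.
Local Open Scope classical_set_scope.
Local Open Scope complex_scope.
Local Open Scope ring_scope.

(** The constant is the common L1 norm of the functions [K(<w,.>)]. In every overspace there is a
    projection of norm at most this value ([kernel_projection_norm]), and in the bounded functions
    on the sphere no projection does better ([opnorm_projection_ge]).

    Integration over the sphere is reduced to moments. [sphere_mean_exists] gives a positive
    functional with the right moments, and iterated means are exchanged through finite expansions of
    the kernels ([zonal_expand]). The central computation is [mean_dot_monomial], the mean of
    [<w,z>^a conj(<w,z>)^b] times a monomial in [z]. As a generating function in [T] it is a
    polynomial times [exp T], and the top coefficient of that polynomial is the monomial at [w].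
    Weights taken from [exp(-T)] isolate this coefficient; they define the reproducing kernel
    ([mean_kernel]), which is then recognised as a Jacobi polynomial ([bihom_kernel_coefE],
    [jacobi_shift]).

    The modulus [|K|] is a function of [t = |s|^2] whose square is a polynomial, so Visser's
    iteration approximates it uniformly by polynomials. This shows that the mean of [|K|] is the
    asserted integral ([mean_norm_kernel]), and it provides kernels bounded by 1 whose pairing with
    [K] tends to that integral ([mean_dual_kernel]). Paired with any projection onto the space, such
    a kernel gives a trace that does not depend on the projection ([mean_projection_dual]) and is at
    most its norm. *)

(** * Coefficient extraction and truncated exponentials *)

Section combinatorics.
Local Open Scope nat_scope.

(** Sort the [(a + c).+1]-subsets of [{0, ..., K}] by the element [i] that has exactly [a] members
    of the subset below it and [c] above it. *)
Lemma sum_bin_upper a c K :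
  \sum_(i < K.+1) 'C(i, a) * 'C(K - i, c) = 'C(K.+1, (a + c).+1).
Proof.
elim: K a c => [|K IH] a c.
  by rewrite big_ord1 /= subn0; case: a c => [|a] [|c] //=; rewrite binSS bin_small.
case: c => [|c].
  have E k : \sum_(i < k.+1) 'C(i, a) * 'C(k - i, 0) = \sum_(i < k.+1) 'C(i, a).
    by apply: eq_bigr => i _; rewrite bin0 muln1.
  by have := IH a 0; rewrite !E addn0 => IHa; rewrite big_ord_recr /= IHa binS.
rewrite big_ord_recr /= subnn bin0n muln0 addn0.
under eq_bigr => i _ do rewrite subSn -1?ltnS // binS mulnDr.
by rewrite big_split /= !IH addnS [in RHS]binS.
Qed.

(** Reindexing by [e] gives [sum_bin_upper] for [k + e + e']; as [e <= a] and [e' <= c], the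
    additional terms at both ends vanish. *)
Lemma sum_bin_shift a c e e' k : e <= a -> e' <= c ->
  \sum_(i < k.+1) 'C(i + e, a) * 'C(k - i + e', c) =
  'C((k + e + e').+1, (a + c).+1).
Proof.
move=> ea ec; rewrite -sum_bin_upper.
rewrite -[RHS](big_mkord xpredT (fun i => 'C(i, a) * 'C(k + e + e' - i, c))).
rewrite (big_cat_nat _ (n := e)) //=; last by lia.
rewrite [X in _ = X + _]big1_seq ?add0n; last first.
  by move=> i; rewrite mem_index_iota => /andP[_ ie]; rewrite bin_small //; lia.
rewrite (big_cat_nat _ (n := e + k.+1)) //=; [|lia|lia].
rewrite [X in _ = _ + X]big1_seq ?addn0; last first.
  move=> i; rewrite mem_index_iota => /andP[_ ie].
  by rewrite [X in _ * X]bin_small ?muln0 //; lia.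
rewrite -[X in index_iota X](add0n e) big_addn addKn.
rewrite -(big_mkord xpredT (fun i => 'C(i + e, a) * 'C(k - i + e', c))).
apply: eq_big_nat => i ik; congr (_ * 'C(_, _)); lia.
Qed.

End combinatorics.

Section coefficients.
Variable A : comNzRingType.
Implicit Types (p q : {poly A}) (b : nat).

(** Congruence modulo the power [b + 1] of ['X]: polynomials serve as truncated power series. *)
Definition eqpoly_upto b p q := forall j, (j <= b)%N -> p`_j = q`_j.

Lemma eqpoly_upto_trans b p q r :
  eqpoly_upto b p q -> eqpoly_upto b q r -> eqpoly_upto b p r.
Proof. by move=> h1 h2 j jb; rewrite h1 ?h2. Qed.

Lemma eqpoly_uptoM b p p' q q' : eqpoly_upto b p p' -> eqpoly_upto b q q' ->
  eqpoly_upto b (p * q) (p' * q').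
Proof.
move=> h1 h2 j jb; rewrite !coefM; apply: eq_bigr => i _.
by rewrite h1 ?h2 //; have := ltn_ord i; lia.
Qed.

Lemma eqpoly_upto_prod b (I : Type) (s : seq I) (F G : I -> {poly A}) :
  (forall i, eqpoly_upto b (F i) (G i)) ->
  eqpoly_upto b (\prod_(i <- s) F i) (\prod_(i <- s) G i).
Proof.
by move=> FG; elim/big_ind2: _ => // *; exact: eqpoly_uptoM.
Qed.

Lemma coef_prod_poly (n N k : nat) (f : 'I_n -> nat -> A) : (k <= N)%N ->
  (\prod_i \poly_(j < N.+1) f i j)`_k =
  \sum_(g : {ffun 'I_n -> 'I_N.+1} | (\sum_i g i == k)%N) \prod_i f i (g i).
Proof.
move=> kN; under eq_bigr do rewrite poly_def.
rewrite bigA_distr_bigA coef_sum [RHS]big_mkcond /=; apply: eq_bigr => g _.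
rewrite scaler_prod coefZ.
have -> : \prod_(i < n) ('X : {poly A}) ^+ g i = 'X^(\sum_i g i).
  by rewrite -(big_morph (fun m => 'X^m) (@exprD _ 'X) (expr0 'X)).
by rewrite coefXn eq_sym; case: eqP => _; rewrite ?mulr1 ?mulr0.
Qed.

(** Iterates [sum_bin_shift]; each of the [n] convolutions adds one to both entries of the binomial
    coefficient. *)
Lemma coef_prod_bin (n N k : nat) (e a : 'I_n.+1 -> nat) : (k <= N)%N ->
  (forall i, (e i <= a i)%N) ->
  (\prod_i \poly_(j < N.+1) ('C(j + e i, a i)%:R : A))`_k =
  'C(k + \sum_i e i + n, \sum_i a i + n)%:R.
Proof.
elim: n k e a => [|n IH] k e a kN ea.
  by rewrite !big_ord1 coef_poly ltnS kN !addn0.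
rewrite big_ord_recl coefM.
transitivity (\sum_(i < k.+1) ('C(i + e ord0, a ord0) *
    'C(k - i + (\sum_i e (lift ord0 i) + n), \sum_i a (lift ord0 i) + n))%:R : A).
  apply: eq_bigr => i _; rewrite coef_poly ifT; last first.
    by rewrite ltnS (leq_trans _ kN) // -ltnS.
  by rewrite IH ?(leq_trans (leq_subr _ _)) // natrM addnA.
rewrite -natr_sum sum_bin_shift //; last first.
  by rewrite leq_add2r leq_sum.
congr ('C(_, _)%:R); rewrite [in RHS]big_ord_recl.
  by rewrite !addnS !addnA.
by rewrite addnS addnA.
Qed.

End coefficients.

Section truncated_exponential.
Variable A : numFieldType.

Lemma fact_neq0 n : n`!%:R != 0 :> A.
Proof. by rewrite pnatr_eq0 -lt0n fact_gt0. Qed.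

Definition texp N (x : A) : {poly A} := \poly_(j < N.+1) (x ^+ j / j`!%:R).

Lemma bin_factV k i : (i <= k)%N ->
  'C(k, i)%:R / k`!%:R = (i`!%:R * (k - i)`!%:R)^-1 :> A.
Proof.
move=> ik; have := bin_fact ik => /(congr1 (GRing.natmul (1 : A))).
rewrite natrM natrM => <-; rewrite invfM mulrA divff ?mul1r //.
by rewrite pnatr_eq0 -lt0n bin_gt0.
Qed.

Lemma texpD N x y : eqpoly_upto N (texp N x * texp N y) (texp N (x + y)).
Proof.
move=> k kN; rewrite coefM coef_poly ltnS kN addrC exprDn mulr_suml.
apply: eq_bigr => i _; have ik : (i <= k)%N by rewrite -ltnS.
rewrite !coef_poly !ifT; [|lia|lia].
by rewrite -[in RHS]mulr_natr -[RHS]mulrA (bin_factV ik) invfM; ring.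
Qed.

Lemma texp0 N : texp N 0 = 1.
Proof.
apply/polyP => -[|j]; rewrite coef_poly coef1 ?expr0 ?fact0 ?divr1 //.
by rewrite expr0n mul0r if_same.
Qed.

Lemma texp_prod n N (x : 'I_n -> A) :
  eqpoly_upto N (\prod_i texp N (x i)) (texp N (\sum_i x i)).
Proof.
elim: n x => [|n IH] x; first by rewrite !big_ord0 texp0.
rewrite !big_ord_recl; apply: (eqpoly_upto_trans _ (@texpD _ _ _)).
exact: eqpoly_uptoM.
Qed.

(** Compare the coefficients of degree [a] in [exp((sum x_i) 'X)] and in the product of the
    [exp(x_i 'X)]. The free bound [N] lets sums with different [a] share an index type. *)
Lemma multinomial_formula n N a (x : 'I_n -> A) : (a <= N)%N ->
  (\sum_i x i) ^+ a = a`!%:R *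
  \sum_(g : {ffun 'I_n -> 'I_N.+1} | (\sum_i g i == a)%N)
     \prod_i (x i ^+ g i / (g i)`!%:R).
Proof.
move=> aN; rewrite -(coef_prod_poly (fun i j => x i ^+ j / j`!%:R)) //.
rewrite texp_prod // coef_poly ltnS aN mulrCA divff ?fact_neq0 ?mulr1 //.
Qed.

End truncated_exponential.

(** * Averages over the lattice points of a simplex *)

Section lattice.
Variable R : realType.

Lemma subn_ratio_cvg (c a : nat) :
  ((N + c - a)%N%:R / N%:R : R) @[N --> \oo] --> (1 : R).
Proof.
have H : (1 + (c%:R - a%:R) * (harmonic N : R)) @[N --> \oo] --> (1 + (c%:R - a%:R) * 0 : R).
  by apply: cvgD; [exact: cvg_cst | apply: cvgMr; exact: cvg_harmonic].
rewrite mulr0 addr0 in H.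
rewrite -(cvg_shiftS (fun N => (N + c - a)%N%:R / N%:R : R)).
apply: cvg_trans H; apply: near_eq_cvg; near=> N.
have aN : (a <= N.+1)%N by apply: leqW; near: N; exact: nbhs_infty_ge.
rewrite /= natrB; last by lia.
have N0 : N.+1%:R != 0 :> R by rewrite pnatr_eq0.
by rewrite natrD; field.
Unshelve. all: by end_near. Qed.

Lemma ffact_ratio_cvg (c a : nat) :
  (((N + c) ^_ a)%:R / N%:R ^+ a : R) @[N --> \oo] --> (1 : R).
Proof.
elim: a => [|a IH].
  under eq_fun do rewrite ffactn0 expr0 divr1; exact: cvg_cst.
under eq_fun do rewrite ffactnSr natrM exprSr invfM mulrACA.
have := cvgM IH (subn_ratio_cvg c a); rewrite mulr1; exact.
Qed.

(** Compare [j (j-1) ... (j-a+1)], [j^a] and [(j+1) ... (j+a)] factor by factor. The outer terms are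
    written with binomials because [sum_lattice_bin] sums those exactly. *)
Lemma expn_ffact_bounds (j a : nat) : (a`! * 'C(j, a) <= j ^ a <= a`! * 'C(j + a, a))%N.
Proof.
rewrite ![(a`! * _)%N]mulnC !bin_ffact.
elim: a => [|a /andP[IH1 IH2]]; first by rewrite !ffactn0 expn0.
rewrite ffactnSr expnSr addnS ffactnS.
rewrite leq_mul ?leq_subr //= mulnC; apply: leq_mul => //.
by apply: leqW; rewrite leq_addr.
Qed.

(** A Riemann sum for a moment of the uniform distribution on the simplex, over its ['C(N + n, n)]
    lattice points [m / N]. *)
Definition lattice_average n (a : 'I_n.+1 -> nat) (N : nat) : R :=
  (\sum_(m : {ffun 'I_n.+1 -> 'I_N.+1} | (\sum_i m i == N)%N)
      \prod_i ((m i)%:R / N%:R) ^+ a i) / 'C(N + n, n)%:R.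

Lemma sum_lattice_bin (A : comNzRingType) n N (e a : 'I_n.+1 -> nat) : (forall i, (e i <= a i)%N) ->
  \sum_(m : {ffun 'I_n.+1 -> 'I_N.+1} | (\sum_i m i == N)%N)
     \prod_i ('C(m i + e i, a i)%:R : A) = 'C(N + \sum_i e i + n, \sum_i a i + n)%:R.
Proof.
move=> ea; rewrite -(@coef_prod_bin A n N N e a (leqnn N) ea).
by rewrite (coef_prod_poly (fun i j => 'C(j + e i, a i)%:R)).
Qed.

Lemma natr_fact_gt0 (j : nat) : (0 : R) < j`!%:R.
Proof. by rewrite ltr0n fact_gt0. Qed.

Lemma natr_bin_fact (j k : nat) : 'C(j + k, k)%:R = (j + k)`!%:R / (k`!%:R * j`!%:R) :> R.
Proof.
rewrite -(bin_fact (leq_addl j k)) addnK !natrM mulfK //.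
Qed.

Lemma natr_ffact (j k : nat) : ((j + k) ^_ k)%:R = (j + k)`!%:R / j`!%:R :> R.
Proof.
rewrite -(ffact_fact (leq_addl j k)) addnK natrM mulfK //.
Qed.

(** [expn_ffact_bounds] encloses the average between two binomial sums. By [sum_lattice_bin] each
    equals the claimed Dirichlet moment times a ratio that tends to 1. *)
Lemma lattice_average_cvg n (a : 'I_n.+1 -> nat) :
  lattice_average a N @[N --> \oo] -->
  ((\prod_i (a i)`! * n`!)%N%:R / (n + \sum_i a i)`!%:R : R).
Proof.
set A := (\sum_i a i)%N; set F := (\prod_i (a i)`!)%N.
pose c : R := (F * n`!)%N%:R / (n + A)`!%:R.
have c_cvg e : (c * (((N + e) ^_ A)%:R / N%:R ^+ A)) @[N --> \oo] --> c.
  have : (c * (((N + e) ^_ A)%:R / N%:R ^+ A)) @[N --> \oo] --> (c * 1 : R).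
    by apply: cvgMr; exact: ffact_ratio_cvg.
  by rewrite mulr1.
have fn0 j : j`!%:R != 0 :> R by rewrite gt_eqF // natr_fact_gt0.
have C0 N : 0 < 'C(N + n, n)%:R :> R by rewrite ltr0n bin_gt0 leq_addl.
apply: (squeeze_cvgr _ (c_cvg 0%N) (c_cvg (n + A)%N)).
near=> N.
have N0 : (0 < N)%N by near: N; exact: nbhs_infty_gt.
have AN : (A <= N)%N by near: N; exact: nbhs_infty_ge.
have NN0 : N%:R != 0 :> R by rewrite pnatr_eq0 -lt0n.
rewrite /lattice_average.
have -> : \sum_(m : {ffun 'I_n.+1 -> 'I_N.+1} | (\sum_i m i == N)%N)
    \prod_i ((m i)%:R / N%:R : R) ^+ a i =
  (\sum_(m : {ffun 'I_n.+1 -> 'I_N.+1} | (\sum_i m i == N)%N)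
    \prod_i (m i ^ a i)%N%:R) / N%:R ^+ A.
  rewrite mulr_suml; apply: eq_bigr => m _.
  rewrite -prodrXr -prodf_div; apply: eq_bigr => i _.
  by rewrite expr_div_n natrX.
have bound (e : 'I_n.+1 -> nat) : (forall i, (e i <= a i)%N) ->
  \sum_(m : {ffun 'I_n.+1 -> 'I_N.+1} | (\sum_i m i == N)%N)
     \prod_i ((a i)`! * 'C(m i + e i, a i))%N%:R =
    F%:R * 'C(N + \sum_i e i + n, A + n)%:R :> R.
  move=> ea; rewrite -sum_lattice_bin // mulr_sumr; apply: eq_bigr => m _.
  by rewrite /F natr_prod -big_split; apply: eq_bigr => i _; rewrite natrM.
apply/andP; split.
  apply: (@le_trans _ _ (F%:R * 'C(N + n, A + n)%:R / N%:R ^+ A / 'C(N + n, n)%:R)).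
    rewrite le_eqVlt; apply/orP; left; apply/eqP; rewrite /c addn0 natr_bin_fact.
    have -> : 'C(N + n, A + n)%:R = (N + n)`!%:R / ((A + n)`!%:R * (N - A)`!%:R) :> R.
      have {1 2}-> : (N + n = N - A + (A + n))%N by lia.
      exact: natr_bin_fact.
    have -> : (N ^_ A)%:R = N`!%:R / (N - A)`!%:R :> R.
      by rewrite -{1 2}(subnK AN) natr_ffact.
    rewrite natrM [(n + A)%N]addnC.
    by field; rewrite ?fn0 ?expf_neq0.
  rewrite ler_pM2r ?invr_gt0 // ler_pM2r ?invr_gt0 ?exprn_gt0 ?ltr0n //.
  have := bound (fun=> 0%N) (fun=> leq0n _); rewrite [X in (N + X + n)%N]big1 // addn0 => <-.
  apply: ler_sum => m _; apply: ler_prod => i _; rewrite ler0n ler_nat /= addn0.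
  by have /andP[] := expn_ffact_bounds (m i) (a i).
apply: (@le_trans _ _ (F%:R * 'C(N + A + n, A + n)%:R / N%:R ^+ A / 'C(N + n, n)%:R)); last first.
  rewrite le_eqVlt; apply/orP; left; apply/eqP; rewrite /c natr_bin_fact.
  have -> : 'C(N + A + n, A + n)%:R = (N + n + A)`!%:R / ((A + n)`!%:R * N`!%:R) :> R.
    by rewrite -addnA natr_bin_fact; congr (_`!%:R / _); lia.
  rewrite addnA natr_ffact natrM [(n + A)%N]addnC.
  by field; rewrite ?fn0 ?expf_neq0.
rewrite ler_pM2r ?invr_gt0 // ler_pM2r ?invr_gt0 ?exprn_gt0 ?ltr0n //.
rewrite -bound //; apply: ler_sum => m _; apply: ler_prod => i _; rewrite ler0n ler_nat /=.
by have /andP[] := expn_ffact_bounds (m i) (a i).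
Unshelve. all: by end_near. Qed.

End lattice.

(** * An invariant mean on the sphere *)

(** The polynomial ['X^m - 1] is separable, so it has [m] distinct roots, and these form a cyclic
    group. *)
Lemma closed_prim_root_exists (F : closedFieldType) (m : nat) : (0 < m)%N ->
  m%:R != 0 :> F -> exists w : F, m.-primitive_root w.
Proof.
move=> m0 mF; pose p : {poly F} := 'X^m - 1.
have pmonic : p \is monic by rewrite monicXnsubC.
have [r pr] := closed_field_poly_normal p.
rewrite (monicP pmonic) scale1r in pr.
have ru : uniq r.
  by rewrite -separable_prod_XsubC -pr separable_Xn_sub_1.
have sr : size r = m.
  by apply: succn_inj; rewrite -(size_prod_XsubC r id) -pr size_XnsubC.
suff : has m.-primitive_root r by move/hasP => [w _ ?]; exists w.
apply: has_prim_root => //; last by rewrite sr.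
apply/allP => w wr; rewrite unity_rootE -subr_eq0.
have : root p w by rewrite pr root_prod_XsubC.
by rewrite /root /p !hornerE.
Qed.

Section ultrafilter_limit.
Variable R : realType.

Lemma eventually_ultrafilter :
  exists U : set_system nat, UltraFilter U /\ \oo `<=` U.
Proof. by have [U [? ?]] := ultraFilterLemma (F := \oo) _; exists U. Qed.

(** The image of an ultrafilter is an ultrafilter, and on the compact segment [[-M, M]] every
    ultrafilter converges. *)
Lemma ultrafilter_bounded_cvg (U : set_system nat) (u : nat -> R) (M : R) :
  UltraFilter U -> (forall N, `|u N| <= M) -> cvg (u @ U).
Proof.
move=> UU uM.
have uU : UltraFilter (u @ U).
  split; first exact: fmap_proper_filter.
  move=> G GF sG; rewrite predeqE => A; split=> [GA|]; last exact: sG.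
  have [//|UA] := in_ultra_setVsetC (u @^-1` A) UU.
  have GnA : G (~` A) by apply: sG; rewrite /= /nbhs /=; apply: filterS UA.
  by have /filter_ex[? []] : G (A `&` ~` A) by exact: filterI.
have : compact `[- M, M] by exact: segment_compact.
rewrite compact_ultra => /(_ _ uU) [|l [_ ul]]; last by apply/cvg_ex; exists l.
rewrite /=; apply: (@filterS _ U _ setT); last exact: filterT.
by move=> N _ /=; rewrite in_itv /= -ler_norml.
Qed.

End ultrafilter_limit.

Section complex_facts.
Variable R : realType.
Implicit Types x y : R[i].

Lemma Re_add x y : complex.Re (x + y) = complex.Re x + complex.Re y.
Proof. by case: x y => [a b] [c d]. Qed.

Lemma Im_add x y : complex.Im (x + y) = complex.Im x + complex.Im y.
Proof. by case: x y => [a b] [c d]. Qed.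

Lemma Re_mul x y : complex.Re (x * y) =
  complex.Re x * complex.Re y - complex.Im x * complex.Im y.
Proof. by case: x y => [a b] [c d]. Qed.

Lemma Im_mul x y : complex.Im (x * y) =
  complex.Re x * complex.Im y + complex.Im x * complex.Re y.
Proof. by case: x y => [a b] [c d]. Qed.

Lemma normC_le x (M : R) : 0 <= M ->
  (`|x| <= M%:C) = (complex.Re x ^+ 2 + complex.Im x ^+ 2 <= M ^+ 2).
Proof.
by move=> M0; rewrite -lecR add_Re2_Im2 rmorphXn ler_pXn2r // nnegrE ler0c.
Qed.

Lemma normC_le_Re x (M : R) : `|x| <= M%:C -> `|complex.Re x| <= M.
Proof. by move=> xM; rewrite -lecR; apply: le_trans xM; exact: normc_ge_Re. Qed.

Lemma normC_le_Im x (M : R) : `|x| <= M%:C -> `|complex.Im x| <= M.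
Proof.
move=> xM; rewrite -normrN -ReiNIm; apply: normC_le_Re.
by rewrite normrM (_ : `|'i%C| = 1) ?mulr1 // normc_def /= expr0n expr1n add0r sqrtr1.
Qed.

Lemma conjC_conjc x : Num.conj x = conjc x.
Proof.
have [->|x0] := eqVneq x 0; first by rewrite rmorph0 conjc0.
by apply: (mulfI x0); rewrite -normCK sqr_normc.
Qed.

End complex_facts.

Section ultrafilter_complex.
Variables (R : realType) (U : set_system nat).
Context {UU : UltraFilter U}.
Hypothesis UE : \oo `<=` U.

Definition ulim (v : nat -> R[i]) : R[i] :=
  lim (complex.Re (v N) @[N --> U]) +i* lim (complex.Im (v N) @[N --> U]).

Definition seq_bounded (v : nat -> R[i]) := exists M : R, forall N, `|v N| <= M%:C.

Lemma ulim_Re v : seq_bounded v -> complex.Re (v N) @[N --> U] --> complex.Re (ulim v).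
Proof.
move=> [M vM] /=; apply: (@ultrafilter_bounded_cvg _ _ _ M) => N.
exact: normC_le_Re.
Qed.

Lemma ulim_Im v : seq_bounded v -> complex.Im (v N) @[N --> U] --> complex.Im (ulim v).
Proof.
move=> [M vM] /=; apply: (@ultrafilter_bounded_cvg _ _ _ M) => N.
exact: normC_le_Im.
Qed.

Lemma ulimP v l : complex.Re (v N) @[N --> U] --> complex.Re l ->
  complex.Im (v N) @[N --> U] --> complex.Im l -> ulim v = l.
Proof.
case: l => a b /= va vb; rewrite /ulim.
by rewrite (cvg_lim _ va) // (cvg_lim _ vb).
Qed.

Lemma ulim_linear c v w : seq_bounded v -> seq_bounded w ->
  ulim (fun N => c * v N + w N) = c * ulim v + ulim w.
Proof.
move=> bv bw; apply: ulimP.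
  under eq_fun do rewrite Re_add Re_mul.
  rewrite Re_add Re_mul; apply: cvgD; last exact: ulim_Re.
  by apply: cvgB; apply: cvgMr; [exact: ulim_Re|exact: ulim_Im].
under eq_fun do rewrite Im_add Im_mul.
rewrite Im_add Im_mul; apply: cvgD; last exact: ulim_Im.
by apply: cvgD; apply: cvgMr; [exact: ulim_Im|exact: ulim_Re].
Qed.

(** The hypothesis makes [w] real and nonnegative, so squared moduli can be compared and passed to
    the limit through real and imaginary parts. *)
Lemma ulim_norm_le v w : seq_bounded w -> (forall N, `|v N| <= w N) ->
  `|ulim v| <= ulim w.
Proof.
move=> bw vw.
have w0 N : 0 <= w N by apply: le_trans (vw N).
have wE N : w N = (complex.Re (w N))%:C by rewrite RRe_real // ger0_real.
have bv : seq_bounded v by have [M wM] := bw; exists M => N; apply: le_trans (vw N) _; apply: le_trans (wM N); rewrite ger0_norm.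
have Rew0 N : 0 <= complex.Re (w N) by rewrite -ler0c -wE.
have limw : ulim w = (complex.Re (ulim w))%:C.
  apply: ulimP => /=; first exact: ulim_Re.
  under eq_fun do rewrite wE /=; exact: cvg_cst.
have lw0 : 0 <= complex.Re (ulim w).
  apply: (@limr_ge _ U _ _ _ _) => //=; first by apply: cvgP; exact: ulim_Re.
  exact: nearW.
rewrite limw normC_le //.
have sqr_cvg (f : nat -> R) (l : R) : f @ U --> l -> (f N ^+ 2) @[N --> U] --> l ^+ 2.
  by move=> fl; rewrite expr2; under eq_fun do rewrite expr2; exact: cvgM.
have c1 := sqr_cvg _ _ (ulim_Re bv); have c2 := sqr_cvg _ _ (ulim_Im bv).
have c3 := sqr_cvg _ _ (ulim_Re bw).
apply: (ler_cvg_to (cvgD c1 c2) c3); apply: nearW => N.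
by rewrite -normC_le // -wE.
Qed.

Lemma ulim_eventually v (r : nat -> R) (l : R) : (\forall N \near \oo, v N = (r N)%:C) ->
  r @ \oo --> l -> ulim v = l%:C.
Proof.
move=> vr rl; have UvN : U (fun N => v N = (r N)%:C) by exact: UE.
apply: ulimP.
  have rU : r N @[N --> U] --> l by exact: (cvg_trans (cvg_app r UE) rl).
  apply: cvg_trans rU; apply: near_eq_cvg.
  by apply: (filterS _ UvN) => N /= ->.
have c0 : (fun=> 0 : R) N @[N --> U] --> (0 : R) by exact: cvg_cst.
apply: cvg_trans c0; apply: near_eq_cvg.
by apply: (filterS _ UvN) => N /= ->.
Qed.

End ultrafilter_complex.

Definition fun_bounded (R : realType) (T : Type) (F : T -> R[i]) :=
  exists M : R, forall z, `|F z| <= M%:C.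

Definition sphere_monomial (R : realType) n (a b : 'I_n -> nat)
    (z : csphere R n) : R[i] :=
  (\prod_i sval z ord0 i ^+ a i) * (\prod_i Num.conj (sval z ord0 i) ^+ b i).

(* The moments are those of the normalised surface measure.                   *)
Record sphere_mean (R : realType) n (L : (csphere R n.+1 -> R[i]) -> R[i]) :
    Prop := SphereMean {
  mean_linear : forall c F G, fun_bounded F -> fun_bounded G ->
    L (fun z => c * F z + G z) = c * L F + L G;
  mean_norm_le : forall F G, fun_bounded G -> (forall z, `|F z| <= G z) ->
    `|L F| <= L G;
  mean_monomial : forall a b : 'I_n.+1 -> nat, L (sphere_monomial a b) =
    if [forall i, a i == b i]
    then (\prod_i (a i)`! * n`!)%N%:R / (n + \sum_i a i)`!%:R else 0 }.

Section mean_existence.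
Variables (R : realType) (n : nat).
Local Notation C := R[i].
Local Notation S := (csphere R n.+1).

Definition sphere_base : S.
Proof.
exists (\row_i (i == ord0)%:R).
rewrite big_ord_recl big1 ?mxE ?eqxx ?normr1 ?expr1n ?addr0 // => i _.
by rewrite mxE normr0 expr0n.
Defined.

(** Made total by sending vectors off the sphere to [sphere_base]; the rows sampled below lie on the
    sphere ([sample_row_sphere]). *)
Definition to_sphere (v : 'rV[C]_n.+1) : S :=
  if pselect (exists z : S, sval z = v) is left h then projT1 (cid h)
  else sphere_base.

Lemma to_sphereK (v : 'rV[C]_n.+1) :
  \sum_i `|v ord0 i| ^+ 2 = 1 -> sval (to_sphere v) = v.
Proof.
move=> /eqP h; rewrite /to_sphere; case: pselect => [ex|[]]; last by exists (exist _ v h).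
by case: cid.
Qed.

Definition unity_root N : C :=
  xget 1 [set w | N.+1.-primitive_root w].

Lemma unity_rootP N : N.+1.-primitive_root (unity_root N).
Proof.
rewrite /unity_root; case: xgetP => [w _ //|].
have [w wP] : exists w : C, N.+1.-primitive_root w.
  by apply: closed_prim_root_exists => //; rewrite pnatr_eq0.
by move/(_ w); case.
Qed.

Lemma norm_unity_root N : `|unity_root N| = 1.
Proof.
apply/eqP; rewrite -(@pexpr_eq1 _ _ N.+1) // -normrX.
by rewrite (prim_expr_order (unity_rootP N)) normr1.
Qed.

(** Squared moduli form a lattice point of the simplex, and phases run over the roots of unity of
    order [N.+1]. Under the surface measure they are likewise uniform on the simplex and,
    independently, on the torus. *)
Definition sample_row N (m : {ffun 'I_n.+1 -> 'I_N.+2})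
    (k : {ffun 'I_n.+1 -> 'I_N.+1}) : 'rV[C]_n.+1 :=
  \row_i ((Num.sqrt ((m i)%:R / N.+1%:R))%:C * unity_root N ^+ k i).

Lemma sample_row_sphere N (m : {ffun 'I_n.+1 -> 'I_N.+2})
    (k : {ffun 'I_n.+1 -> 'I_N.+1}) : (\sum_i m i)%N = N.+1 ->
  sval (to_sphere (sample_row m k)) = sample_row m k.
Proof.
move=> mN; apply: to_sphereK.
transitivity (\sum_i ((m i)%:R / N.+1%:R : R)%:C).
  apply: eq_bigr => i _; rewrite mxE normrM normrX norm_unity_root expr1n mulr1.
  rewrite ger0_norm ?ler0c ?sqrtr_ge0 // -rmorphXn /= sqr_sqrtr //.
rewrite -rmorph_sum -mulr_suml -natr_sum mN divff ?rmorph1 //.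
Qed.

Definition sphere_average N (F : S -> C) : C :=
  (\sum_(m : {ffun 'I_n.+1 -> 'I_N.+2} | (\sum_i m i == N.+1)%N)
     \sum_(k : {ffun 'I_n.+1 -> 'I_N.+1}) F (to_sphere (sample_row m k))) /
  ('C(N.+1 + n, n) * N.+1 ^ n.+1)%N%:R.

Lemma sphere_average_linear N c F G :
  sphere_average N (fun z => c * F z + G z) =
  c * sphere_average N F + sphere_average N G.
Proof.
rewrite /sphere_average mulrA -mulrDl; congr (_ / _).
rewrite mulr_sumr -big_split; apply: eq_bigr => m _.
by rewrite mulr_sumr -big_split.
Qed.

Lemma sphere_average_norm_le N F G : (forall z, `|F z| <= G z) ->
  `|sphere_average N F| <= sphere_average N G.
Proof.
move=> FG; rewrite /sphere_average normrM [X in _ * X]ger0_norm; last first.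
  by rewrite invr_ge0 ler0n.
apply: ler_wpM2r; first by rewrite invr_ge0 ler0n.
apply: le_trans (ler_norm_sum _ _ _) _; apply: ler_sum => m _.
by apply: le_trans (ler_norm_sum _ _ _) _; apply: ler_sum.
Qed.

Lemma sphere_average_cst N c : sphere_average N (fun=> c) = c.
Proof.
rewrite /sphere_average.
under eq_bigr do rewrite sumr_const card_ffun !card_ord -mulr_natr.
rewrite -mulr_suml.
have -> : \sum_(m : {ffun 'I_n.+1 -> 'I_N.+2} | (\sum_i m i == N.+1)%N) c =
    c * 'C(N.+1 + n, n)%:R.
  have := @sum_lattice_bin C n N.+1 (fun=> 0%N) (fun=> 0%N) (fun=> leqnn _).
  rewrite /= !big1_eq addn0 add0n => <-; rewrite mulr_sumr.
  by apply: eq_bigr => m _; rewrite big1 ?mulr1 // => i _; rewrite bin0.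
rewrite natrM -[X in X / _]mulrA mulfK // mulf_neq0 // pnatr_eq0 -lt0n ?expn_gt0 //.
by rewrite bin_gt0 leq_addl.
Qed.

Lemma sphere_average_bounded F : fun_bounded F ->
  seq_bounded (fun N => sphere_average N F).
Proof.
move=> [M FM]; exists M => N; rewrite -[leRHS](sphere_average_cst N).
exact: sphere_average_norm_le.
Qed.

(** Orthogonality of the characters of a cyclic group of order [N.+1]; for [a, b <= N] equal
    residues mean equal exponents. *)
Lemma sum_unity_root N (a b : nat) : (a <= N)%N -> (b <= N)%N ->
  \sum_(j < N.+1) (unity_root N ^+ j) ^+ a * Num.conj (unity_root N ^+ j) ^+ b =
  if a == b then N.+1%:R else 0.
Proof.
move=> aN bN; set w := unity_root N.
have wu : Num.conj w = w^-1.
  have w0 : w != 0 by rewrite -normr_eq0 norm_unity_root oner_eq0.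
  by apply: (mulfI w0); rewrite -normCK norm_unity_root expr1n divff.
pose x := w ^+ a * Num.conj w ^+ b.
have w0 : w != 0 by rewrite -normr_eq0 norm_unity_root oner_eq0.
transitivity (\sum_(j < N.+1) x ^+ j).
  by apply: eq_bigr => j _; rewrite /x rmorphXn exprMn -!exprM ![(j * _)%N]mulnC.
have [ab|ab] := eqVneq a b.
  rewrite (eq_bigr (fun=> 1)) ?sumr_const ?card_ord // => j _.
  by rewrite /x ab wu exprVn mulfV ?expr1n // expf_neq0.
have x1 : x != 1.
  rewrite /x wu exprVn; apply: contraNneq ab => /divr1_eq /eqP.
  by rewrite (eq_prim_root_expr (unity_rootP N)) !modn_small ?ltnS.
have xN : x ^+ N.+1 = 1.
  rewrite exprMn -!exprM ![(_ * N.+1)%N]mulnC !exprM wu exprVn.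
  by rewrite (prim_expr_order (unity_rootP N)) invr1 !expr1n mulr1.
apply: (@mulfI _ (x - 1)); first by rewrite subr_eq0.
by rewrite -subrX1 xN subrr mulr0.
Qed.

(** The average factors over the coordinates. Summing over phases kills the monomial unless [a = b],
    and then the square roots occur to even powers and leave a lattice average. *)
Lemma sphere_average_monomial N (a b : 'I_n.+1 -> nat) :
  (forall i, (a i <= N)%N) -> (forall i, (b i <= N)%N) ->
  sphere_average N (sphere_monomial a b) =
  if [forall i, a i == b i] then (lattice_average R a N.+1)%:C else 0.
Proof.
move=> aN bN; pose r (m : 'I_N.+2) : C := (Num.sqrt (m%:R / N.+1%:R))%:C.
have rJ m : Num.conj (r m) = r m by rewrite conjC_conjc conjc_real.
have r2 m : r m ^+ 2 = (m%:R / N.+1%:R : R)%:C.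
  by rewrite -rmorphXn /= sqr_sqrtr ?divr_ge0.
have -> : sphere_average N (sphere_monomial a b) =
    (\sum_(m : {ffun 'I_n.+1 -> 'I_N.+2} | (\sum_i m i == N.+1)%N)
       \prod_i (r (m i) ^+ (a i + b i) * if a i == b i then N.+1%:R else 0)) /
    ('C(N.+1 + n, n) * N.+1 ^ n.+1)%N%:R.
  congr (_ / _); apply: eq_bigr => m /eqP mN.
  under [RHS]eq_bigr do rewrite -sum_unity_root //.
  under [RHS]eq_bigr do rewrite mulr_sumr.
  rewrite bigA_distr_bigA; apply: eq_bigr => k _.
  rewrite /sphere_monomial sample_row_sphere // -big_split.
  apply: eq_bigr => i _; rewrite mxE -/(r (m i)) rmorphM /= rJ !exprMn exprD.
  by rewrite mulrACA.
case: ifPn => [/forallP ab|]; last first.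
  rewrite negb_forall => /existsP[i abi].
  rewrite big1 ?mul0r // => m _.
  by rewrite (bigD1 i) //= (negPf abi) mulr0 mul0r.
rewrite /lattice_average natrM invfM mulrA mulrAC.
have c0 : (N.+1 ^ n.+1)%N%:R != 0 :> C by rewrite pnatr_eq0 -lt0n expn_gt0.
rewrite [RHS]rmorphM /= fmorphV rmorph_nat; congr (_ / _).
apply: (mulIf c0); rewrite divfK // rmorph_sum mulr_suml.
apply: eq_bigr => m _; rewrite big_split /=; congr (_ * _).
  rewrite rmorph_prod; apply: eq_bigr => i _.
  by rewrite -(eqP (ab i)) addnn -mul2n exprM r2 rmorphXn.
by under eq_bigr do rewrite ab; rewrite prodr_const card_ord natrX.
Qed.

Lemma fun_bounded_monomial (a b : 'I_n.+1 -> nat) :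
  fun_bounded (@sphere_monomial R n.+1 a b).
Proof.
exists 1 => z; rewrite normrM mulr_ile1 // normr_prod prodr_ile1 // => i _.
  by rewrite normr_ge0 normrX exprn_ile1 // coord_le1.
by rewrite normr_ge0 normrX norm_conjC exprn_ile1 // coord_le1.
Qed.

(** Averages converge along an ultrafilter finer than [\oo] for every bounded function. For a fixed
    monomial they are eventually lattice averages, whose limit is known. *)
Lemma sphere_mean_exists : exists L, @sphere_mean R n L.
Proof.
have [U [UU UE]] := eventually_ultrafilter.
exists (fun F => ulim U (fun N => sphere_average N F)); split.
- move=> c F G bF bG; under [X in ulim U X]funext do rewrite sphere_average_linear.
  by apply: ulim_linear; exact: sphere_average_bounded.
- move=> F G bG FG; apply: ulim_norm_le; first exact: sphere_average_bounded.
  by move=> N; exact: sphere_average_norm_le.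
- move=> a b; pose s : R := if [forall i, a i == b i]
    then (\prod_i (a i)`! * n`!)%N%:R / (n + \sum_i a i)`!%:R else 0.
  transitivity (s%:C); last first.
    by rewrite /s; case: ifP => // _; rewrite rmorphM /= fmorphV !rmorph_nat.
  apply: (@ulim_eventually _ _ UU UE _
    (fun N => if [forall i, a i == b i] then lattice_average R a N.+1 else 0)).
    near=> N; rewrite sphere_average_monomial; first by case: ifP.
      move=> i; apply: (@leq_trans (\sum_i a i)%N).
        by rewrite (bigD1 i) //= leq_addr.
      by near: N; exact: nbhs_infty_ge.
    move=> i; apply: (@leq_trans (\sum_i b i)%N).
      by rewrite (bigD1 i) //= leq_addr.
    by near: N; exact: nbhs_infty_ge.
  rewrite /s; case: ifP => _; last exact: cvg_cst.
  have := @lattice_average_cvg R n a.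
  by rewrite -(cvg_shiftS (lattice_average R a)).
Unshelve. all: by end_near. Qed.

End mean_existence.

(** * Moments of the mean *)

Section coordinate.
Variable A : numFieldType.

(* For [z] a standard complex Gaussian, [shift_coef a b x y d] is the part of  *)
(* degree [d] in [y] of the expectation of [(z + x) ^+ a * (z^* + y) ^+ b].     *)
Definition shift_coef (a b : nat) (x y : A) (d : nat) : A :=
  'C(a, b - d)%:R * (b ^_ (b - d))%:R * x ^+ (a + d - b) * y ^+ d.

Definition shift_poly (a b : nat) (x y : A) : {poly A} :=
  \poly_(d < b.+1) shift_coef a b x y d.

(** Once factorials and powers are taken out, the convolution is Vandermonde's sum for
    ['C(a + d, b)]. The right-hand side is the contribution of one coordinate in
    [mean_dot_monomial]. *)
Lemma coef_shift_poly_texp N (a b : nat) (x y : A) (d : nat) : (d <= N)%N ->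
  (shift_poly a b x y * texp N (x * y))`_d =
  if (b <= a + d)%N then
    (a + d)`!%:R / (d`!%:R * (a + d - b)`!%:R) * x ^+ (a + d - b) * y ^+ d
  else 0.
Proof.
move=> dN; rewrite coefM.
have term (j : 'I_d.+1) :
    (shift_poly a b x y)`_j * (texp N (x * y))`_(d - j) =
    if (b <= a + d)%N then ('C(d, j) * if (j <= b)%N then 'C(a, b - j) else 0)%N%:R
      * (b`!%:R / d`!%:R * x ^+ (a + d - b) * y ^+ d) else 0.
  have jd : (j <= d)%N by rewrite -ltnS.
  rewrite !coef_poly ltnS [X in _ * X]ifT; last by lia.
  have [jb|bj] := leqP j b; last by rewrite mul0r muln0 mul0r if_same.
  (* If [a + j < b], the exponents are truncated, but the binomial coefficients vanish. *)
  rewrite /shift_coef; have [abj|abj] := ltnP a (b - j).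
    by rewrite bin_small // muln0 !mul0r if_same.
  rewrite ifT; last by lia.
  have -> : x ^+ (a + d - b) = x ^+ (a + j - b) * x ^+ (d - j).
    by rewrite -exprD; congr (_ ^+ _); lia.
  have -> : y ^+ d = y ^+ j * y ^+ (d - j) by rewrite -exprD subnKC.
  have Cd : 'C(d, j)%:R = d`!%:R / (j`!%:R * (d - j)`!%:R) :> A.
    by rewrite -bin_factV // mulrCA divff ?mulr1 // fact_neq0.
  have bj : (b ^_ (b - j))%:R = b`!%:R / j`!%:R :> A.
    by rewrite -(ffact_fact (leq_subr j b)) subKn // natrM mulfK // fact_neq0.
  rewrite natrM Cd bj exprMn.
  by field; rewrite !fact_neq0.
under eq_bigr do rewrite term.
case: ifPn => [bad|_]; last by rewrite big1.
rewrite -mulr_suml -natr_sum.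
have -> : (\sum_(j < d.+1) 'C(d, j) * (if j <= b then 'C(a, b - j) else 0) = 'C(a + d, b))%N.
  rewrite [(a + d)%N]addnC -binomial.Vandermonde.
  rewrite (big_ord_widen_cond (d + b).+1 xpredT
    (fun j => 'C(d, j) * (if j <= b then 'C(a, b - j) else 0))%N) ?ltnS ?leq_addr //.
  rewrite (big_ord_widen_cond (d + b).+1 xpredT
    (fun j => 'C(d, j) * 'C(a, b - j))%N) ?ltnS ?leq_addl //.
  rewrite big_mkcond [RHS]big_mkcond; apply: eq_bigr => j _ /=; rewrite !ltnS.
  have [jd|dj] := leqP j d; last by rewrite bin_small // if_same.
  by case: leqP; rewrite ?muln0.
have Cadb : 'C(a + d, b)%:R = (a + d)`!%:R / (b`!%:R * (a + d - b)`!%:R) :> A.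
  by rewrite -bin_factV // mulrCA divff ?mulr1 // fact_neq0.
by rewrite Cadb; field; rewrite !fact_neq0.
Qed.

End coordinate.

Section mean_moments.
Variables (R : realType) (n : nat).
Local Notation C := R[i].
Local Notation S := (csphere R n.+1).

Lemma fun_boundedD (T : Type) (F G : T -> C) : fun_bounded F -> fun_bounded G ->
  fun_bounded (fun z => F z + G z).
Proof.
move=> [M FM] [M' GM]; exists (M + M') => z.
by rewrite rmorphD (le_trans (ler_normD _ _)) // lerD.
Qed.

Lemma fun_boundedM (T : Type) (F G : T -> C) : fun_bounded F -> fun_bounded G ->
  fun_bounded (fun z => F z * G z).
Proof.
move=> [M FM] [M' GM]; exists (M * M') => z.
by rewrite rmorphM normrM ler_pM.
Qed.

Lemma fun_bounded_cst (T : Type) (c : C) : fun_bounded (fun _ : T => c).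
Proof. by exists (complex.Re `|c|) => _; rewrite RRe_norm. Qed.

Lemma fun_bounded_sum (T I : Type) (s : seq I) (P : pred I) (F : I -> T -> C) :
  (forall i, P i -> fun_bounded (F i)) ->
  fun_bounded (fun z => \sum_(i <- s | P i) F i z).
Proof.
move=> bF; elim: s => [|i s IH].
  by under eq_fun do rewrite big_nil; exact: fun_bounded_cst.
under eq_fun do rewrite big_cons.
have [Pi|//] := boolP (P i).
by apply: fun_boundedD => //; exact: bF.
Qed.

Section mean.
Variable L : (S -> C) -> C.
Hypothesis meanL : sphere_mean L.

Lemma mean_sum (I : Type) (s : seq I) (P : pred I) (c : I -> C) (F : I -> S -> C) :
  (forall i, P i -> fun_bounded (F i)) ->
  L (fun z => \sum_(i <- s | P i) c i * F i z) = \sum_(i <- s | P i) c i * L (F i).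
Proof.
move=> bF.
have L0 : L (fun=> 0) = 0.
  have := mean_linear meanL (-1) (fun_bounded_cst S 0) (fun_bounded_cst S 0).
  by rewrite mulr0 addr0 mulN1r addNr.
elim: s => [|i s IH].
  by rewrite big_nil; under eq_fun do rewrite big_nil.
rewrite big_cons; under eq_fun do rewrite big_cons.
have [Pi|//] := boolP (P i).
rewrite mean_linear ?IH //; first exact: bF.
by apply: fun_bounded_sum => j Pj; apply: fun_boundedM; [exact: fun_bounded_cst|exact: bF].
Qed.

Definition dot (w z : S) : C := \sum_i sval w ord0 i * Num.conj (sval z ord0 i).

Lemma dotJ w z : Num.conj (dot w z) = dot z w.
Proof.
by rewrite rmorph_sum; apply: eq_bigr => i _; rewrite rmorphM /= conjCK mulrC.
Qed.

Lemma dotzz (w : S) : dot w w = 1.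
Proof.
rewrite -(eqP (svalP w)); apply: eq_bigr => i _.
by rewrite -normCK.
Qed.

Definition shift_prod (a b : 'I_n.+1 -> nat) (w : S) : {poly C} :=
  \prod_i shift_poly (a i) (b i) (sval w ord0 i) (Num.conj (sval w ord0 i)).

(** Expand both powers by the multinomial formula, with exponents [g] and [d]. Only terms with
    [al + d = be + g] have nonzero mean, so [d] determines [g], and the sum over [d] is the
    coefficient of degree [b] in a product over coordinates. By [coef_shift_poly_texp] this product
    is [shift_prod] times an exponential. The hypothesis on degrees says that the phases balance. *)
Lemma mean_dot_monomial (a b : nat) (al be : 'I_n.+1 -> nat) (w : S) :
  (a + \sum_i be i = b + \sum_i al i)%N ->
  L (fun z => dot w z ^+ a * Num.conj (dot w z) ^+ b * sphere_monomial al be z) =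
  (a`! * b`! * n`!)%N%:R / (n + (\sum_i al i + b))`!%:R *
  \sum_(j < b.+1) (shift_prod al be w)`_j / (b - j)`!%:R.
Proof.
move=> abE; set N := (a + \sum_i al i + b)%N.
(* The bound [N] just chosen accommodates both [a] and every exponent [al i + d i - be i]. *)
pose x i := sval w ord0 i; pose y i := Num.conj (x i).
pose cg (g : {ffun 'I_n.+1 -> 'I_N.+1}) := \prod_i (x i ^+ g i / (g i)`!%:R).
pose cd (d : {ffun 'I_n.+1 -> 'I_b.+1}) := \prod_i (y i ^+ d i / (d i)`!%:R).
pose K : C := (a`! * b`! * n`!)%N%:R / (n + (\sum_i al i + b))`!%:R.
pose v i (d : nat) : C := if (be i <= al i + d)%N then
  (al i + d)`!%:R / (d`!%:R * (al i + d - be i)`!%:R) * x i ^+ (al i + d - be i) * y i ^+ d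
  else 0.
have -> : (fun z => dot w z ^+ a * Num.conj (dot w z) ^+ b * sphere_monomial al be z) =
  fun z => \sum_(dg : {ffun 'I_n.+1 -> 'I_b.+1} * {ffun 'I_n.+1 -> 'I_N.+1} |
      (\sum_i dg.1 i == b)%N && (\sum_i dg.2 i == a)%N)
    (a`!%:R * b`!%:R * cg dg.2 * cd dg.1) *
      sphere_monomial (fun i => al i + dg.1 i)%N (fun i => be i + dg.2 i)%N z.
  apply/funext => z.
  rewrite -(pair_big (fun d : {ffun 'I_n.+1 -> 'I_b.+1} => (\sum_i d i == b)%N)
     (fun g : {ffun 'I_n.+1 -> 'I_N.+1} => (\sum_i g i == a)%N)
     (fun d g => (a`!%:R * b`!%:R * cg g * cd d) *
      sphere_monomial (fun i => al i + d i)%N (fun i => be i + g i)%N z)) /=.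
  rewrite rmorph_sum /= (@multinomial_formula _ _ N) ?(@multinomial_formula _ _ b) //; last first.
    by rewrite /N -addnA leq_addr.
  set SA := \sum_(g | _) _; set SB := \sum_(g | _) _.
  have -> : a`!%:R * SA * (b`!%:R * SB) * sphere_monomial al be z =
    SB * (SA * (a`!%:R * b`!%:R * sphere_monomial al be z)) by ring.
  rewrite mulr_suml; apply: eq_bigr => d _.
  rewrite mulr_suml mulr_sumr; apply: eq_bigr => g _.
  rewrite /sphere_monomial /cg /cd.
  have split_exp (u : 'I_n.+1 -> C) (p q : 'I_n.+1 -> nat) :
      \prod_i u i ^+ (p i + q i) = \prod_i u i ^+ p i * \prod_i u i ^+ q i.
    by rewrite -big_split; apply: eq_bigr => i _; rewrite exprD.
  have split_mul (u u' : 'I_n.+1 -> C) (p : 'I_n.+1 -> nat) :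
      \prod_i ((u i * u' i) ^+ p i / (p i)`!%:R) =
      \prod_i (u i ^+ p i / (p i)`!%:R) * \prod_i u' i ^+ p i.
    by rewrite -big_split; apply: eq_bigr => i _; rewrite exprMn /= mulrAC.
  under [X in X * _ = _]eq_bigr do rewrite rmorphM /= conjCK.
  by rewrite !split_exp !split_mul; ring.
rewrite mean_sum; last by move=> *; exact: fun_bounded_monomial.
transitivity (\sum_(d : {ffun 'I_n.+1 -> 'I_b.+1} | (\sum_i d i == b)%N)
   K * \prod_i v i (d i)).
  rewrite -(pair_big (fun d : {ffun 'I_n.+1 -> 'I_b.+1} => (\sum_i d i == b)%N)
     (fun g : {ffun 'I_n.+1 -> 'I_N.+1} => (\sum_i g i == a)%N)
     (fun d g => (a`!%:R * b`!%:R * cg g * cd d) *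
      L (sphere_monomial (fun i => al i + d i)%N (fun i => be i + g i)%N))) /=.
  apply: eq_bigr => d /eqP db.
  (* Writing [v i (d i)] as a sum over [g] with at most one nonzero term allows the product over [i]
     to be distributed and matched with the moments. *)
  have vE i : v i (d i) = \sum_(g < N.+1)
      if (al i + d i == be i + g)%N
      then x i ^+ g / g`!%:R * (y i ^+ d i / (d i)`!%:R) * (al i + d i)`!%:R else 0.
    rewrite /v -big_mkcond /=; case: leqP => le; last first.
      by rewrite big_pred0 // => g; apply/negbTE; lia.
    have gN : (al i + d i - be i < N.+1)%N.
      have : (al i <= \sum_i al i)%N by rewrite (bigD1 i) //= leq_addr.
      by have := ltn_ord (d i); lia.
    rewrite (big_pred1 (Ordinal gN)) /=; last first.
      by move=> g /=; apply/eqP/eqP => [h|->]; [apply: val_inj => /=; lia|move=> /=; lia].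
    by field; rewrite !fact_neq0.
  rewrite [in RHS](eq_bigr _ (fun i _ => vE i)).
  rewrite bigA_distr_bigA mulr_sumr big_mkcond; apply: eq_bigr => g _.
  rewrite (mean_monomial meanL); have [ga|gna] := eqVneq (\sum_i g i)%N a;
    case: (boolP [forall i, (al i + d i == be i + g i)%N]).
  - move=> /forallP eqs.
    have -> : (\sum_i (al i + d i) = \sum_i al i + b)%N by rewrite big_split /= db.
    rewrite [X in _ = K * X](eq_bigr (fun i => x i ^+ g i / (g i)`!%:R * (y i ^+ d i / (d i)`!%:R) * (al i + d i)`!%:R)); last by move=> i _; rewrite eqs.
    rewrite /cg /cd !big_split /= natrM natr_prod /K !natrM.
    by field; rewrite fact_neq0.
  - rewrite negb_forall => /existsP[i nei].
    by rewrite (bigD1 i) //= (negPf nei) mul0r !mulr0.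
  - move=> /forallP eqs; case/eqP: gna.
    have : (\sum_i al i + \sum_i d i = \sum_i be i + \sum_i g i)%N.
      by rewrite -!big_split; apply: eq_bigr => i _; exact/eqP.
    by move: abE; rewrite db; lia.
  - rewrite negb_forall => /existsP[i nei].
    by rewrite (bigD1 i) //= (negPf nei) mul0r mulr0.
rewrite -mulr_sumr; congr (_ * _).
rewrite -(coef_prod_poly v) //.
(* The exponentials of the coordinates multiply to [exp 'X] because [w] has norm 1; its coefficients
   are the [1 / (b - j)!] of the statement. *)
have e1 : eqpoly_upto b (\prod_i \poly_(j < b.+1) v i j) (shift_prod al be w * texp b 1).
  apply: (@eqpoly_upto_trans _ _ _ (\prod_i (shift_poly (al i) (be i) (x i) (y i) * texp b (x i * y i)))).
    apply: eqpoly_upto_prod => i d db.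
    by rewrite coef_shift_poly_texp // coef_poly ltnS db.
  rewrite big_split; apply: eqpoly_uptoM => //.
  have <- : \sum_i x i * y i = 1 by exact: dotzz.
  exact: texp_prod.
rewrite e1 // coefM; apply: eq_bigr => j _.
by rewrite coef_poly ifT ?expr1n ?mul1r //; lia.
Qed.

End mean.
End mean_moments.

(** * Bihomogeneous functions on the sphere *)

Section bihomogeneous_functions.
Variables (R : realType) (n : nat).
Local Notation C := R[i].
Local Notation S := (csphere R n.+1).
Local Notation bihom_pred := (@bihom_pred R n.+1).

Lemma bihom_pred_monomial (p q : nat) (al be : 'I_n.+1 -> nat) :
  (\sum_i al i = p)%N -> (\sum_i be i = q)%N ->
  sphere_monomial al be \in bihom_pred p q.
Proof.
move=> alp beq; apply/asboolP.
exists (fun z : 'rV[C]_n.+1 => (\prod_i z ord0 i ^+ al i) *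
  (\prod_i Num.conj (z ord0 i) ^+ be i)) => //.
pose A : {ffun 'I_n.+1 -> 'I_p.+1} := [ffun i => inord (al i)].
pose B : {ffun 'I_n.+1 -> 'I_q.+1} := [ffun i => inord (be i)].
have AE i : A i = al i :> nat.
  by rewrite ffunE inordK // ltnS -alp (bigD1 i) //= leq_addr.
have BE i : B i = be i :> nat.
  by rewrite ffunE inordK // ltnS -beq (bigD1 i) //= leq_addr.
exists (fun a b => ((a == A) && (b == B))%:R) => z.
rewrite (bigD1 A) /=; last by under eq_bigr do rewrite AE; rewrite alp.
rewrite [X in _ + X]big1 ?addr0; last first.
  by move=> a /andP[_ /negPf aA]; rewrite big1 // => b _; rewrite aA !mul0r.
rewrite (bigD1 B) /=; last by under eq_bigr do rewrite BE; rewrite beq.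
rewrite [X in _ + X]big1 ?addr0; last first.
  by move=> b /andP[_ /negPf bB]; rewrite bB andbF !mul0r.
rewrite !eqxx mul1r; congr (_ * _); apply: eq_bigr => i _; first by rewrite AE.
by rewrite BE.
Qed.

Lemma bihom_predZ p q c (f : S -> C) : f \in bihom_pred p q ->
  (fun z => c * f z) \in bihom_pred p q.
Proof. by move=> hf; have := rpredZ c hf. Qed.

Lemma bihom_pred_sum p q (I : Type) (s : seq I) (P : pred I) (f : I -> S -> C) :
  (forall i, P i -> f i \in bihom_pred p q) ->
  (fun z => \sum_(i <- s | P i) f i z) \in bihom_pred p q.
Proof.
move=> fP; have := rpred_sum s fP.
suff -> : \sum_(i <- s | P i) f i = fun z => \sum_(i <- s | P i) f i z by [].
by apply/funext => z; rewrite fct_sumE.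
Qed.

Lemma bihom_pred_expand p q (f : S -> C) : f \in bihom_pred p q ->
  exists c, f = fun z => \sum_(ab : {ffun 'I_n.+1 -> 'I_p.+1} * {ffun 'I_n.+1 -> 'I_q.+1} |
     (\sum_i ab.1 i == p)%N && (\sum_i ab.2 i == q)%N)
     c ab * sphere_monomial (fun i => ab.1 i) (fun i => ab.2 i) z.
Proof.
move=> /asboolP[F [c Fc] ->]; exists (fun ab => c ab.1 ab.2); apply/funext => z.
rewrite Fc pair_big /=; apply: eq_bigr => ab _.
by rewrite -mulrA.
Qed.

(** Multiply by the sum of the [z_j conj(z_j)], which has bidegree [(1, 1)] and equals 1 on the
    sphere. *)
Lemma bihom_pred_raise p q k (f : S -> C) : f \in bihom_pred p q ->
  f \in bihom_pred (p + k) (q + k).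
Proof.
elim: k p q f => [|k IH] p q f fpq; first by rewrite !addn0.
rewrite !addnS -!addSn; apply: IH.
have [c ->] := bihom_pred_expand fpq.
apply: bihom_pred_sum => -[a b] /andP[/= /eqP ap /eqP bq]; apply: bihom_predZ.
have -> : sphere_monomial (fun i => a i) (fun i => b i) = fun z : S =>
   \sum_(j < n.+1) sphere_monomial (fun i => (i == j) + a i)%N (fun i => (i == j) + b i)%N z.
  apply/funext => z; rewrite -[LHS]mul1r -(dotzz z) mulr_suml; apply: eq_bigr => j _.
  have split_exp (u : 'I_n.+1 -> C) (r : 'I_n.+1 -> nat) :
      \prod_i u i ^+ ((i == j) + r i) = u j * \prod_i u i ^+ r i.
    under eq_bigr do rewrite exprD.
    rewrite big_split /=; congr (_ * _).
    by rewrite (bigD1 j) //= eqxx expr1 big1 ?mulr1 // => i /negPf ->.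
  by rewrite /sphere_monomial !split_exp mulrACA.
have sum_delta (j : 'I_n.+1) : (\sum_(i < n.+1) (i == j) = 1)%N.
  by rewrite (bigD1 j) //= eqxx big1 // => i /negPf ->.
apply: bihom_pred_sum => j _; apply: bihom_pred_monomial.
  by rewrite big_split /= sum_delta ap.
by rewrite big_split /= sum_delta bq.
Qed.

Lemma coef_shift_prod (al be : 'I_n.+1 -> nat) (w : S) j :
  (shift_prod al be w)`_j =
  \sum_(d : {ffun 'I_n.+1 -> 'I_j.+1} | (\sum_i d i == j)%N)
    (\prod_i if d i <= be i then 'C(al i, be i - d i) * be i ^_ (be i - d i) else 0)%N%:R
    * sphere_monomial (fun i => al i + d i - be i)%N (fun i => d i) w.
Proof.
pose v i d : C := if (d <= be i)%N then
  shift_coef (al i) (be i) (sval w ord0 i) (Num.conj (sval w ord0 i)) d else 0.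
transitivity ((\prod_i \poly_(d < j.+1) v i d)`_j).
  have : eqpoly_upto j (shift_prod al be w) (\prod_i \poly_(d < j.+1) v i d).
    by apply: eqpoly_upto_prod => i d dj; rewrite !coef_poly !ltnS dj.
  exact.
rewrite coef_prod_poly //; apply: eq_bigr => d _.
rewrite natr_prod /sphere_monomial -!big_split; apply: eq_bigr => i _ /=.
rewrite /v /shift_coef; case: ifP => _; last by rewrite mul0r.
by rewrite natrM !mulrA.
Qed.

(** In each term some coordinate has [al i + d i < be i], where the binomial coefficient is zero. *)
Lemma coef_shift_prod_small (al be : 'I_n.+1 -> nat) (w : S) j :
  (j + \sum_i al i < \sum_i be i)%N -> (shift_prod al be w)`_j = 0.
Proof.
move=> jlt; rewrite coef_shift_prod big1 // => d /eqP dj.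
have [i hi] : exists i, (al i + d i < be i)%N.
  apply/existsP; apply: contraLR jlt; rewrite negb_exists => /forallP h.
  rewrite -leqNgt -dj addnC -big_split; apply: leq_sum => i _.
  by rewrite leqNgt.
rewrite (bigD1 i) //= (@bin_small (al i)); last by rewrite ltn_subRL addnC.
by rewrite if_same mul0n mul0r.
Qed.

(** A nonzero term needs [d i <= be i] for all [i]; equality of the total degrees then forces
    [d = be]. *)
Lemma coef_shift_prod_top (al be : 'I_n.+1 -> nat) (w : S) :
  (shift_prod al be w)`_(\sum_i be i) = sphere_monomial al be w.
Proof.
rewrite coef_shift_prod; set q := (\sum_i be i)%N.
pose D : {ffun 'I_n.+1 -> 'I_q.+1} := [ffun i => inord (be i)].
have DE i : D i = be i :> nat.
  by rewrite ffunE inordK // ltnS /q (bigD1 i) //= leq_addr.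
rewrite (bigD1 D) /=; last by under eq_bigr do rewrite DE.
rewrite [X in _ + X]big1 ?addr0.
  rewrite big1 ?mul1r; last by move=> i _; rewrite DE leqnn subnn bin0 ffactn0.
  congr (_ * _); apply: eq_bigr => i _; last by rewrite DE.
  by rewrite DE addnK.
move=> d /andP[/eqP dq dD].
have [i hi] : exists i, (be i < d i)%N.
  apply/existsP; apply: contraNT dD; rewrite negb_exists => /forallP h.
  have le i : (d i <= be i)%N by rewrite leqNgt.
  apply/eqP/ffunP => i; apply: val_inj; rewrite /= DE; apply/eqP.
  rewrite eqn_leq le leqNgt; apply/negP => lt.
  have : (\sum_i d i < \sum_i be i)%N.
    rewrite (bigD1 i) //= [X in (_ < X)%N](bigD1 i) //= -addSn leq_add //.
    exact: leq_sum.
  by rewrite dq ltnn.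
by rewrite (bigD1 i) //= leqNgt hi mul0n mul0r.
Qed.

(** The nonzero terms are monomials of bidegree [(p + j - q, j)], and [bihom_pred_raise] lifts them
    to [(p, q)]. *)
Lemma bihom_pred_coef_shift_prod p q (al be : 'I_n.+1 -> nat) j :
  (\sum_i al i = p)%N -> (\sum_i be i = q)%N ->
  (fun w : S => (shift_prod al be w)`_j) \in bihom_pred p q.
Proof.
move=> alp beq; under eq_fun do rewrite coef_shift_prod.
apply: bihom_pred_sum => d /eqP dj.
have [h|] := boolP [forall i, (d i <= be i)%N && (be i <= al i + d i)%N].
  have {}h i : (d i <= be i /\ be i <= al i + d i)%N.
    by apply/andP; move/forallP: h; exact.
  have jq : (j <= q)%N by rewrite -dj -beq leq_sum // => i _; case: (h i).
  have pq : (q <= p + j)%N.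
    by rewrite -dj -beq -alp -big_split leq_sum // => i _; case: (h i).
  apply: bihom_predZ.
  have aE : (\sum_i (al i + d i - be i) = p + j - q)%N.
    have : (\sum_i (al i + d i - be i) + \sum_i be i = \sum_i al i + \sum_i d i)%N.
      by rewrite -!big_split; apply: eq_bigr => i _ /=; rewrite subnK //; case: (h i).
    by rewrite alp beq dj; lia.
  have := bihom_pred_raise (q - j) (bihom_pred_monomial aE dj).
  by have [-> ->] : ((p + j - q + (q - j) = p) /\ (j + (q - j) = q))%N by lia.
rewrite negb_forall => /existsP[i hi].
have -> : (\prod_i if d i <= be i then 'C(al i, be i - d i) * be i ^_ (be i - d i) else 0)%N = 0%N.
  rewrite (bigD1 i) //=; move: hi; case: leqP => //= _; rewrite -ltnNge => hi.
  by rewrite (@bin_small (al i)) ?mul0n // ltn_subRL addnC.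
under eq_fun do rewrite mul0r.
exact: (rpred0 (bihom_pred p q)).
Qed.

End bihomogeneous_functions.

(** * The reproducing kernel *)

Section reproducing_kernel.
Variables (R : realType) (n : nat).
Local Notation C := R[i].
Local Notation S := (csphere R n.+1).

(** Chosen to cancel the constant of [mean_dot_monomial] at the exponents [i + (p - q)] and
    [i + (q - p)], leaving a coefficient of [exp(-T)]. *)
Definition bihom_kernel_coef (p q i : nat) : R :=
  (-1) ^+ (minn p q - i) * (n + maxn p q + i)`!%:R /
  (n`! * (minn p q - i)`! * (i + (p - q))`! * (i + (q - p))`!)%N%:R.

(** One of the truncated differences is 0, so this is a power of [s] or of its conjugate, times a
    polynomial in [|s|^2]. *)
Definition zonal_sum (p q m : nat) (c : nat -> R) (s : C) : C :=
  \sum_(i < m.+1) (c i)%:C * (s ^+ (i + (p - q)) * Num.conj s ^+ (i + (q - p))).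

Definition bihom_kernel (p q : nat) : C -> C :=
  zonal_sum p q (minn p q) (bihom_kernel_coef p q).

Lemma norm_dot_le1 (w z : S) : `|dot w z| <= 1.
Proof.
apply: le_trans (ler_norm_sum _ _ _) _.
apply: (@le_trans _ _ (\sum_i (`|sval w ord0 i| ^+ 2 + `|sval z ord0 i| ^+ 2) / 2)).
  apply: ler_sum => i _; rewrite normrM norm_conjC.
  set x := `|_|; set y := `|_|.
  have : 0 <= (x - y) ^+ 2 by rewrite -realEsqr rpredB // normr_real.
  move=> h; rewrite ler_pdivlMr // -subr_ge0 (_ : _ - _ = (x - y) ^+ 2) //; ring.
rewrite -mulr_suml big_split /= (eqP (svalP w)) (eqP (svalP z)).
by rewrite divff.
Qed.

Lemma fun_bounded_dot (w : S) : fun_bounded (dot w).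
Proof. by exists 1 => z; exact: norm_dot_le1. Qed.

Lemma fun_boundedJ (T : Type) (F : T -> C) : fun_bounded F ->
  fun_bounded (fun z => Num.conj (F z)).
Proof. by move=> [M FM]; exists M => z; rewrite norm_conjC. Qed.

Lemma fun_boundedX (T : Type) (F : T -> C) k : fun_bounded F ->
  fun_bounded (fun z => F z ^+ k).
Proof.
move=> bF; elim: k => [|k IH].
  by under eq_fun do rewrite expr0; exact: fun_bounded_cst.
by under eq_fun do rewrite exprS; exact: fun_boundedM.
Qed.

Lemma fun_bounded_zonal p q m c (F : S -> C) : fun_bounded F ->
  fun_bounded (fun z => zonal_sum p q m c (F z)).
Proof.
move=> bF; apply: fun_bounded_sum => i _; apply: fun_boundedM.
  exact: fun_bounded_cst.
by apply: fun_boundedM; apply: fun_boundedX => //; exact: fun_boundedJ.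
Qed.

Lemma fun_bounded_bihom p q (f : S -> C) : f \in @bihom_pred R n.+1 p q -> fun_bounded f.
Proof.
move=> /bihom_pred_expand[c ->]; apply: fun_bounded_sum => ab _.
by apply: fun_boundedM; [exact: fun_bounded_cst|exact: fun_bounded_monomial].
Qed.

Variable L : (S -> C) -> C.
Hypothesis meanL : sphere_mean L.

(** Kernels with the phase of [K] map the space to itself, whatever their degree: by
    [mean_dot_monomial] the image of a monomial is a combination of coefficients of [shift_prod]. *)
Lemma mean_dot_bihom p q (a b : nat) (f : S -> C) : (a + q = b + p)%N ->
  f \in @bihom_pred R n.+1 p q ->
  (fun w => L (fun z => dot w z ^+ a * Num.conj (dot w z) ^+ b * f z))
    \in @bihom_pred R n.+1 p q.
Proof.
move=> abpq /bihom_pred_expand[c ->].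
have E w : L (fun z => dot w z ^+ a * Num.conj (dot w z) ^+ b *
    \sum_(ab : {ffun 'I_n.+1 -> 'I_p.+1} * {ffun 'I_n.+1 -> 'I_q.+1} |
     (\sum_i ab.1 i == p)%N && (\sum_i ab.2 i == q)%N)
     c ab * sphere_monomial (fun i => ab.1 i) (fun i => ab.2 i) z) =
  \sum_(ab : {ffun 'I_n.+1 -> 'I_p.+1} * {ffun 'I_n.+1 -> 'I_q.+1} |
     (\sum_i ab.1 i == p)%N && (\sum_i ab.2 i == q)%N)
     c ab * L (fun z => dot w z ^+ a * Num.conj (dot w z) ^+ b *
      sphere_monomial (fun i => ab.1 i) (fun i => ab.2 i) z).
  rewrite -(mean_sum meanL).
    by congr L; apply/funext => z; rewrite mulr_sumr; apply: eq_bigr => ab _; ring.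
  move=> ab _; apply: fun_boundedM; last exact: fun_bounded_monomial.
  have bd := fun_bounded_dot w.
  by apply: fun_boundedM; apply: fun_boundedX => //; exact: fun_boundedJ.
under eq_fun do rewrite E.
apply: bihom_pred_sum => ab /andP[/eqP ap /eqP bq]; apply: bihom_predZ.
under eq_fun => w do rewrite (mean_dot_monomial meanL) ?ap ?bq //.
apply: bihom_predZ; apply: bihom_pred_sum => j _.
under eq_fun do rewrite mulrC.
by apply: bihom_predZ; exact: bihom_pred_coef_shift_prod.
Qed.

Lemma mean_zonal_bihom p q m c (f : S -> C) : f \in @bihom_pred R n.+1 p q ->
  (fun w => L (fun z => zonal_sum p q m c (dot w z) * f z)) \in @bihom_pred R n.+1 p q.
Proof.
move=> fpq; have bf := fun_bounded_bihom fpq.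
have E w : L (fun z => zonal_sum p q m c (dot w z) * f z) = \sum_(i < m.+1)
    (c i)%:C * L (fun z => dot w z ^+ (i + (p - q)) * Num.conj (dot w z) ^+ (i + (q - p)) * f z).
  rewrite -(mean_sum meanL).
    by congr L; apply/funext => z; rewrite mulr_suml; apply: eq_bigr => ab _; ring.
  move=> i _; apply: fun_boundedM => //.
  have bd := fun_bounded_dot w.
  by apply: fun_boundedM; apply: fun_boundedX => //; exact: fun_boundedJ.
under eq_fun do rewrite E.
apply: bihom_pred_sum => i _; apply: bihom_predZ; apply: mean_dot_bihom => //; lia.
Qed.

(* Up to factorials the coefficients of the kernel are those of [exp (- T)],    *)
(* which cancels the factor [exp T] in the generating function of the moments.  *)
Lemma mean_kernel_monomial p q (al be : 'I_n.+1 -> nat) (w : S) :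
  (\sum_i al i = p)%N -> (\sum_i be i = q)%N ->
  L (fun z => bihom_kernel p q (dot w z) * sphere_monomial al be z) = sphere_monomial al be w.
Proof.
move=> alp beq.
have -> : L (fun z => bihom_kernel p q (dot w z) * sphere_monomial al be z) =
  \sum_(i < (minn p q).+1) (bihom_kernel_coef p q i)%:C *
    L (fun z => dot w z ^+ (i + (p - q)) * Num.conj (dot w z) ^+ (i + (q - p)) *
      sphere_monomial al be z).
  rewrite -(mean_sum meanL).
    by congr L; apply/funext => z; rewrite mulr_suml; apply: eq_bigr => ab _; ring.
  move=> i _; apply: fun_boundedM; last exact: fun_bounded_monomial.
  have bd := fun_bounded_dot w.
  by apply: fun_boundedM; apply: fun_boundedX => //; exact: fun_boundedJ.
set P := shift_prod al be w.
pose e b := \sum_(j < b.+1) P`_j / (b - j)`!%:R.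
have eE b : (b <= q)%N -> (P * texp q 1)`_b = e b.
  move=> bq; rewrite coefM; apply: eq_bigr => j _; rewrite coef_poly expr1n mul1r ifT //.
  by lia.
transitivity (\sum_(i < (minn p q).+1)
    (-1) ^+ (minn p q - i) / (minn p q - i)`!%:R * e (i + (q - p))%N).
  apply: eq_bigr => i _; rewrite (mean_dot_monomial meanL) alp ?beq; last by lia.
  rewrite -/P -/(e _) mulrA; congr (_ * _).
  have -> : (n + (p + (i + (q - p))) = n + maxn p q + i)%N by lia.
  rewrite /bihom_kernel_coef !natrM !(rmorphM, fmorphV, rmorphXn, rmorphN, rmorph1, rmorph_nat).
  by field; rewrite !fact_neq0.
transitivity (\sum_(b < q.+1) e b * ((-1) ^+ (q - b) / (q - b)`!%:R)); last first.
  rewrite -coef_shift_prod_top beq.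
  have H : eqpoly_upto q (P * texp q 1 * texp q (-1)) P.
    have : eqpoly_upto q (texp q 1 * texp q (-1)) (1 : {poly C}).
      by have := @texpD C q 1 (-1); rewrite subrr texp0.
    by move=> h; rewrite -mulrA -[X in eqpoly_upto _ _ X]mulr1; exact: eqpoly_uptoM.
  rewrite -/P -H // coefM; apply: eq_bigr => b _.
  have bq : (b <= q)%N by rewrite -ltnS.
  by rewrite eE // coef_poly ifT //; lia.
(* Terms with [b < q - p] vanish by [coef_shift_prod_small]; the others are indexed by
   [b = i + (q - p)]. *)
rewrite -(big_mkord xpredT (fun b => e b * ((-1) ^+ (q - b) / (q - b)`!%:R))).
rewrite (big_cat_nat _ (n := (q - p)%N)) //=; last by lia.
rewrite [X in _ = X + _]big1_seq ?add0r; last first.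
  move=> b /andP[_]; rewrite mem_index_iota => /andP[_ bqp].
  rewrite /e big1 ?mul0r // => j _.
  by rewrite /P coef_shift_prod_small ?mul0r // alp beq; have := ltn_ord j; lia.
rewrite -[X in index_iota X](add0n (q - p)%N) big_addn.
have -> : (q.+1 - (q - p) = (minn p q).+1)%N by lia.
rewrite big_mkord; apply: eq_bigr => i _; rewrite mulrC.
by have -> : (q - (i + (q - p)) = minn p q - i)%N by lia.
Qed.

Lemma mean_kernel p q (f : S -> C) (w : S) : f \in @bihom_pred R n.+1 p q ->
  L (fun z => bihom_kernel p q (dot w z) * f z) = f w.
Proof.
move=> /bihom_pred_expand[c ->].
transitivity (\sum_(ab : {ffun 'I_n.+1 -> 'I_p.+1} * {ffun 'I_n.+1 -> 'I_q.+1} |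
     (\sum_i ab.1 i == p)%N && (\sum_i ab.2 i == q)%N)
     c ab * L (fun z => bihom_kernel p q (dot w z) *
      sphere_monomial (fun i => ab.1 i) (fun i => ab.2 i) z)).
  rewrite -(mean_sum meanL).
    by congr L; apply/funext => z; rewrite mulr_sumr; apply: eq_bigr => ab _; ring.
  move=> ab _; apply: fun_boundedM; last exact: fun_bounded_monomial.
  exact/fun_bounded_zonal/fun_bounded_dot.
apply: eq_bigr => ab /andP[/eqP ap /eqP bq].
by rewrite mean_kernel_monomial.
Qed.

Definition sqdot (w z : S) : R := complex.Re (`|dot w z| ^+ 2).

Lemma sqdotE w z : (sqdot w z)%:C = dot w z * Num.conj (dot w z).
Proof. by rewrite -normCK /sqdot RRe_real // rpredX // normr_real. Qed.

Lemma sqdot_itv w z : 0 <= sqdot w z <= 1.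
Proof.
rewrite -!lecR sqdotE -normCK exprn_ge0 //=.
by rewrite exprn_ile1 // norm_dot_le1.
Qed.

(** For the constant monomial [shift_prod] is 1 and only [j = 0] contributes to [mean_dot_monomial];
    this gives the moments of [|<w,z>|^2]. *)
Lemma mean_radial (psi : {poly R}) (w : S) :
  L (fun z => (psi.[sqdot w z])%:C) =
  (\sum_(a < size psi) psi`_a * ((a`! * n`!)%N%:R / (n + a)`!%:R))%:C.
Proof.
rewrite rmorph_sum /=.
transitivity (\sum_(a < size psi) (psi`_a)%:C *
   L (fun z => dot w z ^+ a * Num.conj (dot w z) ^+ a * sphere_monomial (fun=> 0%N) (fun=> 0%N) z)).
  rewrite -(mean_sum meanL).
    congr L; apply/funext => z; rewrite horner_coef rmorph_sum; apply: eq_bigr => a _.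
    rewrite rmorphM rmorphXn /= sqdotE exprMn /sphere_monomial !big1 ?mulr1 //.
  move=> i _; apply: fun_boundedM; last exact: fun_bounded_monomial.
  have bd := fun_bounded_dot w.
  by apply: fun_boundedM; apply: fun_boundedX => //; exact: fun_boundedJ.
apply: eq_bigr => a _; rewrite (mean_dot_monomial meanL) //= big1_eq add0n.
have -> : shift_prod (fun=> 0%N) (fun=> 0%N) w = 1.
  rewrite /shift_prod big1 // => i _; apply/polyP => j; rewrite coef_poly coef1.
  by case: j => //= ; rewrite /shift_coef !expr0 !mulr1.
rewrite (bigD1 ord0) //= coef1 eqxx subn0 big1 ?addr0; last first.
  by move=> j /negbTE j0; rewrite coef1 (_ : (j == 0 :> nat)%N = false) ?mul0r.
rewrite [in RHS]rmorphM; congr (_ * _).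
rewrite !natrM !(rmorphM, fmorphV, rmorph_nat).
by rewrite div1r; field; rewrite !fact_neq0.
Qed.

End reproducing_kernel.

(** * The Hahn-Banach theorem *)

Section hahn_banach_real.
Variables (R : realType) (V : lmodType R[i]) (p : V -> R).
Hypothesis pD : forall x y, p (x + y) <= p x + p y.
Hypothesis pZ : forall (t : R) x, 0 <= t -> p (t%:C *: x) = t * p x.

(** Partial real-linear functionals are represented by graphs, so that extension is inclusion and
    the union of a chain is again a candidate. *)
Definition linear_graph (G : set (V * R)) := forall (t : R) x a y b,
  G (x, a) -> G (y, b) -> G (t%:C *: x + y, t * a + b).

Definition dominated_graph (G : set (V * R)) := forall x a, G (x, a) -> a <= p x.

Lemma linear_graph0 G : linear_graph G -> G !=set0 -> G (0, 0).
Proof.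
move=> lG [[x a] xa]; have := lG (-1) _ _ _ _ xa xa.
by rewrite rmorphN1 scaleN1r mulN1r !addNr.
Qed.

Lemma linear_graphZ G t x a : linear_graph G -> G (x, a) -> G (t%:C *: x, t * a).
Proof.
move=> lG xa; have G0 := linear_graph0 lG (ex_intro _ _ xa).
by have := lG t _ _ _ _ xa G0; rewrite !addr0.
Qed.

(** The value [c] at [x0] has to lie above all [a - p (x - x0)] and below all [p (y + x0) - b].
    Subadditivity puts the former below the latter, and [c] is the supremum of the former. *)
Lemma dominated_graph_extend G x0 : linear_graph G -> dominated_graph G -> G !=set0 ->
  exists G', [/\ linear_graph G', dominated_graph G', G `<=` G' & exists c, G' (x0, c)].
Proof.
move=> lG dG G0; have G00 := linear_graph0 lG G0.
pose E := [set xa.2 - p (xa.1 - x0) | xa in G].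
have Eub y b : G (y, b) -> ubound E (p (y + x0) - b).
  move=> yb _ [[x a] xa <-] /=.
  have := dG _ _ (lG 1 _ _ _ _ xa yb); rewrite scale1r mul1r.
  have := pD (x - x0) (y + x0); rewrite addrACA addNr addr0; lra.
have Ene : E !=set0 by exists (0 - p (0 - x0)), (0, 0).
have supE : has_sup E by split => //; exists (p (0 + x0) - 0); exact: Eub.
pose c := sup E.
have c1 y b : G (y, b) -> b + c <= p (y + x0).
  by move=> yb; have := ge_sup Ene (Eub _ _ yb); rewrite -/c; lra.
have c2 x a : G (x, a) -> a - c <= p (x - x0).
  move=> xa; have : a - p (x - x0) <= c by apply: sup_upper_bound => //; exists (x, a).
  by lra.
exists [set (xa.1 + t%:C *: x0, xa.2 + t * c) | xa in G & t in [set: R]]; split.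
- move=> t _ _ _ _ [[x a] /= xa [s _ [<- <-]]] [[y b] /= yb [r _ [<- <-]]].
  exists (t%:C *: x + y, t * a + b); first exact: lG.
  exists (t * s + r) => //=; congr pair; last by ring.
  by rewrite rmorphD rmorphM scalerDr scalerDl scalerA addrACA.
- move=> _ _ [[x a] /= xa [t _ [<- <-]]].
  have [t0|t0|->] := ltgtP t 0; last by rewrite scale0r mul0r !addr0; exact: dG.
    have nt : 0 < - t by rewrite oppr_gt0.
    have := c2 _ _ (linear_graphZ (- t)^-1 lG xa).
    rewrite -(ler_pM2l nt) -(pZ _ (ltW nt)) scalerBr scalerA -rmorphM divff ?gt_eqF //.
    rewrite scale1r rmorphN scaleNr opprK mulrBr mulrA divff ?gt_eqF //; lra.
  have := c1 _ _ (linear_graphZ t^-1 lG xa).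
  rewrite -(ler_pM2l t0) -(pZ _ (ltW t0)) scalerDr scalerA -rmorphM divff ?gt_eqF //.
  by rewrite scale1r mulrDr mulrA divff ?gt_eqF // mul1r.
- move=> [x a] xa; exists (x, a) => //; exists 0 => //=.
  by rewrite scale0r mul0r !addr0.
- exists c; exists (0, 0) => //; exists 1 => //=.
  by rewrite scale1r mul1r !add0r.
Qed.

(** Zorn's lemma, with [G0] adjoined to each candidate so that the empty chain is covered. A maximal
    graph is total by [dominated_graph_extend]. It is single-valued, since two values [a, b] at one
    point put [(0, b - a)] in the graph, whence [b - a <= p 0 = 0]. *)
Lemma hahn_banach_graph G0 : linear_graph G0 -> dominated_graph G0 -> G0 !=set0 ->
  exists u : V -> R, [/\ forall t x y, u (t%:C *: x + y) = t * u x + u y,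
    forall x, u x <= p x & forall x a, G0 (x, a) -> u x = a].
Proof.
move=> lG0 dG0 G00.
pose P : set (set (V * R)) :=
  [set H | linear_graph (G0 `|` H) /\ dominated_graph (G0 `|` H)].
have [|H [[lH dH] Hmax]] := @Zorn_bigcup _ P.
  move=> F FP Ftot; split=> [t x a y b xa yb|x a [|[X FX Xxa]]]; last 2 first.
  - exact: dG0.
  - by apply: (FP X FX).2; right.
  have common : exists2 X, F X \/ X = set0 &
      (G0 `|` X) (x, a) /\ (G0 `|` X) (y, b).
    case: xa yb => [xa|[X FX Xxa]] [yb|[X' FX' X'yb]].
    - by exists set0; [right|split; left].
    - by exists X'; [left|split; [left|right]].
    - by exists X; [left|split; [right|left]].
    have [XX'|X'X] := Ftot _ _ FX FX'.
      by exists X'; [left|split; right => //; exact: XX'].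
    by exists X; [left|split; right => //; exact: X'X].
  have [X [FX|->] [Xxa Xyb]] := common.
    by have [|] := (FP X FX).1 t _ _ _ _ Xxa Xyb; [left|right; exists X].
  by left; rewrite setU0 in Xxa Xyb; exact: lG0.
set G := G0 `|` H in lH dH.
have Gne : G !=set0 by have [z zG0] := G00; exists z; left.
have total x : exists a, G (x, a).
  have [G' [lG' dG' GG' [c xc]]] := dominated_graph_extend x lH dH Gne.
  exists c; apply: contrapT => nG.
  have G0G' : G0 `|` G' = G'.
    by apply/seteqP; split => [z [zG0|//]|z]; [apply: GG'; left|right].
  apply: (Hmax G'); last by rewrite /P /= G0G'.
  split=> [|HG']; first by move=> z Hz; apply: GG'; right.
  by apply: nG; right; exact: HG'.
have p0 : p 0 = 0 by have := @pZ 0 0 (lexx 0); rewrite scaler0 mul0r.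
have le_of x a b : G (x, a) -> G (x, b) -> b <= a.
  move=> xa xb; have := dH _ _ (lH (-1) _ _ _ _ xa xb).
  by rewrite rmorphN1 scaleN1r addNr p0; lra.
have functional x a b : G (x, a) -> G (x, b) -> a = b.
  by move=> xa xb; apply/eqP; rewrite eq_le !(le_of x).
pose u x := projT1 (cid (total x)).
have uG x : G (x, u x) by rewrite /u; case: cid.
exists u; split.
- by move=> t x y; apply: functional (uG _) _; exact: lH.
- by move=> x; exact: dH.
- by move=> x a xa; apply: functional (uG _) _; left.
Qed.

End hahn_banach_real.

(** The real part of [f], transported to the range of [I], extends to a real-linear [u]; then
    [g(y) = u(y) - i u(i y)] is complex-linear and extends [f]. *)
Lemma hahn_banach_complex (R : realType) (X : lmodType R[i]) (Y : normedModType R[i])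
    (I : {linear X -> Y}) (f : {linear X -> R[i]^o}) :
  (forall x, `|f x| <= `|I x|) ->
  exists g : Y -> R[i], [/\ forall c x y, g (c *: x + y) = c * g x + g y,
    forall y, `|g y| <= `|y| & forall x, g (I x) = f x].
Proof.
move=> fI; pose p (y : Y) := complex.Re `|y|.
have pE y : (p y)%:C = `|y| by rewrite /p RRe_real // normr_real.
pose G0 := [set (I x, complex.Re (f x)) | x in [set: X]].
have [|||||u [ulin up uG0]] := @hahn_banach_graph R Y p _ _ G0.
- by move=> x y; rewrite -lecR rmorphD /= !pE ler_normD.
- move=> t x t0; apply: complexI; rewrite rmorphM /= !pE normrZ ger0_norm //.
  by rewrite ler0c.
- move=> t _ _ _ _ [x _ [<- <-]] [y _ [<- <-]]; exists (t%:C *: x + y) => //.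
  have -> : f (t%:C *: x + y) = t%:C * f x + f y by exact: linearP.
  rewrite linearP Re_add. by rewrite (Re_mul t%:C (f x)) /= mul0r subr0.
- move=> _ _ [x _ [<- <-]]; apply: le_trans (ler_norm _) _.
  by apply: normC_le_Re; rewrite pE.
- by exists (I 0, complex.Re (f 0)), 0.
pose g y : R[i] := u y +i* - u ('i *: y).
have uD x y : u (x + y) = u x + u y.
  by have := ulin 1 x y; rewrite scale1r mul1r.
have u0 : u 0 = 0 by have := uD 0 0; rewrite addr0; lra.
have uZ t x : u (t%:C *: x) = t * u x by have := ulin t x 0; rewrite !addr0 u0 addr0.
have gD x y : g (x + y) = g x + g y.
  by rewrite /g scalerDr !uD; apply/eqP; rewrite eq_complex /= opprD !eqxx.
have gZ c x : g (c *: x) = c * g x.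
  have cE : c = (complex.Re c)%:C + (complex.Im c)%:C * 'i.
    by rewrite {1}[c]complexE [_ * 'i]mulrC.
  have ux : u (c *: x) = complex.Re c * u x + complex.Im c * u ('i *: x).
    by rewrite {1}cE scalerDl uD -scalerA !uZ.
  have uix : u ('i *: (c *: x)) = complex.Re c * u ('i *: x) - complex.Im c * u x.
    rewrite {1}cE scalerA mulrDr scalerDl uD -scalerA; congr (_ + _).
      by rewrite scalerA mulrC -scalerA uZ.
    rewrite mulrCA -expr2 sqr_i mulrN1 -rmorphN /= uZ; ring.
  rewrite /g ux uix; case: c {cE ux uix} => a b; apply/eqP.
  by rewrite eq_complex /=; apply/andP; split; apply/eqP; ring.
exists g; split.
- by move=> c x y; rewrite gD gZ.
- move=> y; have [->|gy0] := eqVneq (g y) 0; first by rewrite normr0.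
  (* Rotation by [c] makes the value of [g] real and nonnegative, hence equal to a value of [u],
     which is dominated by the norm. *)
  pose c := Num.conj (g y) / `|g y|.
  have c1 : `|c| = 1 by rewrite normrM norm_conjC normfV normr_id divff ?normr_eq0.
  have gcy : g (c *: y) = `|g y|.
    by rewrite gZ /c mulrAC mulrC [_ * g y]mulrC -normCK expr2 mulKf // normr_eq0.
  have -> : `|g y| = (u (c *: y))%:C.
    rewrite -gcy; have : complex.Im (g (c *: y)) = 0.
      by rewrite gcy; apply: ger0_Im.
    by rewrite /g /= => ->.
  by rewrite -(mul1r `|y|) -c1 -normrZ -pE lecR.
- move=> x; have uI z : u (I z) = complex.Re (f z) by apply: uG0; exists z.
  have fi : f ('i *: x) = 'i * f x by exact: linearZ.
  rewrite /g -linearZ !uI fi mulrC ReiNIm opprK.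
  by case: (f x).
Qed.

(** * The Banach space of bounded functions *)

Section sup_norm.
Variables (R : realType) (T : Type).
Local Notation C := R[i].
Implicit Types f g : T -> C.

Definition sup_norm f : R := sup [set complex.Re `|f z| | z in [set: T]].

Lemma le_sup_norm f z : fun_bounded f -> `|f z| <= (sup_norm f)%:C.
Proof.
move=> [M fM]; rewrite -RRe_norm lecR; apply: ub_le_sup; last by exists z.
by exists M => _ [w _ <-]; rewrite -lecR RRe_norm.
Qed.

Lemma sup_norm_le f M : 0 <= M -> (forall z, `|f z| <= M%:C) -> sup_norm f <= M.
Proof.
move=> M0 fM; rewrite /sup_norm; set E := [set _ | _ in _].
have [->|/set0P E0] := eqVneq E set0; first by rewrite sup0.
by apply: ge_sup => // _ [z _ <-]; rewrite -lecR RRe_norm.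
Qed.

Lemma sup_norm_ge0 f : fun_bounded f -> 0 <= sup_norm f.
Proof.
move=> bf; rewrite /sup_norm; set E := [set _ | _ in _].
have [->|/set0P[_ [z _ _]]] := eqVneq E set0; first by rewrite sup0.
by rewrite -ler0c; exact: le_trans (normr_ge0 _) (le_sup_norm z bf).
Qed.

End sup_norm.

Section bounded_functions.
Variables (R : realType) (T : Type).
Local Notation C := R[i].

Definition bounded_pred : {pred T -> C} := fun f => `[< fun_bounded f >].

(** The space [l^infty(T)]. For [T] the sphere it is the overspace of the lower bound. *)
Record bounded_function : Type := BoundedFunction {
  bounded_function_fun :> T -> C;
  _ : bounded_function_fun \in bounded_pred
}.

HB.instance Definition _ := [isSub for bounded_function_fun].
HB.instance Definition _ := [Choice of bounded_function by <:].

Lemma bounded_pred_submod_closed : submod_closed bounded_pred.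
Proof.
split; first by apply/asboolP; exact: fun_bounded_cst.
move=> c f g /asboolP bf /asboolP bg; apply/asboolP.
by apply: fun_boundedD => //; apply: fun_boundedM => //; exact: fun_bounded_cst.
Qed.

HB.instance Definition _ :=
  GRing.isSubmodClosed.Build C (T -> C) bounded_pred bounded_pred_submod_closed.
HB.instance Definition _ := [SubChoice_isSubLmodule of bounded_function by <:].

Implicit Types f g : bounded_function.

Lemma bounded_functionP f : fun_bounded f.
Proof. by case: f => f /= /asboolP. Qed.

Definition bounded_norm f : C := (sup_norm f)%:C.

Lemma bounded_normD f g : bounded_norm (f + g) <= bounded_norm f + bounded_norm g.
Proof.
have [bf bg] := (bounded_functionP f, bounded_functionP g).
rewrite /bounded_norm -rmorphD lecR; apply: sup_norm_le.
  by apply: addr_ge0; exact: sup_norm_ge0.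
move=> z; rewrite rmorphD; apply: le_trans (ler_normD (f z) (g z)) _.
by apply: lerD; exact: le_sup_norm.
Qed.

Lemma bounded_normZ c f : bounded_norm (c *: f) = `|c| * bounded_norm f.
Proof.
have le1 k g : bounded_norm (k *: g) <= `|k| * bounded_norm g.
  have bg := bounded_functionP g.
  rewrite /bounded_norm -(RRe_norm k) -rmorphM lecR; apply: sup_norm_le.
    by apply: mulr_ge0; [rewrite -ler0c RRe_norm|exact: sup_norm_ge0].
  move=> z; rewrite rmorphM /= RRe_norm [leLHS](normrM k (g z)).
  by apply: ler_wpM2l => //; exact: le_sup_norm.
apply/eqP; rewrite eq_le le1 /=; have [->|c0] := eqVneq c 0.
  rewrite normr0 mul0r lecR; apply: sup_norm_ge0; exact: bounded_functionP.
have := le1 c^-1 (c *: f); rewrite scalerA mulVf // scale1r normfV.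
by rewrite mulrC ler_pdivlMr ?normr_gt0 // mulrC.
Qed.

Lemma bounded_norm_eq0 f : bounded_norm f = 0 -> f = 0.
Proof.
move=> f0; apply/val_inj/funext => z; apply/eqP; rewrite -normr_le0.
by apply: le_trans (le_sup_norm z (bounded_functionP f)) _; rewrite -/(bounded_norm f) f0.
Qed.

HB.instance Definition _ := Lmodule_isNormed.Build C bounded_function
  bounded_normD bounded_normZ bounded_norm_eq0.

Lemma bounded_function_normE f : `|f| = (sup_norm f)%:C.
Proof. by []. Qed.

Lemma norm_bounded_functionP f (M : R) : 0 <= M ->
  `|f| <= M%:C <-> forall z, `|f z| <= M%:C.
Proof.
move=> M0; split=> [fM z|fM].
  exact: le_trans (le_sup_norm z (bounded_functionP f)) fM.
by rewrite bounded_function_normE lecR; exact: sup_norm_le.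
Qed.

(** A Cauchy filter is uniformly Cauchy, so real and imaginary parts converge pointwise, and the
    uniform estimates survive in the limit. *)
Lemma bounded_function_complete (F : set_system bounded_function) :
  ProperFilter F -> cauchy F -> cvg F.
Proof.
move=> FF /cauchy_ballP Fc.
have FcN (e : R) : 0 < e -> exists2 A, F A &
    forall f g, A f -> A g -> forall z, `|f z - g z| <= e%:C.
  move=> e0; have e0C : 0 < e%:C by rewrite ltcR.
  have [[A B] /= [FA FB] AB] := Fc _ e0C; exists (A `&` B); first exact: filterI.
  move=> f g [Af _] [_ Bg] z.
  have /ltW : `|f - g| < e%:C by have := AB (f, g) (conj Af Bg); rewrite -ball_normE.
  by move=> /(norm_bounded_functionP _ (ltW e0)) /(_ z).
have part_cvg (h : C -> R) : (forall x y (e : R), `|x - y| <= e%:C -> `|h x - h y| <= e) ->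
    forall z, cvg (h (f z) @[f --> F]).
  move=> hL z; apply: cauchy_cvg; apply/cauchy_ballP => e e0.
  have e20 : 0 < e / 2 by rewrite divr_gt0.
  have [A FA AE] := FcN _ e20.
  exists ((fun f : bounded_function => h (f z)) @` A, (fun f : bounded_function => h (f z)) @` A).
    by split; rewrite /= /nbhs /=; apply: filterS FA => f Af; exists f.
  move=> [_ _] [/= [f Af <-] [g Ag <-]]; rewrite -ball_normE /=.
  by apply: le_lt_trans (hL _ _ _ (AE f g Af Ag z)) _; rewrite ltr_pdivrMr // ltr_pMr // ltr1n.
have ReL (x y : C) (e : R) : `|x - y| <= e%:C -> `|complex.Re x - complex.Re y| <= e.
  by move/normC_le_Re; case: x y => [a b] [c d].
have ImL (x y : C) (e : R) : `|x - y| <= e%:C -> `|complex.Im x - complex.Im y| <= e.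
  by move/normC_le_Im; case: x y => [a b] [c d].
pose g0 (z : T) : C := lim (complex.Re (f z) @[f --> F]) +i* lim (complex.Im (f z) @[f --> F]).
have close e A : 0 < e -> F A ->
    (forall f g, A f -> A g -> forall z, `|f z - g z| <= e%:C) ->
    forall f, A f -> forall z, `|f z - g0 z| <= e%:C.
  move=> e0 FA AE f Af z; rewrite normC_le; last exact: ltW.
  have subE (x y : C) : complex.Re (x - y) ^+ 2 + complex.Im (x - y) ^+ 2 =
     (complex.Re x - complex.Re y) ^+ 2 + (complex.Im x - complex.Im y) ^+ 2.
    by case: x y => [a b] [c d].
  rewrite subE /g0 /=.
  have sqr_cvg (h : bounded_function -> R) (a l : R) : h @ F --> l ->
      ((a - h f) ^+ 2 @[f --> F]) --> (a - l) ^+ 2.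
    move=> hl; rewrite expr2; under eq_fun do rewrite expr2.
    by apply: cvgM; apply: cvgB => //; exact: cvg_cst.
  have c1 := sqr_cvg _ (complex.Re (f z)) _ (part_cvg _ ReL z).
  have c2 := sqr_cvg _ (complex.Im (f z)) _ (part_cvg _ ImL z).
  apply: (ler_cvg_to (cvgD c1 c2) (cvg_cst (e ^+ 2))).
  apply: filterS FA => g Ag /=.
  by have := AE _ _ Af Ag z; rewrite normC_le ?subE // ltW.
have bg0 : fun_bounded g0.
  have [A FA AE] := FcN 1 ltr01; have [f Af] := filter_ex FA.
  have [M fM] := bounded_functionP f; exists (M + 1) => z.
  rewrite [g0 z](_ : _ = f z - (f z - g0 z)); last by rewrite opprB addrC subrK.
  rewrite rmorphD; apply: le_trans (ler_normB _ _) _; apply: lerD => //.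
  exact: (close _ _ ltr01 FA AE f Af z).
have bg0P : g0 \in bounded_pred by apply/asboolP.
apply/cvg_ex; exists (BoundedFunction bg0P).
apply/cvgrPdist_le => e e0.
have eE : e = (complex.Re e)%:C by rewrite RRe_real // gtr0_real.
have e0R : 0 < complex.Re e by rewrite -ltcR -eE.
have [A FA AE] := FcN _ e0R; rewrite /=.
apply: (filterS _ FA) => f Af; rewrite eE distrC.
apply/(norm_bounded_functionP _ (ltW e0R)) => z.
exact: (close _ _ e0R FA AE f Af z).
Qed.

HB.instance Definition _ := Uniform_isComplete.Build bounded_function
  bounded_function_complete.

End bounded_functions.

Definition bounded_functions_banach (R : realType) (T : Type) : completeNormedModType R[i] :=
  bounded_function R T.

(** * Visser's polynomials and Jacobi polynomials *)

Section visser.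
Variable R : realType.

(* ['X * visser j] is the j-th iterate of Visser's recursion                  *)
(* [v -> v + ('X - v ^+ 2) / 2], which increases to the square root on [0,1]. *)
Fixpoint visser (j : nat) : {poly R} :=
  if j is j'.+1 then visser j' + 2^-1 *: (1 - 'X * visser j' ^+ 2) else 0.

(** If [v] is the current iterate at [y^2] and [v'] the next, then
    [y - v' = (y - v) (1 - (y + v)/2)]. Since [(1 - (y + v)/2) (1 + (j+1) y/2) <= 1 + j y/2], the
    second bound is preserved. *)
Lemma visser_bounds j (y : R) : 0 <= y <= 1 ->
  [/\ 0 <= y ^+ 2 * (visser j).[y ^+ 2] <= y &
      (y - y ^+ 2 * (visser j).[y ^+ 2]) * (1 + j%:R * y / 2) <= y].
Proof.
move=> /andP[y0 y1]; elim: j => [|j [/andP[IH0 IH1] IH2]].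
  by rewrite /= horner0 mulr0 lexx y0 subr0 !mul0r addr0 mulr1.
rewrite /= !hornerE /=; set r := (visser j).[y ^+ 2] in IH0 IH1 IH2 *.
set v := y ^+ 2 * r in IH0 IH1 IH2.
rewrite [y ^+ 2 * _](_ : _ = v + (y ^+ 2 - v ^+ 2) / 2); last by rewrite /v; field.
have e : y - (v + (y ^+ 2 - v ^+ 2) / 2) = (y - v) * (1 - (y + v) / 2) by field.
split; first by apply/andP; split; [nra | rewrite -subr_ge0 e; nra].
rewrite e; apply: le_trans IH2.
have h1 : 0 <= y - v by lra.
rewrite -mulrA; apply: ler_wpM2l => //.
have j0 : 0 <= j%:R :> R by rewrite ler0n.
have jy0 : 0 <= j%:R * y by exact: mulr_ge0.
have vjy0 := mulr_ge0 IH0 jy0; have vy0 := mulr_ge0 IH0 y0.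
have jyy0 := mulr_ge0 jy0 y0; have yy0 := mulr_ge0 y0 y0.
rewrite -subr_ge0 -natr1.
set w := (X in 0 <= X).
have -> : w = (v + v + j%:R * y * y + y * y + v * (j%:R * y) + v * y) / 4.
  by rewrite /w; field.
by rewrite divr_ge0 // !addr_ge0.
Qed.

(** The error is at most [2 / j] uniformly, also near [y = 0]: divide the second bound of
    [visser_bounds] by [y]. *)
Lemma visser_approx j (y : R) : 0 <= y <= 1 ->
  (y - y ^+ 2 * (visser j).[y ^+ 2]) * j%:R <= 2.
Proof.
move=> y01; have [/andP[h0 h1] h2] := visser_bounds j y01.
have /andP[y0 y1] := y01.
set v := y ^+ 2 * _ in h0 h1 h2 *.
have [y00|yn0] := eqVneq y 0.
  have v0 : v = 0 by apply/eqP; rewrite eq_le h0 -[leRHS]y00 h1.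
  by rewrite y00 v0 subr0 mul0r.
have yp : 0 < y by rewrite lt_neqAle eq_sym yn0.
rewrite -(ler_pM2l yp).
have -> : y * ((y - v) * j%:R) = 2 * ((y - v) * (1 + j%:R * y / 2) - (y - v)) by field.
lra.
Qed.

Lemma visser_le1 j (y : R) : 0 <= y <= 1 -> 0 <= y * (visser j).[y ^+ 2] <= 1.
Proof.
move=> y01; have [/andP[h0 h1] _] := visser_bounds j y01.
have /andP[y0 _] := y01.
have [->|yn0] := eqVneq y 0; first by rewrite mul0r lexx ler01.
have yp : 0 < y by rewrite lt_neqAle eq_sym yn0.
move: h0 h1; rewrite expr2 -mulrA pmulr_rge0 // => ->.
by rewrite -[leRHS]mulr1 ler_pM2l.
Qed.

End visser.

Section jacobi_polynomial.
Variable R : realType.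

Lemma derive1n_horner (p : {poly R}) j : derive1n j (fun s : R => p.[s]) = fun s => (p^`(j)).[s].
Proof.
elim: j => [|j IH]; first by rewrite derive1n0.
rewrite derive1nS IH derivnS; apply/funext => s.
rewrite derive1E; exact: (@derive_val _ _ _ _ _ _ _ (is_derive_poly (p^`(j)) s)).
Qed.

Lemma derive1n_eq_itv (f g : R -> R) (a b : R) j :
  (forall t, a < t < b -> f t = g t) -> forall t, a < t < b -> derive1n j f t = derive1n j g t.
Proof.
move=> fg; elim: j => [|j IH] t atb; first exact: fg.
rewrite !derive1nS !derive1E; apply: near_eq_derive.
have /andP[at_ tb] := atb.
by near=> s; apply: IH; apply/andP; split; near: s; [exact: lt_nbhsr|exact: lt_nbhsl].
Unshelve. all: by end_near. Qed.

(** Taylor coefficients at [x]; they turn the derivative in Rodrigues' formula into coefficient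
    extraction. *)
Lemma coef_comp_shift (p : {poly R}) (x : R) j :
  (p \Po ('X + x%:P))`_j = (p^`N(j)).[x].
Proof.
have -> : p \Po ('X + x%:P) = \poly_(i < size p) (p^`N(i)).[x].
  apply: horner_itv_inj => t _.
  rewrite horner_comp !hornerE addrC nderiv_taylor; last exact: mulrC.
  by rewrite horner_poly.
rewrite coef_poly; case: ltnP => // sp.
by rewrite nderivn_poly0 // horner0.
Qed.

Lemma coef_exp_linear (c d : R) N i :
  ((c%:P + d *: 'X) ^+ N)`_i = 'C(N, i)%:R * c ^+ (N - i) * d ^+ i.
Proof.
rewrite exprDn coef_sum.
have E (l : 'I_N.+1) : (c%:P ^+ (N - l) * (d *: 'X) ^+ l *+ 'C(N, l))`_i =
    if (l == i :> nat) then 'C(N, i)%:R * c ^+ (N - i) * d ^+ i else 0.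
  rewrite coefMn -rmorphXn /= exprZn -scalerAr coefZ coefCM coefXn eq_sym.
  by case: eqP => [->|_]; rewrite ?mulr1 ?mulr0 ?mul0rn // -mulr_natl; ring.
under eq_bigr do rewrite E.
have [iN|Ni] := ltnP i N.+1.
  by rewrite -big_mkcond /= (big_pred1 (Ordinal iN)).
rewrite bin_small // !mul0r big1 // => l _.
by case: eqP => // li; have := ltn_ord l; rewrite li ltnNge Ni.
Qed.

Lemma bin_trinomial (N s u : nat) : (u <= s)%N -> (s <= N)%N ->
  ('C(N, s) * 'C(s, u) = 'C(N, u) * 'C(N - u, s - u))%N.
Proof.
move=> us sN.
have f0 : (0 < u`! * (s - u)`! * (N - s)`!)%N by rewrite !muln_gt0 !fact_gt0.
apply/eqP; rewrite -(eqn_pmul2r f0); apply/eqP.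
have h1 := bin_fact sN; have h2 := bin_fact us.
have h3 := bin_fact (leq_trans us sN).
have h4 : ('C(N - u, s - u) * ((s - u)`! * (N - s)`!) = (N - u)`!)%N.
  have le : (s - u <= N - u)%N by lia.
  by rewrite -(bin_fact le); congr (_ * (_ * _`!))%N; lia.
transitivity (N`!).
  by rewrite -h1 -h2; ring.
by rewrite -h3 -h4; ring.
Qed.

(** The left side is the classical two-term form of the Jacobi polynomial at [2t - 1]. Expand
    [(t - 1)^s], apply [bin_trinomial], and sum over [s] by Vandermonde's identity. *)
Lemma vandermonde_alternating (n k m : nat) (t : R) :
  \sum_(s < m.+1) 'C(n + m, m - s)%:R * 'C(k + m, s)%:R * (t - 1) ^+ s * t ^+ (m - s) =
  \sum_(b < m.+1) (-1) ^+ (m - b) * 'C(m + k, m - b)%:R * 'C(n + (m + k) + b, b)%:R * t ^+ b.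
Proof.
transitivity (\sum_(s < m.+1) \sum_(u < m.+1) (-1) ^+ u * t ^+ (m - u) *
    ('C(n + m, m - s) * ('C(k + m, u) * if u <= s then 'C(k + m - u, s - u) else 0))%N%:R).
  apply: eq_bigr => s _; have sm : (s <= m)%N by rewrite -ltnS.
  rewrite exprDn !(mulr_sumr, mulr_suml).
  rewrite (big_ord_widen_cond m.+1 xpredT (fun u => 'C(n + m, m - s)%:R * 'C(k + m, s)%:R *
     (t ^+ (s - u) * (-1) ^+ u *+ 'C(s, u)) * t ^+ (m - s))) ?ltnS //.
  rewrite big_mkcond; apply: eq_bigr => u _ /=; rewrite ltnS.
  case: leqP => us; last by rewrite !muln0 mulr0.
  have -> : t ^+ (m - u) = t ^+ (s - u) * t ^+ (m - s) by rewrite -exprD; congr (_ ^+ _); lia.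
  have [skm|kms] := leqP s (k + m); last by lia.
  rewrite -bin_trinomial // -mulr_natr !natrM; ring.
rewrite exchange_big (reindex_inj rev_ord_inj); apply: eq_bigr => b _ /=.
have bm : (b <= m)%N by rewrite -ltnS.
rewrite subSS -mulr_sumr -natr_sum subKn // -!mulrA; congr (_ * _).
rewrite mulrC !mulrA -natrM; congr (_%:R * _).
rewrite [(m + k)%N]addnC.
have -> : 'C(n + (k + m) + b, b) = (\sum_(s < m.+1) 'C(n + m, m - s) *
    if m - b <= s then 'C(k + b, s - (m - b)) else 0)%N.
  rewrite [RHS](reindex_inj rev_ord_inj) /=.
  have -> : (n + (k + m) + b = n + m + (k + b))%N by lia.
  rewrite -binomial.Vandermonde.
  rewrite (big_ord_widen_cond m.+1 xpredT
    (fun j => 'C(n + m, j) * 'C(k + b, b - j))%N) ?ltnS //.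
  rewrite big_mkcond; apply: eq_bigr => j _ /=; rewrite ltnS subSS.
  have jm : (j <= m)%N by rewrite -ltnS.
  rewrite subKn //; case: leqP => jb; last by rewrite ifF ?muln0 //; lia.
  by rewrite ifT; [congr (_ * 'C(_, _))%N; lia | lia].
rewrite big_distrr /=; apply: eq_bigr => s _.
rewrite mulnCA; congr (_ * (_ * _))%N; case: ifP => // _; congr 'C(_, _); lia.
Qed.

(** The Jacobi polynomial at [2t - 1] in powers of [t = |s|^2], the form in which it occurs in the
    kernel. *)
Definition shifted_jacobi (n k m : nat) : {poly R} :=
  \poly_(b < m.+1) ((-1) ^+ (m - b) * 'C(m + k, m - b)%:R * 'C(n + (m + k) + b, b)%:R).

(** At a point [x] of []-1, 1[] the derivative in Rodrigues' formula is [m!] times the coefficient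
    of degree [m] in [(1 - x - 'X)^(n + m) (1 + x + 'X)^(k + m)]. Its expansion is the left side of
    [vandermonde_alternating] at [t = (1 + x)/2]. *)
Lemma jacobi_shift n k m (t : R) :
  (jacobi (n%:R : R) k%:R m).[2 * t - 1] = (shifted_jacobi n k m).[t].
Proof.
suff -> : jacobi (n%:R : R) k%:R m = shifted_jacobi n k m \Po (2^-1 *: ('X + 1)).
  by rewrite horner_comp !hornerE; congr _.[_]; field.
move: t => _; apply: horner_itv_inj => x x11; rewrite jacobiE // horner_comp !hornerE.
have /andP[x1 x2] := x11.
have p1 : 0 < 1 - x by rewrite subr_gt0.
have p2 : 0 < 1 + x by rewrite -ltrBlDl sub0r.
pose W : {poly R} := (1%:P + (-1) *: 'X) ^+ (n + m) * (1%:P + 1 *: 'X) ^+ (k + m).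
have DW : derive1n m (fun s : R => (1 - s) `^ (n%:R + m%:R) * (1 + s) `^ (k%:R + m%:R)) x =
    (W^`(m)).[x].
  have <- := congr1 (fun f => f x) (derive1n_horner W m).
  apply: (@derive1n_eq_itv _ _ (-1) 1) => // s /andP[s1 s2].
  have q1 : 0 <= 1 - s by rewrite subr_ge0 ltW.
  have q2 : 0 <= 1 + s by rewrite -lerBlDl sub0r ltW.
  by rewrite -!natrD !powR_mulrn // /W !hornerE mulN1r.
rewrite /rodrigues DW nderivn_def hornerMn -coef_comp_shift.
have -> : W \Po ('X + x%:P) =
    ((1 - x)%:P + (-1) *: 'X) ^+ (n + m) * ((1 + x)%:P + 1 *: 'X) ^+ (k + m).
  have cl (c d : R) : (c%:P + d *: 'X) \Po ('X + x%:P) = (c + d * x)%:P + d *: 'X.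
    rewrite comp_polyD comp_polyC comp_polyZ comp_polyX scalerDr.
    by rewrite -[d *: x%:P]mul_polyC -polyCM polyCD -addrA [_ + (d * x)%:P]addrC.
  by rewrite /W comp_polyM !(rmorphXn (comp_poly ('X + x%:P))) /= !cl mulN1r mul1r.
rewrite coefM.
have -> : (1 - x) `^ (- n%:R) = ((1 - x) ^+ n)^-1 by rewrite powRN powR_mulrn // ltW.
have -> : (1 + x) `^ (- k%:R) = ((1 + x) ^+ k)^-1 by rewrite powRN powR_mulrn // ltW.
rewrite horner_poly -vandermonde_alternating; set t := 2^-1 * (x + 1).
have e1 : 1 - x = 2 * (1 - t) by rewrite /t; field.
have e2 : 1 + x = 2 * t by rewrite /t; field.
rewrite [RHS](reindex_inj rev_ord_inj) /= -[(\sum_(_ < _) _) *+ _]mulr_natr !(mulr_sumr, mulr_suml).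
apply: eq_bigr => i _; have im : (i <= m)%N by rewrite -ltnS.
rewrite !coef_exp_linear subSS subKn // expr1n mulr1.
have -> : (n + m - i = n + (m - i))%N by lia.
have -> : (k + m - (m - i) = k + i)%N by lia.
rewrite !exprD.
have n1 : (1 - x) ^+ n != 0 by rewrite expf_neq0 // gt_eqF.
have n2 : (1 + x) ^+ k != 0 by rewrite expf_neq0 // gt_eqF.
have f0 : m`!%:R != 0 :> R by exact: fact_neq0.
have -> : (t - 1) ^+ (m - i) = (-1) ^+ (m - i) * (1 - t) ^+ (m - i).
  by rewrite -exprMn; congr (_ ^+ _); ring.
have -> : (1 - x) ^+ (m - i) = 2 ^+ (m - i) * (1 - t) ^+ (m - i) by rewrite e1 exprMn.
have -> : (1 + x) ^+ i = 2 ^+ i * t ^+ i by rewrite e2 exprMn.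
have E2 : 2 ^+ m = 2 ^+ (m - i) * 2 ^+ i :> R by rewrite -exprD subnK.
have S2 : (-1) ^+ m * (-1) ^+ i = (-1) ^+ (m - i) :> R.
  by rewrite -{1}(subnK im) exprD -mulrA -exprD addnn -mul2n exprM sqrrN !expr1n mulr1.
rewrite -S2 E2.
have z2 : 2 != 0 :> R by rewrite pnatr_eq0.
by field; rewrite ?n1 ?n2 ?f0 ?expf_neq0.
Qed.

End jacobi_polynomial.

(** * Integrals *)

Section integrals.
Variable R : realType.
Local Notation mu := (@lebesgue_measure R).

Lemma continuous_horner (p : {poly R}) : continuous (fun t : R => p.[t]).
Proof.
move=> t; apply: differentiable_continuous; apply/derivable1_diffP.
by have [] := is_derive_poly p t.
Qed.

Lemma continuous_itv_integrable (f : R -> R) (a b : R) : continuous f ->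
  mu.-integrable `[a, b] (EFin \o f).
Proof.
move=> cf; apply: continuous_compact_integrable; first exact: segment_compact.
by apply: continuous_subspaceT.
Qed.

Lemma beta_integral (a b : nat) :
  \int[mu]_(t in `[0, 1]) (t ^+ a * (1 - t) ^+ b) =
  (a`! * b`!)%N%:R / (a + b).+1`!%:R :> R.
Proof. by rewrite -beta_fun_fact /beta_fun -Rintegral_mkcond. Qed.

Lemma Rintegral_poly_weight (b : nat) (p : {poly R}) :
  \int[mu]_(t in `[0, 1]) ((1 - t) ^+ b * p.[t]) =
  \sum_(a < size p) p`_a * ((a`! * b`!)%N%:R / (a + b).+1`!%:R) :> R.
Proof.
have c1 : continuous (fun t : R => (1 - t) ^+ b).
  move=> t; have -> : (fun t : R => (1 - t) ^+ b) = fun t => ((1 - 'X) ^+ b : {poly R}).[t].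
    by apply/funext => s; rewrite !hornerE.
  exact: continuous_horner.
have cX a (r : R) : continuous (fun t : R => r * (t ^+ a * (1 - t) ^+ b)).
  by move=> t; apply: cvgMr; apply: cvgM; [exact: exprn_continuous|exact: c1].
under eq_Rintegral => t _ do rewrite horner_coef mulrC mulr_suml.
elim: (size p) => [|N IH].
  rewrite big_ord0; under eq_Rintegral => t _ do rewrite big_ord0.
  by rewrite Rintegral_cst // mul0r.
rewrite big_ord_recr -IH /= -beta_integral.
rewrite -RintegralZl //=; last first.
  apply: continuous_itv_integrable => t.
  by apply: cvgM; [exact: exprn_continuous|exact: c1].
rewrite -RintegralD //=.
- by apply: eq_Rintegral => t _; rewrite big_ord_recr /= -!mulrA.
- apply: continuous_itv_integrable => t.
  have -> : (fun t : R => \sum_(i < N) p`_i * t ^+ i * (1 - t) ^+ b) =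
     fun t : R => (\sum_(i < N) p`_i *: 'X^i : {poly R}).[t] * (1 - t) ^+ b.
    apply/funext => s; rewrite horner_sum mulr_suml; apply: eq_bigr => i _.
    by rewrite !hornerE.
  by apply: cvgM; [exact: continuous_horner|exact: c1].
- exact: continuous_itv_integrable.
Qed.

Lemma powR_half_sqrt (t : R) (k : nat) : 0 <= t -> t `^ (k%:R / 2) = Num.sqrt t ^+ k.
Proof.
by move=> t0; rewrite mulrC powRrM powR12_sqrt // powR_mulrn // sqrtr_ge0.
Qed.

Section gamma.

(** The exponential series gives [exp t >= t^(i+1) / (i+1)!], hence the majorant [(i+1)! / t]. *)
Lemma expR_poly_cvg0 i : expR (- t) * t ^+ i @[t --> +oo%R] --> (0 : R).
Proof.
have h0 : (fun _ : R => 0 : R) t @[t --> +oo%R] --> (0 : R) by exact: cvg_cst.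
have h1 : i.+1`!%:R * t^-1 @[t --> +oo%R] --> (0 : R).
  have V0 : (t^-1 : R) @[t --> +oo%R] --> (0 : R).
    apply/gtr0_cvgV0; last exact: cvg_id.
    by near=> t; near: t; exact: nbhs_pinfty_gt.
  have : i.+1`!%:R * t^-1 @[t --> +oo%R] --> (i.+1`!%:R * 0 : R) by apply: cvgMr.
  by rewrite mulr0.
apply: (squeeze_cvgr _ h0 h1).
near=> t; have t0 : 0 < t by near: t; exact: nbhs_pinfty_gt.
rewrite mulr_ge0 ?expR_ge0 ?exprn_ge0 ?(ltW t0) //= expRN.
rewrite ler_pdivrMl ?expR_gt0 // mulrA ler_pdivlMr // -exprSr.
have := expR_ge1Dxn i (ltW t0).
have f0 : 0 < i.+1`!%:R :> R by rewrite ltr0n fact_gt0.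
move=> h; rewrite -ler_pdivrMr //; apply: le_trans h.
by rewrite lerDr.
Unshelve. all: by end_near. Qed.

(** With [P] the sum of the [(j! / i!) t^i] for [i <= j] one has [P - P' = t^j], so [- exp(-t) P(t)]
    is an antiderivative, going from [- j!] at 0 to 0 at infinity. *)
Lemma Gamma_nat j : Gamma (j.+1%:R : R) = j`!%:R.
Proof.
pose P : {poly R} := \poly_(i < j.+1) (j`!%:R / i`!%:R).
pose F (t : R) : R := - (expR (- t) * P.[t]).
pose f (t : R) : R := t ^+ j * expR (- t).
have PX : P - P^`() = 'X^j.
  apply/polyP => i; rewrite coefB coef_deriv !coef_poly coefXn !ltnS.
  case: ltngtP => [ij|ij|->]; last by rewrite mul0rn subr0 divff ?fact_neq0.
    rewrite factS natrM -[_ *+ i.+1]mulr_natr; apply/eqP; rewrite subr_eq0; apply/eqP.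
    by rewrite [i.+1%:R * _]mulrC invfM mulrA mulfVK // pnatr_eq0.
  by rewrite mul0rn subr0.
have Dexp (t : R) : is_derive t 1 (fun t : R => expR (- t)) (- expR (- t)).
  have Dn : is_derive t 1 (fun s : R => - s) (-1) by exact: (is_deriveN (is_derive_id t 1)).
  have := @is_derive1_comp _ expR (fun s : R => - s) t _ _ (is_derive_expR (- t)) Dn.
  by rewrite mulrN1.
have DF (t : R) : is_derive t 1 F (f t).
  have D := is_deriveN (is_deriveM (Dexp t) (is_derive_poly P t)).
  have E : - (expR (- t) * P^`().[t] + P.[t] * - expR (- t)) = f t.
    have := congr1 (fun q : {poly R} => q.[t]) PX; rewrite !hornerE /f => <-; ring.
  by rewrite -E.
have cE : continuous (fun t : R => expR (- t)).
  by move=> t; apply: differentiable_continuous; apply/derivable1_diffP; case: (Dexp t).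
have cf : continuous f.
  by move=> t; apply: cvgM; [exact: exprn_continuous|exact: cE].
have cF : continuous F.
  by move=> t; apply: differentiable_continuous; apply/derivable1_diffP; case: (DF t).
have Foo : F t @[t --> +oo%R] --> (0 : R).
  have : \sum_(i < j.+1) - (j`!%:R / i`!%:R) * (expR (- t) * t ^+ i) @[t --> +oo%R] -->
      (\sum_(i < j.+1) - (j`!%:R / i`!%:R) * 0 : R).
    apply: cvg_big; first exact: add_continuous.
    by move=> i _; apply: cvgMr; exact: expR_poly_cvg0.
  rewrite big1 => [|i _]; last by rewrite mulr0.
  apply: cvg_trans; apply: near_eq_cvg; apply: nearW => t.
  rewrite /F horner_poly mulr_sumr -sumrN; apply: eq_bigr => i _; ring.
transitivity (\int[mu]_(t in `]0, +oo[) f t).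
  apply: eq_Rintegral => t; rewrite inE /= in_itv /= andbT => t0.
  by rewrite -natr1 addrK powR_mulrn // ltW.
rewrite /Rintegral integral_itv_obnd_cbnd; last first.
  apply/measurable_EFinP; apply: measurable_funTS; exact: continuous_measurable_fun.
have := @Rintegral_ge0_continuous_FTC2y R f F 0 0; rewrite /Rintegral => ->.
- rewrite /F oppr0 expR0 mul1r sub0r opprK horner_poly big_ord_recl big1 /= ?addr0 //.
    by rewrite expr0 mulr1 fact0 divr1.
  by move=> i _; rewrite expr0n mulr0.
- by move=> x x0; rewrite /f mulr_ge0 ?expR_ge0 ?exprn_ge0.
- exact: continuous_subspaceT.
- exact: Foo.
- by move=> x _; case: (DF x).
- by apply: cvg_at_right_filter; exact: cF.
- by move=> x _; rewrite derive1E; apply: derive_val.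
Qed.

End gamma.

Lemma affine_substitution (G : R -> R) : continuous G ->
  \int[mu]_(s in `[-1, 1]) G s = 2 * \int[mu]_(t in `[0, 1]) G (2 * t - 1).
Proof.
move=> cG; pose F (t : R) : R := 2 * t - 1.
have FE : F = fun t => (2 *: 'X - 1 : {poly R}).[t] by apply/funext => t; rewrite !hornerE.
have DF (t : R) : is_derive t 1 F (2 : R).
  have D : ((2 *: 'X - 1 : {poly R})^`()).[t] = 2.
    by rewrite derivB derivZ derivX (derivC 1) subr0 hornerZ hornerC mulr1.
  by rewrite FE; have := is_derive_poly (2 *: 'X - 1 : {poly R}) t; rewrite D.
have F' : derive1 F = fun=> (2 : R) by apply/funext => t; rewrite derive1E; apply: derive_val.
have cF : continuous F by rewrite FE; exact: continuous_horner.
have F0 : F 0 = -1 by rewrite /F mulr0 sub0r.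
have F1 : F 1 = 1 by rewrite /F mulr1 -[2]/(1 + 1) addrK.
have cGF : continuous (fun t => G (F t)).
  by move=> t; apply: continuous_comp; [exact: cF|exact: cG].
rewrite -RintegralZl //; last exact: continuous_itv_integrable.
have key : (\int[mu]_(x in `[F 0%R, F 1%R]) (G x)%:E =
    \int[mu]_(x in `[0%R, 1%R]) (((G \o F) * derive1 F)%R x)%:E)%E.
  apply: integration_by_substitution_increasing => //.
  - by move=> x y _ _ xy; rewrite /F ltrD2r ltr_pM2l.
  - by rewrite F' => x _; exact: cvg_cst.
  - by rewrite F'; exact: is_cvg_cst.
  - by rewrite F'; exact: is_cvg_cst.
  - split; first by move=> x _; case: (DF x).
      by apply: cvg_at_right_filter; exact: cF.
    by apply: cvg_at_left_filter; exact: cF.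
  - exact: continuous_subspaceT.
rewrite F0 F1 in key; congr fine; rewrite key.
by apply: eq_integral => t _; rewrite F' mulrC.
Qed.

End integrals.

(** * The L1-norm of the kernel *)

Section radial_approximation.
Variables (R : realType) (n k : nat) (J : {poly R}).
Hypothesis n0 : (0 < n)%N.
Local Notation mu := (@lebesgue_measure R).

Definition radial_mean (psi : {poly R}) : R :=
  \sum_(a < size psi) psi`_a * ((a`! * n`!)%N%:R / (n + a)`!%:R).

(** By the Beta integral, the moments of [|<w,z>|^2] are those of the density [n (1 - t)^(n - 1)] on
    [[0, 1]]. *)
Lemma radial_meanE psi :
  radial_mean psi = n%:R * \int[mu]_(t in `[0, 1]) ((1 - t) ^+ n.-1 * psi.[t]).
Proof.
rewrite Rintegral_poly_weight mulr_sumr; apply: eq_bigr => a _.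
have -> : (a + n.-1).+1 = (n + a)%N by lia.
rewrite [RHS]mulrCA; congr (_ * _); rewrite [RHS]mulrA -natrM mulnCA; congr (_%:R / _).
by case: n n0 => // n' _; rewrite factS.
Qed.

(** Dominates [|J|] on [[0, 1]]; the summand 1 makes it positive even for [J = 0]. *)
Definition profile_bound : R := 1 + \sum_(i < size J) `|J`_i|.

Lemma profile_bound_gt0 : 0 < profile_bound.
Proof. by rewrite ltr_pwDl // sumr_ge0. Qed.

(** Up to a constant, the modulus of the kernel as a function of [t = |s|^2] ([norm_kernel]). *)
Definition profile (t : R) : R := Num.sqrt t ^+ k * `|J.[t]|.

Lemma profile_itv t : 0 <= t <= 1 -> 0 <= profile t / profile_bound <= 1.
Proof.
move=> /andP[t0 t1]; have B0 := profile_bound_gt0.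
have s0 : 0 <= Num.sqrt t by exact: sqrtr_ge0.
have s1 : Num.sqrt t <= 1 by rewrite -(@sqrtr1 R) ler_wsqrtr.
rewrite divr_ge0 ?mulr_ge0 ?exprn_ge0 ?(ltW B0) //= ler_pdivrMr // mul1r.
apply: (@le_trans _ _ `|J.[t]|); first by rewrite ler_piMl // exprn_ile1.
rewrite horner_coef; apply: le_trans (ler_norm_sum _ _ _) _.
apply: (@le_trans _ _ (\sum_(i < size J) `|J`_i|)); last by rewrite lerDr.
apply: ler_sum => i _; rewrite normrM ler_piMr // normrX exprn_ile1 //.
by rewrite ger0_norm.
Qed.

Definition profile_sqr : {poly R} := (profile_bound ^- 2) *: ('X^k * J ^+ 2).

Lemma profile_sqrE t : 0 <= t -> profile_sqr.[t] = (profile t / profile_bound) ^+ 2.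
Proof.
move=> t0; rewrite hornerZ hornerM hornerXn horner_exp /profile expr_div_n exprMn -exprM mulnC exprM.
by rewrite sqr_sqrtr // real_normK ?num_real //; ring.
Qed.

(** Visser's approximation to the square root of [profile_sqr], scaled back: a polynomial below
    [profile] on [[0, 1]], with error at most [2 * profile_bound / j] for [j > 0]. *)
Definition profile_approx (j : nat) : {poly R} :=
  profile_bound *: (('X * visser R j) \Po profile_sqr).

Lemma profile_approx_bounds j t : 0 <= t <= 1 ->
  0 <= (profile t - (profile_approx j).[t]) /\
  (profile t - (profile_approx j).[t]) * j%:R <= 2 * profile_bound.
Proof.
move=> t01; have B0 := profile_bound_gt0; have y01 := profile_itv t01.
have /andP[t0 _] := t01.
rewrite hornerZ horner_comp hornerM hornerX profile_sqrE //.
set y := _ / _ in y01 *.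
have -> : profile t = profile_bound * y by rewrite /y mulrC divfK // gt_eqF.
rewrite -mulrBr -[_ * j%:R]mulrA [2 * _]mulrC; split.
  rewrite mulr_ge0 ?(ltW B0) // subr_ge0.
  by have [/andP[_ ?] _] := visser_bounds j y01.
by rewrite ler_pM2l // visser_approx.
Qed.

Definition profile_integral : R :=
  n%:R * \int[mu]_(t in `[0, 1]) ((1 - t) ^+ n.-1 * profile t).

Lemma continuous_profile : continuous profile.
Proof.
move=> t; have cs : continuous (fun t : R => Num.sqrt t ^+ k).
  move=> s; apply: (@continuous_comp _ _ _ (@Num.sqrt R) (fun x => x ^+ k)).
    exact: sqrt_continuous.
  exact: exprn_continuous.
have ca : continuous (fun t : R => `|J.[t]|).
  move=> s; apply: (@continuous_comp _ _ _ (fun t => J.[t]) (fun x : R => `|x|)).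
    exact: continuous_horner.
  exact: norm_continuous.
by apply: cvgM; [exact: cs|exact: ca].
Qed.

Lemma continuous_weight (f : R -> R) b : continuous f ->
  continuous (fun t : R => (1 - t) ^+ b * f t).
Proof.
move=> cf t; have c1 : continuous (fun t : R => (1 - t) ^+ b).
  move=> s; have -> : (fun t : R => (1 - t) ^+ b) = fun t => ((1 - 'X) ^+ b : {poly R}).[t].
    by apply/funext => x; rewrite !hornerE.
  exact: continuous_horner.
by apply: cvgM; [exact: c1|exact: cf].
Qed.

Lemma radial_mean_cst (c : R) : radial_mean c%:P = c.
Proof.
rewrite /radial_mean size_polyC; case: eqP => [->|_] /=; first by rewrite big_ord0.
by rewrite big_ord1 coefC addn0 mul1n divff ?mulr1 // fact_neq0.
Qed.

(** The pointwise estimate [profile_approx_bounds] is integrated against the probability density of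
    [radial_meanE]. *)
Lemma radial_mean_approx j :
  0 <= profile_integral - radial_mean (profile_approx j) /\
  (profile_integral - radial_mean (profile_approx j)) * j%:R <= 2 * profile_bound.
Proof.
have iw (f : R -> R) : continuous f ->
      mu.-integrable `[0, 1] (EFin \o (fun t : R => (1 - t) ^+ n.-1 * f t)).
  by move=> cf; apply: continuous_itv_integrable; exact: continuous_weight.
have cd : continuous (fun t : R => profile t - (profile_approx j).[t]).
  by move=> t; apply: cvgB; [exact: continuous_profile|exact: continuous_horner].
have E : profile_integral - radial_mean (profile_approx j) =
    n%:R * \int[mu]_(t in `[0, 1]) ((1 - t) ^+ n.-1 * (profile t - (profile_approx j).[t])).
  rewrite radial_meanE /profile_integral -mulrBr -RintegralB //=; last 2 first.
  - exact/iw/continuous_profile.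
  - exact/iw/continuous_horner.
  by congr (_ * _); apply: eq_Rintegral => t _; rewrite mulrBr.
rewrite E; split.
  rewrite mulr_ge0 // Rintegral_ge0 // => t /=; rewrite in_itv /= => t01.
  have /andP[_ t1] := t01.
  apply: mulr_ge0; first by rewrite exprn_ge0 // subr_ge0.
  by have [] := profile_approx_bounds j t01.
rewrite -mulrA -RintegralZr //=; last exact: iw.
rewrite -[leRHS]radial_mean_cst radial_meanE ler_pM2l ?ltr0n //.
apply: le_Rintegral => //=.
- have -> : (fun t : R => (1 - t) ^+ n.-1 * (profile t - (profile_approx j).[t]) * j%:R) =
    fun t : R => (1 - t) ^+ n.-1 * ((profile t - (profile_approx j).[t]) * j%:R).
    by apply/funext => t; rewrite mulrA.
  by apply: iw => t; apply: cvgMl; exact: cd.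
- exact/iw/continuous_horner.
- move=> t; rewrite in_itv /= => t01; have /andP[_ t1] := t01.
  rewrite -mulrA hornerC ler_wpM2l ?exprn_ge0 ?subr_ge0 //.
  by have [] := profile_approx_bounds j t01.
Qed.

End radial_approximation.

Lemma radial_meanZ (R : realType) n (c : R) (psi : {poly R}) :
  radial_mean n (c *: psi) = c * radial_mean n psi.
Proof.
have [->|c0] := eqVneq c 0.
  by rewrite scale0r mul0r /radial_mean size_poly0 big_ord0.
rewrite /radial_mean size_scale // mulr_sumr; apply: eq_bigr => a _.
by rewrite coefZ -mulrA.
Qed.

Lemma eq0_of_natmul_le (R : realType) (x K : R) :
  (forall j, `|x| * j%:R <= K) -> x = 0.
Proof.
move=> xK; apply/eqP; rewrite -normr_eq0; apply/eqP/le_anti.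
rewrite normr_ge0 andbT leNgt; apply/negP => x0.
have := archi_boundP (_ : 0 <= K / `|x|); rewrite divr_ge0 ?(ltW x0) //; last first.
  by apply: le_trans (xK 0%N); rewrite mulr0.
by move/(_ isT); rewrite ltr_pdivrMr // mulrC ltNge xK.
Qed.

Section kernel_norm.
Variables (R : realType) (n p q : nat).
Hypothesis n0 : (0 < n)%N.
Local Notation C := R[i].
Local Notation S := (csphere R n.+1).
Local Notation k := ((p - q) + (q - p))%N.
Local Notation J := (shifted_jacobi R n k (minn p q)).

Definition kernel_scale : R := (n + maxn p q)`!%:R / (n`! * (maxn p q)`!)%N%:R.

Lemma kernel_scale_ge0 : 0 <= kernel_scale.
Proof. by rewrite divr_ge0. Qed.

(** Here [k = |p - q|], so [minn p q + k = maxn p q]; in factorials the two coefficients then differ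
    by a factor independent of [i]. *)
Lemma bihom_kernel_coefE i : (i <= minn p q)%N ->
  bihom_kernel_coef R n p q i = (kernel_scale *: J)`_i.
Proof.
move=> im; rewrite coefZ coef_poly ltnS im /bihom_kernel_coef /kernel_scale.
have -> : (minn p q + k = i + k + (minn p q - i))%N by lia.
rewrite !natr_bin_fact.
have -> : (i + k + (minn p q - i) = maxn p q)%N by lia.
have -> : (n`! * (minn p q - i)`! * (i + (p - q))`! * (i + (q - p))`! =
    n`! * (minn p q - i)`! * (i`! * (i + k)`!))%N.
  rewrite -mulnA; congr (_ * _)%N; have [pq|pq] := leqP p q.
    by have -> : (p - q = 0)%N by [lia]; rewrite addn0 add0n.
  by have -> : (q - p = 0)%N by [lia]; rewrite !addn0 mulnC.
by rewrite !natrM; field; rewrite !fact_neq0.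
Qed.

Lemma zonal_sum_horner m (g : {poly R}) (s : C) (t : R) : (size g <= m.+1)%N ->
  t%:C = s * Num.conj s ->
  zonal_sum p q m (fun i => g`_i) s =
  s ^+ (p - q) * Num.conj s ^+ (q - p) * (g.[t])%:C.
Proof.
move=> gm ts; rewrite /zonal_sum (horner_coef_wide _ gm) rmorph_sum mulr_sumr.
apply: eq_bigr => i _; rewrite rmorphM rmorphXn /= ts !exprD exprMn; ring.
Qed.

Lemma kernelE (s : C) (t : R) : t%:C = s * Num.conj s ->
  bihom_kernel n p q s = s ^+ (p - q) * Num.conj s ^+ (q - p) * ((kernel_scale *: J).[t])%:C.
Proof.
move=> ts; rewrite -(@zonal_sum_horner (minn p q)) //.
  by apply: eq_bigr => i _; rewrite bihom_kernel_coefE // -ltnS.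
by apply: leq_trans (size_scale_leq _ _) _; exact: size_poly.
Qed.

Lemma norm_zonal (s : C) (t x : R) : t%:C = s * Num.conj s ->
  `|s ^+ (p - q) * Num.conj s ^+ (q - p) * x%:C| = (Num.sqrt t ^+ k * `|x|)%:C.
Proof.
move=> ts; have st : `|s| = (Num.sqrt t)%:C.
  apply/eqP; rewrite -(@eqrXn2 _ 2) // ?ler0c ?sqrtr_ge0 //.
  rewrite normCK -ts -rmorphXn /= sqr_sqrtr //.
  by rewrite -ler0c ts -normCK exprn_ge0.
rewrite !normrM !normrX norm_conjC -exprD st rmorphM rmorphXn /=.
by congr (_ * _); rewrite normc_def /= expr0n addr0 sqrtr_sqr.
Qed.

Lemma norm_kernel (s : C) (t : R) : t%:C = s * Num.conj s ->
  `|bihom_kernel n p q s| = (kernel_scale * profile k J t)%:C.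
Proof.
move=> ts; rewrite (kernelE ts) (norm_zonal _ ts) hornerZ normrM.
by rewrite (ger0_norm kernel_scale_ge0) mulrCA.
Qed.

(* [(visser j).[y ^+ 2]] is close to [y^-1], and at most [y^-1], for [y] in     *)
(* [0, 1]; so [dual_kernel] below approximates the phase of the kernel.         *)
Definition dual_profile (j : nat) : {poly R} :=
  (profile_bound J)^-1 *: ((visser R j \Po profile_sqr k J) * J).

Definition dual_kernel (j : nat) : C -> C :=
  zonal_sum p q (size (dual_profile j)) (fun i => (dual_profile j)`_i).

(** With [y = profile / profile_bound] the modulus is [y] times Visser's polynomial at [y^2], so
    [visser_le1] applies. *)
Lemma norm_dual_kernel_le1 j (s : C) (t : R) : 0 <= t <= 1 -> t%:C = s * Num.conj s ->
  `|dual_kernel j s| <= 1.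
Proof.
move=> t01 ts; have /andP[t0 _] := t01.
rewrite /dual_kernel (@zonal_sum_horner _ _ _ t) // (norm_zonal _ ts) lecR.
rewrite hornerZ hornerM horner_comp profile_sqrE //.
have y01 := profile_itv k J t01; have := visser_le1 j y01.
set y := _ / _; set r := (visser R j).[_] => /andP[yr0 yr1].
have B0 := profile_bound_gt0 J.
rewrite !normrM ger0_norm ?invr_ge0 ?(ltW B0) //.
have -> : Num.sqrt t ^+ k * ((profile_bound J)^-1 * (`|r| * `|J.[t]|)) = y * `|r|.
  by rewrite /y /profile; ring.
have -> : y * `|r| = `|y * r| by rewrite normrM [`|y|]ger0_norm //; case/andP: y01.
by rewrite ger0_norm.
Qed.

(** The phases combine to [t^k], and [t^k J^2] is [profile_bound^2] times [profile_sqr]. *)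
Lemma dual_kernel_mul j (s : C) (t : R) : 0 <= t -> t%:C = s * Num.conj s ->
  dual_kernel j s * Num.conj (bihom_kernel n p q s) =
  ((kernel_scale *: profile_approx k J j).[t])%:C.
Proof.
move=> t0 ts; rewrite (kernelE ts) /dual_kernel (@zonal_sum_horner _ _ _ t) //.
have B0 := profile_bound_gt0 J.
rewrite !rmorphM !rmorphXn /= conjCK [Num.conj _%:C]conjC_conjc conjc_real.
transitivity (((s * Num.conj s) ^+ k) * (((dual_profile j).[t]) * ((kernel_scale *: J).[t]))%:C).
  by rewrite rmorphM exprD !exprMn /=; ring.
rewrite -ts -rmorphXn -rmorphM /=; congr (_%:C).
rewrite /dual_profile /profile_approx !hornerZ !horner_comp !hornerM horner_comp hornerX; set r := (visser R j).[_].
rewrite /profile_sqr hornerZ hornerM hornerXn horner_exp.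
by field; rewrite gt_eqF.
Qed.

Variable L : (S -> C) -> C.
Hypothesis meanL : sphere_mean L.

Lemma mean_dual_kernel j (w : S) :
  L (fun z => dual_kernel j (dot w z) * Num.conj (bihom_kernel n p q (dot w z))) =
  (kernel_scale * radial_mean n (profile_approx k J j))%:C.
Proof.
transitivity (L (fun z => ((kernel_scale *: profile_approx k J j).[sqdot w z])%:C)).
  congr L; apply/funext => z; apply: dual_kernel_mul; last exact: sqdotE.
  by have /andP[] := sqdot_itv w z.
by rewrite mean_radial // -/(radial_mean n _) radial_meanZ.
Qed.

Lemma mean_cst (c : C) : L (fun=> c) = c.
Proof.
have L1 : L (fun=> 1) = 1.
  have := mean_radial meanL (1%:P) (sphere_base R n).
  rewrite -/(radial_mean n _) radial_mean_cst => H.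
  rewrite -[RHS]/((1 : R)%:C) -H.
  by congr L; apply/funext => z; rewrite hornerC.
have := mean_sum meanL [:: tt] (P := xpredT) (fun=> c) (F := fun _ _ => 1)
  (fun _ _ => fun_bounded_cst _ 1).
by rewrite !big_seq1 L1 !mulr1.
Qed.

(** The mean and the integral agree on polynomials in [|<w,z>|^2], and [|K|] is uniformly within a
    multiple of [1 / j] of such polynomials; so the two values differ by [O(1 / j)] for every
    [j]. *)
Lemma mean_norm_kernel (w : S) :
  L (fun z => `|bihom_kernel n p q (dot w z)|) = (kernel_scale * profile_integral n k J)%:C.
Proof.
set F := fun z => _.
have FE z : F z = (kernel_scale * profile k J (sqdot w z))%:C.
  by rewrite /F (norm_kernel (sqdotE w z)).
have bK : fun_bounded (fun z => bihom_kernel n p q (dot w z)).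
  exact/fun_bounded_zonal/fun_bounded_dot.
have bF : fun_bounded F by have [M KM] := bK; exists M => z; rewrite normr_id.
pose P j := kernel_scale *: profile_approx k J j.
pose G j (z : S) : C := ((P j).[sqdot w z])%:C.
have GE j : L (G j) = (kernel_scale * radial_mean n (profile_approx k J j))%:C.
  by rewrite mean_radial // -/(radial_mean n _) radial_meanZ.
have bG j : fun_bounded (G j).
  have /(_ (fun z => dual_kernel j (dot w z))) bM := @fun_boundedM R S.
  have /(_ (fun z => Num.conj (bihom_kernel n p q (dot w z)))) := bM.
  have -> : (fun z => dual_kernel j (dot w z) * Num.conj (bihom_kernel n p q (dot w z))) = G j.
    apply/funext => z; apply: dual_kernel_mul; last exact: sqdotE.
    by have /andP[] := sqdot_itv w z.
  apply; last exact: fun_boundedJ.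
  exact/fun_bounded_zonal/fun_bounded_dot.
have LFR : L F = (complex.Re (L F))%:C.
  rewrite RRe_real // ger0_real //; apply: le_trans (normr_ge0 (L F)) _.
  by apply: (mean_norm_le meanL bF) => z; rewrite normr_id.
pose a := complex.Re (L F) - kernel_scale * profile_integral n k J.
suff a0 : a = 0 by rewrite LFR; congr (_%:C); apply/eqP; rewrite -subr_eq0 -/a a0.
(* The factor 4 comes from two errors, one in the mean and one in the integral, each with factor
   2. *)
apply: (@eq0_of_natmul_le _ _ (4 * kernel_scale * profile_bound J)) => j.
have [j0|j0] := posnP j.
  rewrite j0 mulr0 mulr_ge0 ?(ltW (profile_bound_gt0 J)) // mulr_ge0 //.
  exact: kernel_scale_ge0.
have jR : 0 < j%:R :> R by rewrite ltr0n.
have sc0 := kernel_scale_ge0.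
have scE : 2 * kernel_scale * profile_bound J = kernel_scale * (2 * profile_bound J) by ring.
set e := 2 * kernel_scale * profile_bound J / j%:R.
have h1 : `|complex.Re (L F) - kernel_scale * radial_mean n (profile_approx k J j)| <= e.
  rewrite -lecR.
  have -> : (`|complex.Re (L F) - kernel_scale * radial_mean n (profile_approx k J j)|)%:C =
     `|L (fun z => (-1) * G j z + F z)|.
    rewrite mean_linear // GE LFR mulN1r addrC -rmorphN -rmorphD /=.
    by rewrite normc_def /= expr0n addr0 sqrtr_sqr.
  rewrite -[leRHS]mean_cst; apply: (mean_norm_le meanL); first exact: fun_bounded_cst.
  move=> z; rewrite FE /G mulN1r addrC -rmorphN -rmorphD /=.
  rewrite normc_def /= expr0n addr0 sqrtr_sqr lecR hornerZ -mulrBr normrM.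
  rewrite (ger0_norm sc0) /e.
  have [d0 d1] := profile_approx_bounds k J j (sqdot_itv w z).
  rewrite ger0_norm // ler_pdivlMr // -[leLHS]mulrA scE; exact: ler_wpM2l.
have h2 : `|kernel_scale * profile_integral n k J -
    kernel_scale * radial_mean n (profile_approx k J j)| <= e.
  have [d0 d1] := radial_mean_approx k J n0 j.
  rewrite -mulrBr normrM (ger0_norm sc0) ger0_norm // /e ler_pdivlMr //.
  rewrite -[leLHS]mulrA scE; exact: ler_wpM2l.
have : `|a| <= e + e.
  have -> : a = (complex.Re (L F) - kernel_scale * radial_mean n (profile_approx k J j)) -
    (kernel_scale * profile_integral n k J -
     kernel_scale * radial_mean n (profile_approx k J j)) by rewrite /a; ring.
  exact: le_trans (ler_normB _ _) (lerD h1 h2).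
rewrite -(ler_pM2r jR) => h; apply: le_trans h _.
rewrite /e -mulrDl divfK ?gt_eqF //.
by rewrite le_eqVlt; apply/orP; left; apply/eqP; ring.
Qed.

End kernel_norm.

(** * Finite expansions of zonal kernels *)

Section zonal_expansion.
Variables (R : realType) (n p q : nat).
Local Notation C := R[i].
Local Notation S := (csphere R n.+1).

Lemma dot_expand N a b : (a <= N)%N -> (b <= N)%N ->
  exists c : {ffun 'I_n.+1 -> 'I_N.+1} * {ffun 'I_n.+1 -> 'I_N.+1} -> C,
  forall w z : S, dot w z ^+ a * Num.conj (dot w z) ^+ b =
  \sum_(gd : {ffun 'I_n.+1 -> 'I_N.+1} * {ffun 'I_n.+1 -> 'I_N.+1} | (\sum_i gd.1 i == a)%N && (\sum_i gd.2 i == b)%N)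
    c gd * (sphere_monomial (fun i => gd.1 i) (fun i => gd.2 i) w *
            sphere_monomial (fun i => gd.2 i) (fun i => gd.1 i) z).
Proof.
move=> aN bN.
exists (fun gd : {ffun 'I_n.+1 -> 'I_N.+1} * {ffun 'I_n.+1 -> 'I_N.+1} => a`!%:R * b`!%:R * (\prod_i (gd.1 i)`!%:R^-1) * (\prod_i (gd.2 i)`!%:R^-1)).
move=> w z; rewrite dotJ /dot !(@multinomial_formula _ _ N) //.
rewrite -(pair_big (fun g : {ffun 'I_n.+1 -> 'I_N.+1} => (\sum_i g i == a)%N)
   (fun d : {ffun 'I_n.+1 -> 'I_N.+1} => (\sum_i d i == b)%N)
   (fun g d => a`!%:R * b`!%:R * (\prod_i (g i)`!%:R^-1) * (\prod_i (d i)`!%:R^-1) *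
     (sphere_monomial (fun i => g i) (fun i => d i) w *
            sphere_monomial (fun i => d i) (fun i => g i) z))) /=.
set SA := \sum_(g | _) _; set SB := \sum_(g | _) _.
have -> : a`!%:R * SA * (b`!%:R * SB) = SA * (SB * (a`!%:R * b`!%:R)) by ring.
rewrite mulr_suml; apply: eq_bigr => g _; rewrite mulr_suml mulr_sumr; apply: eq_bigr => d _.
have split_mul (u u' : 'I_n.+1 -> C) (r : 'I_n.+1 -> nat) :
    \prod_i ((u i * u' i) ^+ r i / (r i)`!%:R) =
    \prod_i u i ^+ r i * \prod_i u' i ^+ r i * \prod_i (r i)`!%:R^-1.
  by rewrite -!big_split; apply: eq_bigr => i _; rewrite exprMn.
by rewrite !split_mul /sphere_monomial; ring.
Qed.

(** A zonal kernel has finite rank, so means and linear maps can be exchanged with it termwise. In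
    low degree, raising the monomials in [w] puts the factors [e l] in the space itself. *)
Lemma zonal_expand m (c : nat -> R) :
  exists (T : finType) (e u : T -> S -> C),
  [/\ forall l, fun_bounded (e l), forall l, fun_bounded (u l),
      forall w z, zonal_sum p q m c (dot w z) = \sum_l e l w * u l z &
      (m <= minn p q)%N -> forall l, e l \in @bihom_pred R n.+1 p q].
Proof.
pose N := (m + p + q)%N.
pose a i := (i + (p - q))%N; pose b i := (i + (q - p))%N.
have cex (i : 'I_m.+1) : exists c : {ffun 'I_n.+1 -> 'I_N.+1} * {ffun 'I_n.+1 -> 'I_N.+1} -> C,
  forall w z : S, dot w z ^+ a i * Num.conj (dot w z) ^+ b i =
  \sum_(gd : {ffun 'I_n.+1 -> 'I_N.+1} * {ffun 'I_n.+1 -> 'I_N.+1} | (\sum_i gd.1 i == a i)%N && (\sum_i gd.2 i == b i)%N)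
    c gd * (sphere_monomial (fun i => gd.1 i) (fun i => gd.2 i) w *
            sphere_monomial (fun i => gd.2 i) (fun i => gd.1 i) z).
  by apply: dot_expand; rewrite /a /b /N; have := ltn_ord i; lia.
have [d dE] := choice cex.
pose T : finType := ('I_m.+1 * ({ffun 'I_n.+1 -> 'I_N.+1} * {ffun 'I_n.+1 -> 'I_N.+1}))%type.
(* Pairs of exponents of the wrong degree get coefficient 0, so that a plain product type can index
   the sum. *)
pose e (l : T) (w : S) : C :=
  (if (\sum_i l.2.1 i == a l.1)%N && (\sum_i l.2.2 i == b l.1)%N
   then (c l.1)%:C * d l.1 l.2 else 0) *
  sphere_monomial (fun i => l.2.1 i) (fun i => l.2.2 i) w.
exists T, e, (fun (l : T) (z : S) => sphere_monomial (fun i => l.2.2 i) (fun i => l.2.1 i) z); split.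
- by move=> l; apply: fun_boundedM; [exact: fun_bounded_cst|exact: fun_bounded_monomial].
- by move=> l; exact: fun_bounded_monomial.
- move=> w z; rewrite /zonal_sum.
  rewrite -(pair_bigA _ (fun i gd => e (i, gd) w *
     sphere_monomial (fun i => gd.2 i) (fun i => gd.1 i) z)) /=.
  apply: eq_bigr => i _; rewrite dE mulr_sumr big_mkcond; apply: eq_bigr => gd _.
  by rewrite /e /=; case: ifP => _; rewrite ?mul0r // !mulrA.
- move=> mpq [i [g h]]; rewrite /e /=; case: ifP => [/andP[/eqP ga /eqP hb]|_].
    apply: bihom_predZ; have := bihom_pred_raise (minn p q - i) (bihom_pred_monomial R ga hb).
    have im := ltn_ord i.
    by have [-> ->] : ((a i + (minn p q - i) = p) /\ (b i + (minn p q - i) = q))%N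
      by rewrite /a /b; lia.
  by under eq_fun do rewrite mul0r; exact: (rpred0 (bihom_pred p q)).
Qed.

Lemma bihom_kernel_pred (v : S) :
  (fun z => bihom_kernel n p q (dot z v)) \in @bihom_pred R n.+1 p q.
Proof.
have [T [e [u [_ _ E /(_ (leqnn _)) epq]]]] := zonal_expand (minn p q) (bihom_kernel_coef R n p q).
under eq_fun do rewrite /bihom_kernel E.
apply: bihom_pred_sum => l _; under eq_fun do rewrite mulrC; exact: bihom_predZ.
Qed.

(** The expansion of [K] has its [z]-factors in the space, so for any bounded [phi] the result is a
    finite combination of them. *)
Lemma mean_bihom_kernel_pred (L : (S -> C) -> C) (phi : S -> C) : sphere_mean L ->
  fun_bounded phi ->
  (fun z => L (fun w => bihom_kernel n p q (dot z w) * phi w)) \in @bihom_pred R n.+1 p q.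
Proof.
move=> meanL bphi.
have [T [e [u [_ bu E /(_ (leqnn _)) epq]]]] := zonal_expand (minn p q) (bihom_kernel_coef R n p q).
have -> : (fun z => L (fun w => bihom_kernel n p q (dot z w) * phi w)) =
    fun z => \sum_l L (fun w => u l w * phi w) * e l z.
  apply/funext => z.
  transitivity (\sum_l e l z * L (fun w => u l w * phi w)).
    rewrite -(mean_sum meanL); last by move=> l _; exact: fun_boundedM.
    congr L; apply/funext => w; rewrite /bihom_kernel E mulr_suml.
    by apply: eq_bigr => l _; rewrite mulrA.
  by apply: eq_bigr => l _; rewrite mulrC.
by apply: bihom_pred_sum => l _; exact: bihom_predZ.
Qed.

End zonal_expansion.

(** * The upper bound *)

Section upper_bound.
Variables (R : realType) (n p q : nat).
Hypothesis n0 : (0 < n)%N.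
Local Notation C := R[i].
Local Notation S := (csphere R n.+1).
Local Notation X := (bihom R n.+1 p q).

Definition bihom_bound : R :=
  kernel_scale R n p q *
  profile_integral n ((p - q) + (q - p)) (shifted_jacobi R n ((p - q) + (q - p)) (minn p q)).

Lemma bihomP (f : X) : (f : S -> C) \in @bihom_pred R n.+1 p q.
Proof. by case: f. Qed.

Lemma bihom_normE (f : X) : `|f| = (sup_norm f)%:C.
Proof. by []. Qed.

Lemma norm_bihom_le (f : X) (w : S) : `|f w| <= `|f|.
Proof. exact: le_sup_norm (fun_bounded_bihom (bihomP f)). Qed.

Definition bihom_eval (w : S) (f : X) : C^o := f w.

Lemma bihom_eval_linear w : linear (bihom_eval w).
Proof. by []. Qed.

HB.instance Definition _ w := GRing.isLinear.Build C X C^o *:%R (bihom_eval w)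
  (bihom_eval_linear w).

Lemma bihom_bound_ge0 : 0 <= bihom_bound.
Proof.
apply: mulr_ge0; first exact: kernel_scale_ge0.
apply: mulr_ge0 => //; apply: Rintegral_ge0 => t /=; rewrite in_itv /= => /andP[_ t1].
by rewrite mulr_ge0 ?exprn_ge0 ?subr_ge0 // mulr_ge0 ?exprn_ge0 ?sqrtr_ge0.
Qed.

Section projection.
Variables (L : (S -> C) -> C) (Y : normedModType C) (I : {linear X -> Y}).
Variable phi : S -> Y -> C.
Hypothesis meanL : sphere_mean L.
Hypothesis I_isometry : forall f, `|I f| = `|f|.
Hypothesis phi_linear : forall w c x y, phi w (c *: x + y) = c * phi w x + phi w y.
Hypothesis phi_le : forall w y, `|phi w y| <= `|y|.
Hypothesis phiI : forall w f, phi w (I f) = f w.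

Lemma fun_bounded_phi y : fun_bounded (phi ^~ y).
Proof. by exists (complex.Re `|y|) => w; rewrite RRe_real // normr_real. Qed.

Definition kernel_extension (y : Y) : X :=
  Bihom (mean_bihom_kernel_pred p q meanL (fun_bounded_phi y)).

Definition kernel_projection (y : Y) : Y := I (kernel_extension y).

Lemma kernel_projection_linear : linear kernel_projection.
Proof.
move=> c x y; rewrite /kernel_projection -linearP; congr (I _).
apply/val_inj/funext => z /=.
have bK : fun_bounded (fun w => bihom_kernel n p q (dot z w)).
  exact/fun_bounded_zonal/fun_bounded_dot.
rewrite -[RHS]/(c * L _ + L _) -(mean_linear meanL); last 2 first.
- by apply: fun_boundedM => //; exact: fun_bounded_phi.
- by apply: fun_boundedM => //; exact: fun_bounded_phi.
congr L; apply/funext => w; rewrite phi_linear; ring.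
Qed.

HB.instance Definition _ := GRing.isLinear.Build C Y Y *:%R kernel_projection
  kernel_projection_linear.

Lemma kernel_projectionI f : kernel_projection (I f) = I f.
Proof.
congr (I _); apply/val_inj/funext => z /=.
under [X in L X]eq_fun do rewrite phiI.
exact: (mean_kernel meanL z (bihomP f)).
Qed.

(** Since [phi w] has norm at most 1, the value at [z] is bounded by [|y|] times the mean of
    [|K(<z,.>)|], which is [bihom_bound] for every [z]. *)
Lemma kernel_projection_norm y : `|kernel_projection y| <= bihom_bound%:C * `|y|.
Proof.
rewrite I_isometry bihom_normE.
have yE : `|y| = (complex.Re `|y|)%:C by rewrite RRe_real // normr_real.
have y0 : 0 <= complex.Re `|y| by rewrite -ler0c -yE.
rewrite yE -rmorphM lecR; apply: sup_norm_le; first by rewrite mulr_ge0 ?bihom_bound_ge0.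
move=> z /=; rewrite rmorphM /= -yE mulrC.
have bK : fun_bounded (fun w => `|bihom_kernel n p q (dot z w)|).
  have [M KM] : fun_bounded (fun w => bihom_kernel n p q (dot z w)).
    exact/fun_bounded_zonal/fun_bounded_dot.
  by exists M => w; rewrite normr_id.
rewrite /bihom_bound -(mean_norm_kernel p q n0 meanL z).
have bK' : fun_bounded (fun w => `|y| * `|bihom_kernel n p q (dot z w)|).
  by apply: fun_boundedM => //; exact: fun_bounded_cst.
have <- : L (fun w => `|y| * `|bihom_kernel n p q (dot z w)|) =
    `|y| * L (fun w => `|bihom_kernel n p q (dot z w)|).
  have := mean_linear meanL `|y| bK (fun_bounded_cst S 0).
  rewrite (mean_cst meanL) addr0 => <-.
  by congr L; apply/funext => w; rewrite addr0.
apply: (mean_norm_le meanL bK') => w.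
by rewrite normrM mulrC ler_wpM2r.
Qed.

Lemma relative_projection_constant_range_le :
  (relative_projection_constant (range I) <= bihom_bound%:E)%E.
Proof.
apply: (@le_trans _ _ (opnorm kernel_projection)).
  apply: ereal_inf_lbound; exists kernel_projection => //; split.
    move=> x; apply/cvgrPdist_le => e e0.
    have K0 : 0 < bihom_bound%:C + 1 by rewrite ltr_wpDl // ler0c bihom_bound_ge0.
    have d0 : 0 < e / (bihom_bound%:C + 1) by rewrite divr_gt0.
    have /cvgrPdist_le/(_ _ d0) : id @ x --> x by exact: cvg_id.
    apply: filterS => y /= xy.
    rewrite -[kernel_projection x - _](linearB kernel_projection).
    apply: le_trans (kernel_projection_norm _) _.
    move: xy; rewrite ler_pdivlMr // => xy; apply: le_trans xy.
    by rewrite mulrC ler_wpM2l // lerDl.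
  split.
    apply/seteqP; split => [_ [y _ <-]|_ [f _ <-]]; first by exists (kernel_extension y).
    by exists (I f) => //; exact: kernel_projectionI.
  by move=> y; exact: kernel_projectionI.
apply: ub_ereal_sup => _ [y /= y1 <-]; rewrite lee_fin -lecR RRe_real ?normr_real //.
apply: le_trans (kernel_projection_norm y) _.
by rewrite ler_piMr // ler0c bihom_bound_ge0.
Qed.

End projection.

Lemma projection_constant_le : (projection_constant X <= bihom_bound%:E)%E.
Proof.
have [L meanL] := sphere_mean_exists R n.
apply: ub_ereal_sup => _ [Y [I [Iiso ->]]].
have ext w : exists g : Y -> C, [/\ forall c x y, g (c *: x + y) = c * g x + g y,
    forall y, `|g y| <= `|y| & forall f : X, g (I f) = f w].
  by apply: (@hahn_banach_complex _ _ _ I (bihom_eval w)) => f; rewrite Iiso norm_bihom_le.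
have [phi phiP] := choice ext.
apply: (@relative_projection_constant_range_le L Y I phi) => //.
- by move=> w; have [] := phiP w.
- by move=> w; have [] := phiP w.
- by move=> w; have [] := phiP w.
Qed.

End upper_bound.

(** * The lower bound *)

Section lower_bound.
Variables (R : realType) (n p q : nat).
Hypothesis n0 : (0 < n)%N.
Local Notation C := R[i].
Local Notation S := (csphere R n.+1).
Local Notation X := (bihom R n.+1 p q).
Local Notation Y := (bounded_function R S).
Local Notation k := ((p - q) + (q - p))%N.
Local Notation J := (shifted_jacobi R n k (minn p q)).

Lemma bounded_pred_of (F : S -> C) : fun_bounded F -> F \in @bounded_pred R S.
Proof. by move=> bF; apply/asboolP. Qed.

Definition to_bounded (F : S -> C) (bF : fun_bounded F) : Y :=
  BoundedFunction (bounded_pred_of bF).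

Definition bihom_inclusion (f : X) : Y := to_bounded (fun_bounded_bihom (bihomP f)).

Lemma bihom_inclusion_linear : linear bihom_inclusion.
Proof. by move=> c f g; apply/val_inj/funext. Qed.

HB.instance Definition _ := GRing.isLinear.Build C X Y *:%R bihom_inclusion
  bihom_inclusion_linear.

Lemma bounded_function_sum (I : Type) (s : seq I) (F : I -> Y) (w : S) :
  (\sum_(i <- s) F i) w = \sum_(i <- s) F i w.
Proof. by elim/big_rec2: _ => // i x y _ <-. Qed.

Lemma zonal_sumJ m (c : nat -> R) (s : C) :
  zonal_sum p q m c (Num.conj s) = Num.conj (zonal_sum p q m c s).
Proof.
rewrite /zonal_sum rmorph_sum; apply: eq_bigr => i _.
rewrite !rmorphM !rmorphXn /=; congr (_ * _).
by rewrite conjC_conjc conjc_real.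
Qed.

Section trace.
Variables (L : (S -> C) -> C) (P : {linear Y -> Y}) (j : nat).
Hypothesis meanL : sphere_mean L.
Hypothesis rangeP : range P = range bihom_inclusion.
Hypothesis idemP : forall y, P (P y) = P y.

Lemma fun_bounded_dual_kernel (z : S) :
  fun_bounded (fun w => dual_kernel n p q j (dot w z)).
Proof.
apply: fun_bounded_zonal; have [M dM] := fun_bounded_dot z.
by exists M => w; rewrite -dotJ norm_conjC.
Qed.

Definition dual_function (z : S) : Y := to_bounded (fun_bounded_dual_kernel z).

Lemma projection_fixes (f : X) : P (bihom_inclusion f) = bihom_inclusion f.
Proof.
have [y _ <-] : range P (bihom_inclusion f) by rewrite rangeP; exists f.
exact: idemP.
Qed.

(** With [h_z] the sum of the [u_l(z) B_l] and [P B_l = f_l] in the space, the mean of [(P h_z)(z)]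
    is that of the sum of the [u_l f_l]. The reproducing property brings in [K], which reduces [P]
    to its action on the space, where it is the identity. *)
Lemma mean_projection_dual : fun_bounded (fun z => P (dual_function z) z) /\
  L (fun z => P (dual_function z) z) =
  (kernel_scale R n p q * radial_mean n (profile_approx k J j))%:C.
Proof.
have [T [e [u [be bu E _]]]] := zonal_expand n p q (size (dual_profile R n p q j))
  (fun i => (dual_profile R n p q j)`_i).
have [T' [a [b [ba bb EK _]]]] := zonal_expand n p q (minn p q) (bihom_kernel_coef R n p q).
pose B l := to_bounded (be l).
have hE z : dual_function z = \sum_l u l z *: B l.
  apply/val_inj/funext => w; rewrite /= /dual_kernel E.
  rewrite [RHS]bounded_function_sum; apply: eq_bigr => l _.
  exact: mulrC.
have [f fE] : {f : T -> X & forall l, P (B l) = bihom_inclusion (f l)}.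
  apply: (@choice T X (fun l fl => P (B l) = bihom_inclusion fl)) => l.
  have : range bihom_inclusion (P (B l)) by rewrite -rangeP; exists (B l).
  by case=> fl _ <-; exists fl.
have bf l : fun_bounded (f l) by exact: (fun_bounded_bihom (bihomP (f l))).
have VE : (fun z => P (dual_function z) z) = fun z => \sum_l u l z * f l z.
  apply/funext => z; rewrite hE linear_sum bounded_function_sum.
  by apply: eq_bigr => l _; rewrite linearZ fE.
have bV : fun_bounded (fun z => P (dual_function z) z).
  by rewrite VE; apply: fun_bounded_sum => l _; exact: fun_boundedM.
split => //.
pose t v l := L (fun z => u l z * bihom_kernel n p q (dot z v)).
have bK v : fun_bounded (fun z : S => bihom_kernel n p q (dot z v)).
  exact: (fun_bounded_bihom (bihom_kernel_pred p q v)).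
(* Replace [f_l(z)] by the mean over [v] of [K(<z,v>) f_l(v)] and exchange the two means using the
   finite expansion of [K]. *)
have -> : L (fun z => P (dual_function z) z) = L (fun v => \sum_l t v l * f l v).
  have sum1 (F : T -> S -> C) : (forall l, fun_bounded (F l)) ->
      L (fun z => \sum_l F l z) = \sum_l L (F l).
    move=> bF; have := mean_sum meanL (index_enum T) (P := xpredT) (fun=> 1) (F := F) (fun l _ => bF l).
    under eq_fun do under eq_bigr do rewrite mul1r.
    by move=> ->; apply: eq_bigr => l _; rewrite mul1r.
  have tE v l : t v l = \sum_m b m v * L (fun z => u l z * a m z).
    rewrite -(mean_sum meanL) => [|m _]; last exact: fun_boundedM.
    congr L; apply/funext => z; rewrite /bihom_kernel EK mulr_sumr.
    by apply: eq_bigr => m _; ring.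
  have bt l : fun_bounded (fun v => t v l).
    under eq_fun do rewrite tE.
    by apply: fun_bounded_sum => m _; apply: fun_boundedM => //; exact: fun_bounded_cst.
  rewrite VE !sum1; [|by move=> l; exact: fun_boundedM..].
  apply: eq_bigr => l _.
  transitivity (\sum_m L (fun v => b m v * f l v) * L (fun z => u l z * a m z)).
    rewrite -(mean_sum meanL) => [|m _]; last exact: fun_boundedM.
    congr L; apply/funext => z; rewrite -(mean_kernel meanL z (bihomP (f l))).
    have -> : L (fun v => bihom_kernel n p q (dot z v) * f l v) =
        \sum_m a m z * L (fun v => b m v * f l v).
      rewrite -(mean_sum meanL) => [|m _]; last exact: fun_boundedM.
      congr L; apply/funext => v; rewrite /bihom_kernel EK mulr_suml.
      by apply: eq_bigr => m _; ring.
    by rewrite mulr_sumr; apply: eq_bigr => m _; ring.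
  transitivity (\sum_m L (fun z => u l z * a m z) * L (fun v => b m v * f l v)).
    by apply: eq_bigr => m _; rewrite mulrC.
  rewrite -(mean_sum meanL) => [|m _]; last exact: fun_boundedM.
  congr L; apply/funext => v; rewrite tE mulr_suml; apply: eq_bigr => m _; ring.
(* For fixed [v], the mean over [z] of [h_z(w) K(<z,v>)] is a function of [w] in the space, hence
   fixed by [P]. Its value at [w = v] is the pairing of the two kernels, the same for all [v]. *)
have -> : (fun v => \sum_l t v l * f l v) = fun=>
    (kernel_scale R n p q * radial_mean n (profile_approx k J j))%:C.
  apply/funext => v.
  have gP : (fun w => L (fun z => dual_kernel n p q j (dot w z) * bihom_kernel n p q (dot z v)))
      \in @bihom_pred R n.+1 p q.
    by apply: mean_zonal_bihom => //; exact: bihom_kernel_pred.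
  have gE : bihom_inclusion (Bihom gP) = \sum_l t v l *: B l.
    apply/val_inj/funext => w; rewrite [RHS]bounded_function_sum /=.
    transitivity (\sum_l e l w * t v l); last by apply: eq_bigr => l _; exact: mulrC.
    rewrite -(mean_sum meanL) => [|l _]; last exact: fun_boundedM.
    congr L; apply/funext => z; rewrite /dual_kernel E mulr_suml.
    by apply: eq_bigr => l _; rewrite mulrA.
  have := projection_fixes (Bihom gP); rewrite {1}gE linear_sum => PgE.
  have -> : \sum_l t v l * f l v = bihom_inclusion (Bihom gP) v.
    rewrite -PgE bounded_function_sum; apply: eq_bigr => l _.
    by rewrite linearZ fE.
  rewrite /= -(mean_dual_kernel p q n0 meanL j v).
  by congr L; apply/funext => z; rewrite -zonal_sumJ dotJ.
exact: mean_cst.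
Qed.

End trace.

End lower_bound.

Section lower_bound_conclusion.
Variables (R : realType) (n p q : nat).
Hypothesis n0 : (0 < n)%N.
Local Notation C := R[i].
Local Notation S := (csphere R n.+1).
Local Notation X := (bihom R n.+1 p q).
Local Notation Y := (bounded_function R S).
Local Notation k := ((p - q) + (q - p))%N.
Local Notation J := (shifted_jacobi R n k (minn p q)).

(** Each [dual_function] has norm at most 1, so the trace of [mean_projection_dual] is at most [r];
    it approaches [bihom_bound] at rate [1 / j]. *)
Lemma opnorm_projection_ge (P : {linear Y -> Y}) (r : R) :
  range P = range (@bihom_inclusion R n p q) -> (forall y, P (P y) = P y) ->
  (forall y : Y, `|y| <= 1 -> `|P y| <= r%:C) -> bihom_bound R n p q <= r.
Proof.
move=> rangeP idemP Pr; have [L meanL] := sphere_mean_exists R n.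
have approx j : kernel_scale R n p q * radial_mean n (profile_approx k J j) <= r.
  have [bV LV] := mean_projection_dual n0 j meanL rangeP idemP.
  have : `|L (fun z => P (dual_function p q j z) z)| <= L (fun=> r%:C).
    apply: (mean_norm_le meanL); first exact: fun_bounded_cst.
    move=> z; apply: le_trans (le_sup_norm z (bounded_functionP _)) _.
    rewrite -bounded_function_normE; apply: Pr.
    apply/(norm_bounded_functionP _ ler01) => w /=.
    exact: (norm_dual_kernel_le1 _ _ _ _ (sqdot_itv w z) (sqdotE w z)).
  rewrite LV (mean_cst meanL) normc_def /= expr0n addr0 sqrtr_sqr lecR.
  exact: le_trans (ler_norm _).
rewrite leNgt; apply/negP => lt.
have d0 : 0 < bihom_bound R n p q - r by rewrite subr_gt0.
have sc0 := kernel_scale_ge0 R n p q.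
suff : bihom_bound R n p q - r = 0 by move=> d; rewrite d ltxx in d0.
apply: (@eq0_of_natmul_le _ _ (kernel_scale R n p q * (2 * profile_bound J))) => j.
rewrite gtr0_norm //; have [_ d1] := radial_mean_approx k J n0 j.
apply: le_trans (ler_wpM2l sc0 d1).
rewrite mulrA ler_wpM2r // mulrBr; apply: lerB => //.
Qed.

Lemma projection_constant_ge : ((bihom_bound R n p q)%:E <= projection_constant X)%E.
Proof.
apply: (@le_trans _ _ (@relative_projection_constant R Y (range (@bihom_inclusion R n p q)))); last first.
  apply: ereal_sup_ubound; exists (bounded_functions_banach R S).
  by exists (@bihom_inclusion R n p q).
apply/ereal_infP => _ [P [_ [rangeP idemP]] <-].
have le_op (y : Y) : `|y| <= 1 -> ((complex.Re `|P y|)%:E <= opnorm P)%E.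
  by move=> y1; apply: ereal_sup_ubound; exists y.
(* The bound is trivial for norm [+oo], and [-oo] is excluded by the value at [y = 0]. *)
case E : (opnorm P) => [r||]; last 2 first.
- exact: leey.
- by have := le_op 0; rewrite normr0 ler01 E leeNy_eq => /(_ isT).
rewrite lee_fin; apply: (opnorm_projection_ge rangeP idemP) => y y1.
by have := le_op y y1; rewrite E lee_fin -lecR RRe_real // normr_real.
Qed.

Lemma projection_constantE : projection_constant X = (bihom_bound R n p q)%:E.
Proof.
by apply/eqP; rewrite eq_le projection_constant_le // projection_constant_ge.
Qed.

End lower_bound_conclusion.

(* The explicit formula *)
Local Close Scope complex_scope.

Theorem theorem5p3 (R : realType) (n p q : nat) (hn : (2 <= n)%N) :
  let M := maxn p q in
  let m := minn p q in
  let k := `|p%:Z - q%:Z|%N in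
  let J := jacobi (n.-1%:R : R) k%:R m in
  let c := Gamma (n%:R + M%:R : R) / (Gamma (n%:R - 1) * Gamma (1 + M%:R)) in
  projection_constant (bihom R n p q) =
    (c * \int[lebesgue_measure]_(t in `[0, 1])
      ((1 - t) ^+ (n - 2) * t `^ (k%:R / 2) * `|J.[2 * t - 1]|))%:E
  /\
  projection_constant (bihom R n p q) =
    (1 / 2 `^ (n%:R - 1 + k%:R / 2) * c * \int[lebesgue_measure]_(s in `[-1, 1])
      ((1 - s) ^+ (n - 2) * (1 + s) `^ (k%:R / 2) * `|J.[s]|))%:E.
Proof.
move=> M m k J c.
(* The dimension becomes [n.+2]; the parameter of the preceding sections is one less than the
   dimension, here [n.+1]. *)
case: n hn @J @c => [|[|n]] // _ J c.
have kE : k = ((p - q) + (q - p))%N by rewrite /k; lia.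
have cE : c = (n.+1 + M)`!%:R / (n`!%:R * M`!%:R).
  rewrite /c; congr (_ / (_ * _)).
  - by rewrite -natrD addSn Gamma_nat.
  - by rewrite -natr1 addrK Gamma_nat.
  - by rewrite addrC natr1 Gamma_nat.
pose I : R := \int[lebesgue_measure]_(t in `[0, 1])
  ((1 - t) ^+ n * profile ((p - q) + (q - p)) (shifted_jacobi R n.+1 ((p - q) + (q - p)) m) t).
have main : projection_constant (bihom R n.+2 p q) = (c * I)%:E.
  rewrite projection_constantE //; congr EFin.
  rewrite /bihom_bound /kernel_scale /profile_integral -/I -/M mulrA; congr (_ * _).
  have n1 : n.+1%:R != 0 :> R by rewrite pnatr_eq0.
  (* The factor [n.+1] of [profile_integral] cancels against the factorial of [n.+1] in
     [kernel_scale]. *)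
  rewrite cE factS !natrM; move: (n.+1%:R) n1 => N1 N10; field.
  by rewrite !fact_neq0 N10.
have i1 : \int[lebesgue_measure]_(t in `[0, 1])
    ((1 - t) ^+ (n.+2 - 2) * t `^ (k%:R / 2) * `|J.[2 * t - 1]|) = I.
  apply: eq_Rintegral => t; rewrite inE /= in_itv /= => /andP[t0 _].
  by rewrite subn2 powR_half_sqrt // -mulrA /J jacobi_shift /profile kE.
split; first by rewrite main i1.
rewrite main; congr EFin.
(* Written with square roots, the integrand is continuous on the whole line, as
   [affine_substitution] requires. *)
pose G (s : R) : R := (1 - s) ^+ n * (Num.sqrt (1 + s) ^+ k * `|J.[s]|).
have cG : continuous G.
  apply: continuous_weight => s.
  have cs : continuous (fun s : R => Num.sqrt (1 + s) ^+ k).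
    move=> x; apply: (@continuous_comp _ _ _ (fun s : R => Num.sqrt (1 + s)) (fun x => x ^+ k)).
      apply: (@continuous_comp _ _ _ (fun s : R => 1 + s) (@Num.sqrt R)).
        by apply: cvgD; [exact: cvg_cst|exact: cvg_id].
      exact: sqrt_continuous.
    exact: exprn_continuous.
  have ca : continuous (fun t : R => `|J.[t]|).
    move=> x; apply: (@continuous_comp _ _ _ (fun t => J.[t]) (fun x : R => `|x|)).
      exact: continuous_horner.
    exact: norm_continuous.
  by apply: cvgM; [exact: cs|exact: ca].
have -> : \int[lebesgue_measure]_(s in `[-1, 1])
    ((1 - s) ^+ (n.+2 - 2) * (1 + s) `^ (k%:R / 2) * `|J.[s]|) =
    \int[lebesgue_measure]_(s in `[-1, 1]) G s.
  apply: eq_Rintegral => s; rewrite inE /= in_itv /= => /andP[s0 _].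
  by rewrite subn2 powR_half_sqrt -?mulrA // -lerBlDl sub0r.
rewrite affine_substitution //.
(* The two weights contribute [2^n] and [(sqrt 2)^k]; the factor 2 of the substitution completes the
   power in front. *)
have -> : \int[lebesgue_measure]_(t in `[0, 1]) G (2 * t - 1) =
    (2 ^+ n * Num.sqrt 2 ^+ k) * I.
  rewrite -RintegralZl //; last first.
    apply: continuous_itv_integrable; apply: continuous_weight; exact: continuous_profile.
  apply: eq_Rintegral => t; rewrite inE /= in_itv /= => /andP[t0 _].
  rewrite /G /profile -jacobi_shift -kE -/J.
  have -> : 1 - (2 * t - 1) = 2 * (1 - t) :> R by ring.
  have -> : 1 + (2 * t - 1) = 2 * t :> R by ring.
  by rewrite sqrtrM // !exprMn; ring.
have -> : n.+2%:R - 1 + k%:R / 2 = n.+1%:R + k%:R / 2 :> R by rewrite -natr1 addrK.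
rewrite powRD; last by rewrite pnatr_eq0 implybT.
rewrite powR_mulrn // powR_half_sqrt // exprS.
have s2 : Num.sqrt 2 ^+ k != 0 :> R by rewrite expf_neq0 // sqrtr_eq0 -ltNge.
have t2 : 2 ^+ n != 0 :> R by rewrite expf_neq0 // pnatr_eq0.
have z2 : 2 != 0 :> R by rewrite pnatr_eq0.
by field; rewrite s2 t2.
Qed.
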